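(* Let $Q$ be a $2\times 2$ canonical $\pi$-periodic matrix function on $\mathbb{R}$, integrable on $[0,\pi)$, and let $\Delta(\lambda)$ be the discriminant of $JY'+QY=\lambda Y$. Then: (a) $Q$ is a.e. $\frac{\pi}{2}$-periodic if and only if $\Delta+2$ has only double zeros. (b) $Q$ is a.e. $\frac{\pi}{2}$-anti-periodic if and only if $\Delta-2$ has only double zeros.
   Context: $J=\left(\begin{array}{cc}0&1\\-1&0\end{array}\right)$, and $\mathbb{I}$ is the $2\times2$ identity matrix. A potential $Q$ is canonical if it has the form $Q=\left(\begin{array}{cc} p & s\\ s & -p\end{array}\right)$ with $p,s$ real valued functions. For $\lambda\in\mathbb{C}$, let $\mathbb{Y}(z)=\mathbb{Y}(z,\lambda)$ be the $2\times 2$ matrix solution (locally absolutely continuous in $z\in\mathbb{R}$, equation holding a.e.) of $JY'+QY=\lambda Y$ with $\mathbb{Y}(0)=\mathbb{I}$. The discriminant is the entire function $\Delta(\lambda)=\mathrm{Tr}\,\mathbb{Y}(\pi,\lambda)$. ''$f$ has only double zeros'' means that every zero of the entire function $f$ of $\lambda$ has multiplicity exactly $2$. A function $F$ is a.e. $\frac{\pi}{2}$-periodic (respectively a.e. $\frac\pi2$-anti-periodic) if $F(z+\frac\pi2)=F(z)$ (respectively $F(z+\frac\pi2)=-F(z)$) for a.e. $z\in\mathbb{R}$. *)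

(* Defs.v *)
From HB Require Import structures.
From mathcomp Require Import all_boot all_order all_algebra.
From mathcomp Require Import all_classical all_reals all_analysis.
From mathcomp Require Export complex.

Set Implicit Arguments.
Unset Strict Implicit.
Unset Printing Implicit Defensive.
Import Order.TTheory GRing.Theory Num.Theory.
Import numFieldNormedType.Exports.

Local Open Scope classical_set_scope.
Local Open Scope ring_scope.
Local Open Scope complex_scope.

Definition mx2 (K : Type) (a b c d : K) : 'M[K]_2 :=
  \matrix_(i, j) if i == 0 then (if j == 0 then a else b)
                 else (if j == 0 then c else d).

Definition Jmx (K : pzRingType) : 'M[K]_2 := mx2 0 1 (- 1) 0.

Definition canonical_potential (R : realType) (Q : R -> 'M[R]_2) : Prop :=
  exists p s : R -> R, forall z, Q z = mx2 (p z) (s z) (s z) (- p z).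

Definition periodic_with (R : realType) (T : R) (Q : R -> 'M[R]_2) : Prop :=
  forall z, Q (z + T) = Q z.

(* The completed measure makes "measurable" mean Lebesgue measurable; with
   [lebesgue_measure] it would only mean Borel measurable. *)
Definition integrable_mx (R : realType) (D : set R) (Q : R -> 'M[R]_2) : Prop :=
  forall i j, (@completed_lebesgue_measure R).-integrable D
                (fun z => (Q z i j)%:E).

Definition ae_periodic (R : realType) (T : R) (Q : R -> 'M[R]_2) : Prop :=
  {ae @completed_lebesgue_measure R, forall z : R, Q (z + T) = Q z}.

Definition ae_antiperiodic (R : realType) (T : R) (Q : R -> 'M[R]_2) : Prop :=
  {ae @completed_lebesgue_measure R, forall z : R, Q (z + T) = - Q z}.

Definition abs_continuous_on (R : realType) (a b : R) (f : R -> R) : Prop :=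
  forall e : R, 0 < e -> exists2 d : R, 0 < d &
    forall (n : nat) (u v : 'I_n -> R),
      (forall k, a <= u k /\ u k <= v k /\ v k <= b) ->
      trivIset setT (fun k => `]u k, v k[%classic) ->
      \sum_(k < n) (v k - u k) < d ->
      \sum_(k < n) `|f (v k) - f (u k)| < e.

Definition loc_abs_continuous (R : realType) (f : R -> R) : Prop :=
  forall a b : R, a <= b -> abs_continuous_on a b f.

(* Complex-valued functions of a real variable are handled through their real
   and imaginary parts: [R[i]] is not a normed module over [R]. *)
Definition loc_abs_continuousC (R : realType) (f : R -> R[i]) : Prop :=
  loc_abs_continuous (fun t => complex.Re (f t)) /\
  loc_abs_continuous (fun t => complex.Im (f t)).

Definition is_deriveC (R : realType) (f : R -> R[i]) (z : R) (d : R[i]) : Prop :=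
  is_derive z 1 (fun t => complex.Re (f t)) (complex.Re d) /\
  is_derive z 1 (fun t => complex.Im (f t)) (complex.Im d).

Definition is_solution (R : realType) (Q : R -> 'M[R]_2) (lam : R[i])
    (Y : R -> 'M[R[i]]_2) : Prop :=
  (forall i j, loc_abs_continuousC (fun t => Y t i j)) /\
  {ae @completed_lebesgue_measure R, forall z : R,
    exists2 Y' : 'M[R[i]]_2,
      (forall i j, is_deriveC (fun t => Y t i j) z (Y' i j)) &
      Jmx _ *m Y' + map_mx (real_complex R) (Q z) *m Y z = lam *: Y z}.

Definition is_fundamental_solution (R : realType) (Q : R -> 'M[R]_2)
    (Y : R[i] -> R -> 'M[R[i]]_2) : Prop :=
  forall lam, is_solution Q lam (Y lam) /\ Y lam 0 = 1%:M.

Definition discriminant (R : realType) (Y : R[i] -> R -> 'M[R[i]]_2)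
    (lam : R[i]) : R[i] := \tr (Y lam pi).

(* Multiplicity as the order of the first nonvanishing derivative; here
   [derive1n] differentiates in the sense of the field [K], hence the
   complex derivative when [K] is [R[i]]. *)
Definition zero_of_multiplicity (K : numFieldType) (f : K -> K) (m : nat)
    (z : K) : Prop :=
  (forall k, (k < m)%N -> derive1n k f z = 0) /\ derive1n m f z <> 0.

Definition only_double_zeros (K : numFieldType) (f : K -> K) : Prop :=
  forall z, f z = 0 -> zero_of_multiplicity f 2 z.

(* Main.v *)
(* In the coordinates y = a (1, i) + b (1, -i), and with w = p + i s, the canonical
   system reads a' = - i lam a + i w^* b, b' = i lam b - i w a. Put L = pi / 2, and
   eps = -1 in (a), eps = 1 in (b): the condition on Q is w (z + L) = - eps w z a.e.,
   and the function of lam is d = tr M - 2 eps with M the monodromy over 2 L.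

   Since (|a|^2 - |b|^2)' = 2 Im lam (|a|^2 + |b|^2), the zeros of d are real and
   |d (lam + i t)| >= k t^2 near a real lam. If w (z + L) = - eps w z, then M is the
   square of diag (1, - eps) X (L), so that d = nu^2 with nu = X00 (L) - eps X11 (L),
   and the lower bound forces nu' <> 0 at the zeros of d.

   Conversely, let C and D be the transfer matrices over [s, s + L] and
   [s + L, s + 2 L] and N = D - eps C^-1 = (M - eps) C^-1. At a double zero of d one
   has M = eps, hence N = 0, and the quotients N_ij N_kl / d are entire; the growth of
   solutions makes them bounded by O (1 + |Im lam|^-2), so they are constant, and the
   constants are read off as Im lam tends to infinity. This says that
   D = S C S with S = diag (1, - eps), and differentiating in s yields
   w (z + L) = - eps w z.

   The only complex analysis needed is the maximum principle and its consequences
   for functions with polynomial expansions of every order at every point, a class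
   closed under products and under the quotients above. *)
Require Import Defs.
From mathcomp Require Import all_boot all_order all_algebra.
From mathcomp Require Import all_classical all_reals all_analysis measurable_realfun.
From mathcomp Require Import ring lra.
Import Order.TTheory GRing.Theory Num.Theory.
Import numFieldNormedType.Exports.
Set Implicit Arguments.
Unset Strict Implicit.
Unset Printing Implicit Defensive.
Local Open Scope classical_set_scope.
Local Open Scope ring_scope.
Local Open Scope complex_scope.

(** Nothing is assumed about the dependence of [Y] on [lam]; analyticity comes from a finite Dyson
    expansion with remainder. As [w] is merely integrable, estimates go through an absolutely
    continuous [h] whose derivative dominates [|w|], and inequalities between derivatives, valid
    almost everywhere, replace integration.

    Expansions of all orders can be divided: if numerator and denominator are of order [k] and the
    denominator is bounded below by a multiple of [|h|^k], the quotient expands again. This removes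
    singularities.

    The bound [|d| >= k t^2] excludes zeros of order above two; its companion
    [|M - eps| <= |d| / (kappa t)] makes [M - eps] vanish at a double zero. Products of two entries
    of [N] are used because each entry has at least a simple zero where [d] has a double one, so no
    square root of [d] has to be chosen. The growth bound is empty on the real axis; a factor
    [(z^2 - r^2)^2] vanishes where the boundary of the square of half side [r] crosses it. The start
    [s] of the window is kept variable so that the final relation can be differentiated in [s]. *)

Section NullSets.
Context {R : realType}.
Local Notation mu := (@lebesgue_measure R).
Local Notation cmu := (@completed_lebesgue_measure R).

(** Both notions amount to outer measure zero, so null sets can be handled through open covers of
    small measure. *)
Lemma completed_negligibleP (N : set R) :
  cmu.-negligible N <-> mu.-negligible N.
Proof.
split=> [[A [mA A0 NA]]|[A [mA A0 NA]]].
  apply/negligible_outer_measure/eqP.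
  by rewrite eq_le outer_measure_ge0 andbT -A0 le_outer_measure.
by exists A; split => //; apply: sub_caratheodory.
Qed.

Lemma negligible_open (N : set R) (e : R) : cmu.-negligible N -> 0 < e ->
  exists U, [/\ open U, N `<=` U & (mu U <= e%:E)%E].
Proof.
move=> /completed_negligibleP/negligible_outer_measure N0 e0.
by have := @outer_measure_open_le R N _ e0; rewrite N0 add0e.
Qed.

Lemma open_negligible (N : set R) :
  (forall e : R, 0 < e -> exists U, [/\ open U, N `<=` U & (mu U <= e%:E)%E]) ->
  cmu.-negligible N.
Proof.
move=> h; apply/completed_negligibleP/negligible_outer_measure/eqP.
rewrite eq_le outer_measure_ge0 andbT; apply/lee_addgt0Pr => e /h[U [_ NU Ue]].
by rewrite add0e; apply: le_trans Ue; exact: le_outer_measure.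
Qed.

Lemma lebesgue_measure_shift (c : R) (A : set R) : measurable A ->
  mu ((fun x => x + c) @^-1` A) = mu A.
Proof.
have mf : measurable_fun [set: R] (fun x : R => x + c).
  by apply: measurable_realfun.measurable_funD.
move=> mA; apply/esym.
have := @lebesgue_measure_unique R
  (pushforward mu ((fun x : R => x + c) : measurableTypeR R -> measurableTypeR R)).
apply => // X /ocitvP[->|[[a b] /= ab ->]].
  by rewrite !measure0.
rewrite /pushforward.
rewrite (_ : _ @^-1` _ = `]a - c, b - c]%classic).
  by rewrite !lebesgue_measure_itv/= !lte_fin ltrD2r; case: ifP => // _;
    rewrite -!EFinB; congr EFin; ring.
by apply/seteqP; split => x /=; rewrite !in_itv/= ltrBlDr lerBrDr.
Qed.

Lemma negligible_shift (c : R) (N : set R) : cmu.-negligible N ->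
  cmu.-negligible ((fun x => x + c) @^-1` N).
Proof.
move=> Nn; apply: open_negligible => e e0.
have [U [oU NU Ue]] := negligible_open Nn e0.
exists ((fun x => x + c) @^-1` U); split.
- apply: open_comp => // x _.
  by apply: continuousD; [exact: cvg_id|exact: cvg_cst].
- by move=> x; exact: NU.
- by rewrite lebesgue_measure_shift//; exact: open_measurable.
Qed.

Lemma ae_shift (c : R) (P : R -> Prop) : {ae cmu, forall z, P z} ->
  {ae cmu, forall z, P (z + c)}.
Proof. by move=> /(@negligible_shift c). Qed.

Lemma ae_neq (a : R) : {ae cmu, forall z, z <> a}.
Proof.
apply/completed_negligibleP; exists [set a]; split => //.
- exact: lebesgue_measure_set1.
- by move=> x /=; rewrite notE.
Qed.

Lemma ae_and (P Q : R -> Prop) : {ae cmu, forall z, P z} ->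
  {ae cmu, forall z, Q z} -> {ae cmu, forall z, P z /\ Q z}.
Proof. by move=> hP hQ; apply: (@filterI _ _ (ae_filter_ringOfSetsType cmu)). Qed.

Lemma ae_imply (P Q : R -> Prop) : (forall z, P z -> Q z) ->
  {ae cmu, forall z, P z} -> {ae cmu, forall z, Q z}.
Proof. by move=> PQ; apply: (@filterS _ _ (ae_filter_ringOfSetsType cmu)). Qed.

Lemma ae_imply2 (P P' Q : R -> Prop) : (forall z, P z -> P' z -> Q z) ->
  {ae cmu, forall z, P z} -> {ae cmu, forall z, P' z} ->
  {ae cmu, forall z, Q z}.
Proof. by move=> PQ; apply: (@filterS2 _ _ (ae_filter_ringOfSetsType cmu)). Qed.

Lemma sum_itv_le_measure (U : set R) (e : R) n (u v : 'I_n -> R) :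
  open U -> (mu U <= e%:E)%E ->
  (forall k, u k <= v k) -> (forall k, `]u k, v k[ `<=` U) ->
  trivIset setT (fun k => `]u k, v k[%classic) ->
  \sum_(k < n) (v k - u k) <= e.
Proof.
move=> oU Ue uv sU tI.
have sub : \big[setU/set0]_(k < n) `]u k, v k[%classic `<=` U.
  apply: (big_ind (fun X => X `<=` U)) => [|A B AU BU|k _]; [exact: sub0set|by rewrite subUset|exact: sU].
have : (mu (\big[setU/set0]_(k < n) `]u k, v k[%classic) <= mu U)%E.
  apply: le_measure; rewrite ?inE//; last exact: open_measurable.
  by apply: bigsetU_measurable => k _; exact: measurable_itv.
rewrite measure_bigsetU_ord//= => h.
rewrite -lee_fin; apply: le_trans (le_trans h Ue).
rewrite -sumEFin; apply: lee_sum => k _.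
rewrite lebesgue_measure_itv/= lte_fin; case: ltP => //.
by move=> vu; rewrite lee_fin subr_le0.
Qed.

End NullSets.

Section DerivativeBound.
Context {K : numFieldType}.

(** Multiplying out the difference quotient admits [h = 0]. The field is general because the real
    case serves monotonicity and the converse below serves complex derivatives. *)
Lemma is_derive_bound (f : K -> K) (z d e : K) : is_derive z 1 f d -> 0 < e ->
  exists2 r : K, 0 < r & forall h, `|h| < r ->
    `|f (z + h) - f z - d * h| <= e * `|h|.
Proof.
move=> [df dE] e0.
have cv : h^-1 *: (f (h *: 1 + z) - f z) @[h --> 0^'] --> d.
  by rewrite -dE; exact: df.
have /cvgrPdist_le/(_ e e0) := cv.
rewrite near_withinE => /nbhs_ballP[r /= r0 hr].
exists r => // h hlt.
have [->|h0] := eqVneq h 0; first by rewrite addr0 mulr0 subrr subr0 !normr0 mulr0.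
have := hr h; rewrite /ball/= sub0r normrN => /(_ hlt h0).
rewrite distrC -(ler_pM2r (x := `|h|)) ?normr_gt0// -normrM.
rewrite /GRing.scale/= mulr1 (addrC h z) mulrBl.
by rewrite mulrAC mulVf// mul1r.
Qed.

Lemma bound_is_derive (f : K -> K) (z d : K) :
  (forall e : K, 0 < e -> exists2 r : K, 0 < r & forall h, `|h| < r ->
    `|f (z + h) - f z - d * h| <= e * `|h|) -> is_derive z 1 f d.
Proof.
move=> H.
have cv : h^-1 *: (f (h *: 1 + z) - f z) @[h --> 0^'] --> d.
  apply/cvgrPdist_le => e /H[r r0 hr].
  rewrite near_withinE; apply/nbhs_ballP; exists r => //= h.
  rewrite /ball/= sub0r normrN => /hr {}hr h0.
  rewrite distrC -(ler_pM2r (x := `|h|)) ?normr_gt0// -normrM.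
  rewrite /GRing.scale/= mulr1 (addrC h z) mulrBl.
  by rewrite mulrAC mulVf// mul1r.
by apply: DeriveDef; [apply/cvg_ex; exists d|exact: cvg_lim cv].
Qed.

End DerivativeBound.

(** * Absolutely continuous functions *)

Section Monotone.
Context {R : realType}.
Local Notation cmu := (@completed_lebesgue_measure R).

Section Chain.
Variables (f : R -> R) (U : set R) (a e : R).
Hypothesis e0 : 0 <= e.

(* [f x - f a] is bounded below up to the oscillation of [f] over finitely many
   successive intervals of [U] *)
Definition chain (x : R) := exists n (u v : nat -> R), [/\
  forall k, (k < n)%N ->
    [/\ a <= u k, u k <= v k, v k <= x & `]u k, v k[ `<=` U],
  forall i j, (i < j)%N -> (j < n)%N -> v i <= u j &
  - e * (x - a) - \sum_(k < n) `|f (v k) - f (u k)| <= f x - f a].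

Lemma chain_left : chain a.
Proof.
by exists 0%N, (fun=> 0), (fun=> 0); split => //; rewrite big_ord0 !subrr mulr0 subr0.
Qed.

Lemma chain_slope x y : x <= y -> - e * (y - x) <= f y - f x ->
  chain x -> chain y.
Proof.
move=> xy fxy [n [u [v [huv hij hs]]]]; exists n, u, v; split => //.
  by move=> k /huv[? ? vx ?]; split => //; exact: le_trans vx xy.
by move: fxy hs; lra.
Qed.

(** The new interval joins the list and its own oscillation is charged to the sum. *)
Lemma chain_itv x y : a <= x -> x <= y -> `]x, y[ `<=` U -> chain x -> chain y.
Proof.
move=> ax xy xyU [n [u [v [huv hij hs]]]].
exists n.+1, (fun k => if (k < n)%N then u k else x),
  (fun k => if (k < n)%N then v k else y); split.
- move=> k _; case: ifPn => [/huv[? ? vx ?]|_]; split => //.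
  exact: le_trans vx xy.
- move=> i j ij; rewrite ltnS leq_eqVlt => /orP[/eqP jn|jn].
    have i_n : (i < n)%N by rewrite -jn.
    by rewrite i_n jn ltnn; have [] := huv _ i_n.
  by rewrite jn (ltn_trans ij jn); exact: hij.
- rewrite big_ord_recr/= ltnn.
  under eq_bigr do rewrite ltn_ord/=.
  have := ler_norm (- (f y - f x)); rewrite normrN.
  have: 0 <= e * (y - x) by rewrite mulr_ge0// subr_ge0.
  move: hs; set S := \sum_(_ < _) _; set T := `|_|.
  by lra.
Qed.

End Chain.

(* Real induction along [chain]: near a point outside the null set the slope is at
   least [- e], and the null set is covered by an open set so small that the
   oscillation of [f] over its intervals is negligible. *)
Lemma ac_nondecreasing (f g : R -> R) (a b : R) : a <= b ->
  loc_abs_continuous f ->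
  {ae cmu, forall z, a < z < b -> is_derive z 1 f (g z) /\ 0 <= g z} ->
  f a <= f b.
Proof.
move=> ab acf aeg; apply/ler_addgt0Pr => e0 e0_gt0.
have ba1 : 0 < b - a + 1 by rewrite ltr_wpDl// subr_ge0.
(* The total loss will be [e * (b - a)] from the slopes plus [e] from the oscillation over [U],
   hence the [+ 1]. *)
pose e := e0 / (b - a + 1); have e_gt0 : 0 < e by exact: divr_gt0.
have [d d0 hd] := acf a b ab e e_gt0.
(* The slope is known only inside the interval, so the endpoints join the exceptional set and are
   covered by [U]. *)
have {}aeg : {ae cmu, forall z, (z <> a /\ z <> b) /\
    (a < z < b -> is_derive z 1 f (g z) /\ 0 <= g z)}.
  by apply: ae_and aeg; apply: ae_and; exact: ae_neq.
have [U [oU NU Ud]] := negligible_open aeg (divr_gt0 d0 (ltr0n R 2)).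
(* One end of the step is [s]: with [y = s] the chain reaches the supremum, with [x = s] it passes
   beyond it. *)
have local s : a <= s -> s <= b -> exists2 r, 0 < r & forall x y,
    a <= x -> x <= y -> y <= b -> x = s \/ y = s -> y - x < r ->
    chain f U a e x -> chain f U a e y.
  move=> as_ sb; have [Us|Us] := pselect (U s).
    have /nbhs_ballP[r /= r0 hr] : nbhs s U by exact: open_nbhs_nbhs.
    exists r => // x y ax xy yb xys yxr; apply: (chain_itv (ltW e_gt0)) => //.
    move=> z /=; rewrite in_itv/= => /andP[xz zy]; apply: hr.
    rewrite /ball/= ltr_distlC.
    by case: xys => <-; apply/andP; split; lra.
  have [[sa sb'] hs] : (s <> a /\ s <> b) /\
      (a < s < b -> is_derive s 1 f (g s) /\ 0 <= g s).
    by apply: contrapT => h; apply/Us/NU.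
  have [|ds gs] := hs.
    by rewrite !lt_neqAle as_ sb !andbT; apply/andP; split; apply/eqP => // /esym.
  have [r r0 hr] := is_derive_bound ds e_gt0.
  exists r => // x y ax xy yb xys yxr; apply: chain_slope => //.
  have xy0 : 0 <= y - x by rewrite subr_ge0.
  case: xys => ?; subst s.
    have := hr (y - x); rewrite ger0_norm// => /(_ yxr).
    by rewrite (_ : x + (y - x) = y) ?ler_norml; [move=> /andP[h _]; nra|ring].
  have := hr (x - y); rewrite distrC ger0_norm// => /(_ yxr).
  by rewrite (_ : y + (x - y) = x) ?ler_norml; [move=> /andP[_ h]; nra|ring].
pose S := [set x | a <= x <= b /\ chain f U a e x].
have Sa : S a by split; [rewrite lexx|exact: chain_left].
have hasS : has_sup S.
  by split; [exists a|exists b => x [/andP[]]].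
have as_ : a <= sup S by exact: (ub_le_sup hasS.2 Sa).
have sb : sup S <= b by apply: ge_sup => [|x [/andP[]]//]; exists a.
have [r r0 hr] := local _ as_ sb.
have [x [/andP[ax xb] Sx] sx] := sup_adherent r0 hasS.
have xs : x <= sup S by apply: (ub_le_sup hasS.2); split => //; rewrite ax.
have chs : chain f U a e (sup S).
  by apply: (hr x) => //; [right|lra].
have chb : chain f U a e b.
  have [->//|sneb] := eqVneq b (sup S).
  have sltb : sup S < b by rewrite lt_neqAle eq_sym sneb.
  pose y := Num.min b (sup S + r / 2).
  have sy : sup S < y by rewrite lt_min sltb/= ltrDl divr_gt0.
  have yb : y <= b by rewrite ge_min lexx.
  have ysr : y <= sup S + r / 2 by rewrite ge_min lexx orbT.
  have : S y.
    split; first by rewrite yb andbT (le_trans as_)// ltW.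
    by apply: (hr (sup S)) => //; [exact: ltW|left|lra].
  by move=> /(ub_le_sup hasS.2); rewrite leNgt sy.
have [n [u [v [huv hij]]]] := chb.
have lt1 (k : 'I_n) : [/\ a <= u k, u k <= v k, v k <= b & `]u k, v k[ `<=` U].
  exact: huv.
have tI : trivIset setT (fun k : 'I_n => `]u k, v k[%classic).
  apply/trivIsetP => i j _ _ ij; rewrite -subset0 => z /=.
  rewrite !in_itv/= => -[/andP[uz zv] /andP[uz' zv']].
  have [ltij|ltij] : (i < j)%N \/ (j < i)%N.
    by move: ij; rewrite -val_eqE/= neq_ltn => /orP.
    have := hij _ _ ltij (ltn_ord j); move/(lt_le_trans zv)/(lt_trans uz').
    by rewrite ltxx.
  have := hij _ _ ltij (ltn_ord i); move/(lt_le_trans zv')/(lt_trans uz).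
  by rewrite ltxx.
have := hd n (fun k => u k) (fun k => v k).
move=> /(_ _ tI) hd'.
have {hd'} : \sum_(k < n) `|f (v k) - f (u k)| < e.
  apply: hd'; first by move=> k; have [? ? ? ?] := lt1 k.
  apply: (@le_lt_trans _ _ (d / 2)); last by lra.
  by apply: (sum_itv_le_measure oU Ud) => // k; have [] := lt1 k.
have -> : e0 = e * (b - a + 1) by rewrite /e divfK// gt_eqF.
by set T := \sum_(_ < _) _ => h1 h2; lra.
Qed.

End Monotone.

Notation cn := ComplexField.Normc.normc.

(** * Modulus, real and imaginary parts of complex numbers *)

Section ComplexModulus.
Context {R : realType}.
Implicit Types x y : R[i].

Lemma normcE x : `|x| = (cn x)%:C. Proof. by []. Qed.

Lemma cn_sqr x : cn x ^+ 2 = complex.Re x ^+ 2 + complex.Im x ^+ 2.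
Proof. by case: x => a b /=; rewrite sqr_sqrtr// addr_ge0// sqr_ge0. Qed.

Lemma cn_ge0 x : 0 <= cn x.
Proof. by case: x => a b /=; exact: sqrtr_ge0. Qed.

Lemma cn0 : cn (0 : R[i]) = 0. Proof. exact: ComplexField.Normc.normc0. Qed.

Lemma cn1 : cn (1 : R[i]) = 1. Proof. exact: ComplexField.Normc.normc1. Qed.

Lemma cnM x y : cn (x * y) = cn x * cn y.
Proof. exact: ComplexField.Normc.normcM. Qed.

Lemma cnV x : cn x^-1 = (cn x)^-1.
Proof. exact: ComplexField.Normc.normcV. Qed.

Lemma cnX x n : cn (x ^+ n) = cn x ^+ n.
Proof. by elim: n => [|n IH]; rewrite ?expr0 ?cn1// !exprS cnM IH. Qed.

Lemma cnN x : cn (- x) = cn x.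
Proof. by case: x => a b /=; rewrite !sqrrN. Qed.

Lemma cnD x y : cn (x + y) <= cn x + cn y.
Proof. exact: le_normcD. Qed.

Lemma cnB x y : cn (x - y) <= cn x + cn y.
Proof. by rewrite -(cnN y) cnD. Qed.

Lemma cn_dist x y : cn (x - y) = cn (y - x).
Proof. by rewrite -cnN opprB. Qed.

Lemma cn_eq0 x : (cn x == 0) = (x == 0).
Proof.
by apply/eqP/eqP => [|->]; [exact: ComplexField.Normc.eq0_normc|exact: cn0].
Qed.

Lemma cn_gt0 x : (0 < cn x) = (x != 0).
Proof. by rewrite lt_neqAle cn_ge0 andbT eq_sym cn_eq0. Qed.

Lemma cnJ x : cn (x^*)%C = cn x.
Proof. by case: x => a b /=; rewrite sqrrN. Qed.

Lemma cn_real (a : R) : cn a%:C = `|a|.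
Proof. by rewrite /= expr0n/= addr0 sqrtr_sqr. Qed.

Lemma Re_le_cn x : `|complex.Re x| <= cn x.
Proof.
rewrite -(@ler_pXn2r _ 2) ?nnegrE ?cn_ge0// cn_sqr real_normK ?num_real//.
by rewrite lerDl sqr_ge0.
Qed.

Lemma Im_le_cn x : `|complex.Im x| <= cn x.
Proof.
rewrite -(@ler_pXn2r _ 2) ?nnegrE ?cn_ge0// cn_sqr real_normK ?num_real//.
by rewrite lerDr sqr_ge0.
Qed.

Lemma cn_le x : cn x <= `|complex.Re x| + `|complex.Im x|.
Proof.
rewrite -(@ler_pXn2r _ 2) ?nnegrE ?cn_ge0 ?addr_ge0// cn_sqr sqrrD.
by rewrite !real_normK ?num_real// -addrA lerD2l lerDr mulrn_wge0// mulr_ge0.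
Qed.

Lemma cReD x y : complex.Re (x + y) = complex.Re x + complex.Re y.
Proof. by case: x y => [? ?] [? ?]. Qed.
Lemma cImD x y : complex.Im (x + y) = complex.Im x + complex.Im y.
Proof. by case: x y => [? ?] [? ?]. Qed.
Lemma cReN x : complex.Re (- x) = - complex.Re x.
Proof. by case: x => [? ?]. Qed.
Lemma cImN x : complex.Im (- x) = - complex.Im x.
Proof. by case: x => [? ?]. Qed.
Lemma cReM x y : complex.Re (x * y) =
  complex.Re x * complex.Re y - complex.Im x * complex.Im y.
Proof. by case: x y => [? ?] [? ?]. Qed.
Lemma cImM x y : complex.Im (x * y) =
  complex.Re x * complex.Im y + complex.Im x * complex.Re y.
Proof. by case: x y => [? ?] [? ?]. Qed.
Lemma cReJ x : complex.Re (x^*)%C = complex.Re x.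
Proof. by case: x => [? ?]. Qed.
Lemma cImJ x : complex.Im (x^*)%C = - complex.Im x.
Proof. by case: x => [? ?]. Qed.

Lemma complex_eqP x y :
  complex.Re x = complex.Re y -> complex.Im x = complex.Im y -> x = y.
Proof. by case: x y => [? ?] [? ?] /= -> ->. Qed.

End ComplexModulus.

(** * Calculus of absolutely continuous functions and their derivatives *)

Section AbsContinuity.
Context {R : realType}.
Local Notation cmu := (@completed_lebesgue_measure R).
Implicit Types f g h : R -> R.

(** Sums, products and compositions all reduce to this: it is enough to bound the oscillation of [F]
    locally by those of two known functions. *)
Lemma ac_dominated F f g :
  (forall a b, a <= b -> exists2 K, 0 <= K & forall x y, a <= x <= b ->
    a <= y <= b -> `|F x - F y| <= K * (`|f x - f y| + `|g x - g y|)) ->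
  loc_abs_continuous f -> loc_abs_continuous g -> loc_abs_continuous F.
Proof.
move=> H acf acg a b ab e e0.
have [K K0 hK] := H a b ab.
pose e' := e / (2 * (K + 1)).
have e'0 : 0 < e' by rewrite divr_gt0// mulr_gt0// ltr_wpDl.
have [d1 d10 h1] := acf a b ab e' e'0.
have [d2 d20 h2] := acg a b ab e' e'0.
exists (Num.min d1 d2) => [|n u v uv tI]; first by rewrite lt_min d10.
rewrite lt_min => /andP[/(h1 n u v uv tI) s1 /(h2 n u v uv tI) s2].
have : \sum_(k < n) `|F (v k) - F (u k)| <=
    K * (\sum_(k < n) `|f (v k) - f (u k)| + \sum_(k < n) `|g (v k) - g (u k)|).
  rewrite -big_split/= mulr_sumr; apply: ler_sum => k _.
  have [auk [uvk vkb]] := uv k.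
  by apply: hK; apply/andP; split => //; [exact: le_trans uvk|exact: le_trans vkb].
move=> /le_lt_trans; apply.
have -> : e = 2 * (K + 1) * e' by rewrite /e' mulrC divfK// gt_eqF// mulr_gt0// ltr_wpDl.
set s := \sum_(_ < _) _ in s1 *; set t := \sum_(_ < _) _ in s2 *.
by nra.
Qed.

Lemma ac_continuous f : loc_abs_continuous f -> continuous f.
Proof.
move=> acf z; apply/cvgrPdist_lt => e e0.
have [d d0 hd] := acf (z - 1) (z + 1) ltac:(lra) e e0.
have near u v : z - 1 <= u -> u <= v -> v <= z + 1 -> v - u < d ->
    `|f v - f u| < e.
  move=> zu uv vz uvd; have := hd 1%N (fun=> u) (fun=> v).
  rewrite !big_ord1; apply => //.
  by apply/trivIsetP => i j; rewrite !ord1 eqxx.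
apply/nbhs_ballP; exists (Num.min d 1) => /= [|t]; first by rewrite lt_min d0 ltr01.
rewrite /ball/= lt_min => /andP[/ltr_normlP[? ?] /ltr_normlP[? ?]].
have [zt|/ltW tz] := leP z t.
  by rewrite distrC; apply: near => //; lra.
by apply: near => //; lra.
Qed.

Lemma ac_bounded f a b : loc_abs_continuous f ->
  exists2 M, 0 <= M & forall x, a <= x <= b -> `|f x| <= M.
Proof.
move=> /ac_continuous cf; have [ab|ba] := leP a b; last first.
  by exists 0 => // x /andP[ax xb]; have := le_trans ax xb; rewrite leNgt ba.
have cnf : {within `[a, b], continuous (fun x => `|f x|)}.
  apply: continuous_subspaceT => x.
  exact: (continuous_comp (cf x) (@norm_continuous _ _ _)).
have [c _ hc] := EVT_max ab cnf.
by exists `|f c| => // x xab; apply: hc; rewrite in_itv.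
Qed.

Lemma is_derive_continuous f g : (forall z : R, is_derive z 1 f (g z)) -> continuous f.
Proof.
move=> df z; apply: differentiable_continuous.
by apply/derivable1_diffP; have [] := df z.
Qed.

Lemma derive_lipschitz f g a b : (forall z : R, is_derive z 1 f (g z)) ->
  continuous g -> exists2 K, 0 <= K & forall x y, a <= x <= b -> a <= y <= b ->
    `|f x - f y| <= K * `|x - y|.
Proof.
move=> df cg.
have [M M0 hM] : exists2 M, 0 <= M & forall x, a <= x <= b -> `|g x| <= M.
  have [ab|ba] := leP a b; last first.
    by exists 0 => // x /andP[ax xb]; have := le_trans ax xb; rewrite leNgt ba.
  have cng : {within `[a, b], continuous (fun x => `|g x|)}.
    apply: continuous_subspaceT => x.
    exact: (continuous_comp (cg x) (@norm_continuous _ _ _)).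
  have [c _ hc] := EVT_max ab cng.
  by exists `|g c| => // x xab; apply: hc; rewrite in_itv.
exists M => //.
have main x y : a <= x <= b -> a <= y <= b -> x <= y -> `|f x - f y| <= M * `|x - y|.
  move=> /andP[ax xb] /andP[ay yb] xy; rewrite distrC (distrC x).
  have [|c] := MVT_segment xy (fun z _ => df z).
    by apply: continuous_subspaceT; exact: is_derive_continuous df.
  rewrite in_itv/= => /andP[xc cy] ->; rewrite normrM ler_wpM2r//.
  by apply: hM; rewrite (le_trans ax)// (le_trans cy).
move=> x y hx hy; have [xy|/ltW yx] := leP x y; first exact: main.
by rewrite distrC (distrC x); exact: main.
Qed.

Lemma ac_id : loc_abs_continuous (@id R).
Proof.
move=> a b ab e e0; exists e => // n u v uv _ s.
rewrite (eq_bigr (fun k => v k - u k)) // => k _ /=.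
by rewrite ger0_norm// subr_ge0 (uv k).2.1.
Qed.

Lemma derive_ac f g : (forall z : R, is_derive z 1 f (g z)) -> continuous g ->
  loc_abs_continuous f.
Proof.
move=> df cg; apply: (@ac_dominated _ id id); [|exact: ac_id..] => a b ab.
have [K K0 hK] := derive_lipschitz a b df cg.
exists K => // x y hx hy; apply: le_trans (hK x y hx hy) _.
by rewrite ler_wpM2l// lerDl.
Qed.

Lemma ac_shift f c : loc_abs_continuous f -> loc_abs_continuous (fun z => f (z + c)).
Proof.
move=> acf a b ab e e0; have [|d d0 hd] := acf (a + c) (b + c) _ e e0.
  by rewrite lerD2r.
exists d => // n u v uv tI s; apply: (hd n (fun k => u k + c) (fun k => v k + c)).
- by move=> k; have [? [? ?]] := uv k; rewrite !lerD2r.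
- apply/trivIsetP => i j _ _ ij; rewrite -subset0 => z /=.
  rewrite !in_itv/= => -[h1 h2].
  have := (trivIsetP.1 tI) i j I I ij; rewrite -subset0 => /(_ (z - c)); apply.
  by rewrite /= !in_itv/= !ltrBrDr !ltrBlDr.
- by under eq_bigr do rewrite opprD addrACA subrr addr0.
Qed.

(** The derivative travels with the function as data, being determined only almost everywhere; the
    rules below compute on such pairs. *)
Definition acd f g := loc_abs_continuous f /\ {ae cmu, forall z : R, is_derive z 1 f (g z)}.

Lemma derive_acd f g : (forall z : R, is_derive z 1 f (g z)) -> continuous g -> acd f g.
Proof.
move=> df cg; split; first exact: derive_ac df cg.
exact: aeW.
Qed.

Lemma acd_cst (c : R) : acd (fun=> c) (fun=> 0).
Proof. by apply: derive_acd => z; exact: cvg_cst. Qed.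

Lemma acd_id : acd id (fun=> 1).
Proof. by apply: derive_acd => z; exact: cvg_cst. Qed.

Lemma acd_eq f g f' g' : (forall z, f z = f' z) -> (forall z, g z = g' z) ->
  acd f g -> acd f' g'.
Proof. by move=> /funext -> /funext ->. Qed.

Lemma acdD f f' g g' : acd f f' -> acd g g' ->
  acd (fun z => f z + g z) (fun z => f' z + g' z).
Proof.
move=> [acf df] [acg dg]; split.
  apply: (@ac_dominated _ f g) => // a b _; exists 1 => // x y _ _.
  by rewrite mul1r opprD addrACA ler_normD.
by apply: (ae_imply2 _ df dg) => z; exact: is_deriveD.
Qed.

Lemma acdN f f' : acd f f' -> acd (fun z => - f z) (fun z => - f' z).
Proof.
move=> [acf df]; split.
  apply: (@ac_dominated _ f f) => // a b _; exists 1 => // x y _ _.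
  by rewrite mul1r -opprD normrN lerDl.
by apply: (ae_imply _ df) => z; exact: is_deriveN.
Qed.

Lemma acdB f f' g g' : acd f f' -> acd g g' ->
  acd (fun z => f z - g z) (fun z => f' z - g' z).
Proof. by move=> hf hg; apply: acdD => //; exact: acdN. Qed.

Lemma acdM f f' g g' : acd f f' -> acd g g' ->
  acd (fun z => f z * g z) (fun z => f' z * g z + f z * g' z).
Proof.
move=> [acf df] [acg dg]; split.
  apply: (@ac_dominated _ f g) => // a b _.
  have [M M0 hM] := ac_bounded a b acf; have [N N0 hN] := ac_bounded a b acg.
  exists (M + N) => [|x y hx hy]; first exact: addr_ge0.
  rewrite (_ : _ - _ = (f x - f y) * g x + f y * (g x - g y)); last by ring.
  apply: le_trans (ler_normD _ _) _; rewrite !normrM.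
  have := hN x hx; have := hM y hy.
  have := normr_ge0 (f x - f y); have := normr_ge0 (g x - g y).
  have := normr_ge0 (f y); have := normr_ge0 (g x).
  by nra.
apply: (ae_imply2 _ df dg) => z dfz dgz.
apply: (is_derive_eq (is_deriveM dfz dgz)).
by rewrite /GRing.scale/=; ring.
Qed.

Lemma acd_comp (phi dphi : R -> R) f f' : (forall z : R, is_derive z 1 phi (dphi z)) ->
  continuous dphi -> acd f f' -> acd (fun z => phi (f z)) (fun z => f' z * dphi (f z)).
Proof.
move=> dp cp [acf df]; split.
  apply: (@ac_dominated _ f f) => // a b _.
  have [M M0 hM] := ac_bounded a b acf.
  have [K K0 hK] := derive_lipschitz (- M) M dp cp.
  exists K => // x y /hM hx /hM hy.
  apply: (le_trans (hK _ _ _ _)); rewrite -?ler_norml//.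
  by rewrite ler_wpM2l// lerDl.
apply: (ae_imply _ df) => z dfz.
apply: (is_derive_eq (is_derive1_comp (dp (f z)) dfz)).
by rewrite /GRing.scale/=; ring.
Qed.

Lemma acd_shift f f' c : acd f f' -> acd (fun z => f (z + c)) (fun z => f' (z + c)).
Proof.
move=> [acf df]; split; first exact: ac_shift.
apply: (ae_imply _ (ae_shift c df)) => z dz.
have ds : is_derive z 1 (fun z : R => z + c) (1 : R).
  by apply: (is_derive_eq (is_deriveD (is_derive_id z 1) (is_derive_cst c z 1))); rewrite addr0.
apply: (is_derive_eq (@is_derive1_comp R f (fun z : R => z + c) z _ _ dz ds)).
by rewrite ?scale1r ?mulr1.
Qed.

Lemma acd_sub_derive f f' f'' : acd f f' ->
  {ae cmu, forall z, f' z = f'' z} -> acd f f''.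
Proof. by move=> [acf df] h; split => //; apply: (ae_imply2 _ df h) => z dz <-. Qed.

(** This does the work of the fundamental theorem of calculus: an integral estimate becomes a sign
    condition on the derivative of a difference. *)
Lemma acd_le f f' a b : a <= b -> acd f f' ->
  {ae cmu, forall z, a < z < b -> 0 <= f' z} -> f a <= f b.
Proof.
move=> ab [acf df] h; apply: (ac_nondecreasing (g := f')) => //.
by apply: (ae_imply2 _ df h) => z dz hz /hz.
Qed.

End AbsContinuity.

Lemma ord2P (i : 'I_2) : i = 0 \/ i = 1.
Proof. by case: i => [[|[|//]] hi]; [left|right]; exact/val_inj. Qed.

(** * Complex and matrix valued absolutely continuous functions *)

Section ComplexAbsContinuity.
Context {R : realType}.
Local Notation cmu := (@completed_lebesgue_measure R).
Implicit Types f g : R -> R[i].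

Definition cacd f f' :=
  acd (fun z => complex.Re (f z)) (fun z => complex.Re (f' z)) /\
  acd (fun z => complex.Im (f z)) (fun z => complex.Im (f' z)).

Lemma cacd_eq f f' g g' : (forall z, f z = g z) -> (forall z, f' z = g' z) ->
  cacd f f' -> cacd g g'.
Proof. by move=> /funext -> /funext ->. Qed.

Lemma cacd_cst (c : R[i]) : cacd (fun=> c) (fun=> 0).
Proof. by split; exact: acd_cst. Qed.

Lemma cacdD f f' g g' : cacd f f' -> cacd g g' ->
  cacd (fun z => f z + g z) (fun z => f' z + g' z).
Proof.
move=> [f1 f2] [g1 g2]; split.
  by apply: (acd_eq _ _ (acdD f1 g1)) => z; rewrite cReD.
by apply: (acd_eq _ _ (acdD f2 g2)) => z; rewrite cImD.
Qed.

Lemma cacdN f f' : cacd f f' -> cacd (fun z => - f z) (fun z => - f' z).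
Proof.
move=> [f1 f2]; split.
  by apply: (acd_eq _ _ (acdN f1)) => z; rewrite cReN.
by apply: (acd_eq _ _ (acdN f2)) => z; rewrite cImN.
Qed.

Lemma cacdB f f' g g' : cacd f f' -> cacd g g' ->
  cacd (fun z => f z - g z) (fun z => f' z - g' z).
Proof. by move=> hf hg; apply: cacdD => //; exact: cacdN. Qed.

Lemma cacdM f f' g g' : cacd f f' -> cacd g g' ->
  cacd (fun z => f z * g z) (fun z => f' z * g z + f z * g' z).
Proof.
move=> [f1 f2] [g1 g2]; split.
  apply: (acd_eq _ _ (acdB (acdM f1 g1) (acdM f2 g2))) => z; rewrite ?cReD !cReM//.
  by ring.
apply: (acd_eq _ _ (acdD (acdM f1 g2) (acdM f2 g1))) => z; rewrite ?cImD !cImM//.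
by ring.
Qed.

Lemma cacdZ (c : R[i]) f f' : cacd f f' ->
  cacd (fun z => c * f z) (fun z => c * f' z).
Proof.
by move=> hf; apply: (cacd_eq _ _ (cacdM (cacd_cst c) hf)) => // z;
  rewrite mul0r add0r.
Qed.

Lemma cacd_conj f f' : cacd f f' ->
  cacd (fun z => (f z)^*)%C (fun z => (f' z)^*)%C.
Proof.
move=> [f1 f2]; split.
  by apply: (acd_eq _ _ f1) => z; rewrite cReJ.
by apply: (acd_eq _ _ (acdN f2)) => z; rewrite cImJ.
Qed.

Lemma cacd_shift f f' c : cacd f f' ->
  cacd (fun z => f (z + c)) (fun z => f' (z + c)).
Proof. by move=> [/(acd_shift c) f1 /(acd_shift c) f2]. Qed.

Lemma cacd_sub_derive f f' f'' : cacd f f' ->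
  {ae cmu, forall z, f' z = f'' z} -> cacd f f''.
Proof.
move=> [f1 f2] h; split.
  by apply: (acd_sub_derive f1); apply: (ae_imply _ h) => z ->.
by apply: (acd_sub_derive f2); apply: (ae_imply _ h) => z ->.
Qed.

Lemma cacd_sum (I : Type) (r : seq I) (F F' : I -> R -> R[i]) :
  (forall i, cacd (F i) (F' i)) ->
  cacd (fun z => \sum_(i <- r) F i z) (fun z => \sum_(i <- r) F' i z).
Proof.
move=> hF; elim: r => [|i r IH].
  by apply: (cacd_eq _ _ (cacd_cst 0)) => z; rewrite big_nil.
by apply: (cacd_eq _ _ (cacdD (hF i) IH)) => z; rewrite big_cons.
Qed.

Lemma acd_cn_sqr f f' : cacd f f' -> acd (fun z => cn (f z) ^+ 2)
  (fun z => 2 * (complex.Re (f z) * complex.Re (f' z) +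
                 complex.Im (f z) * complex.Im (f' z))).
Proof.
move=> [f1 f2]; apply: (acd_eq _ _ (acdD (acdM f1 f1) (acdM f2 f2))) => z.
  by rewrite cn_sqr !expr2.
by ring.
Qed.

(** Projection on the direction of [D = f b - f a] reduces this to the real case: by Cauchy-Schwarz,
    [|D| h - Re (conj D f)] has nonnegative derivative. *)
Lemma cacd_mvt f f' (h g : R -> R) (a b : R) : a <= b -> cacd f f' -> acd h g ->
  {ae cmu, forall z, a < z < b -> cn (f' z) <= g z} ->
  cn (f b - f a) <= h b - h a.
Proof.
move=> ab [f1 f2] hg le.
set D := f b - f a.
have [n0|n0] := eqVneq (cn D) 0.
  rewrite n0 subr_ge0; apply: (acd_le ab hg); apply: (ae_imply _ le) => z H /H.
  by apply: le_trans; exact: cn_ge0.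
have n_gt0 : 0 < cn D by rewrite lt_neqAle eq_sym n0 cn_ge0.
pose x := complex.Re D; pose y := complex.Im D.
have := acdB (acdM (acd_cst (cn D)) hg)
  (acdD (acdM (acd_cst x) f1) (acdM (acd_cst y) f2)).
move=> /(acd_le ab) H.
have nE : cn D ^+ 2 = x ^+ 2 + y ^+ 2 by rewrite cn_sqr.
have {H} : cn D * h a - (x * complex.Re (f a) + y * complex.Im (f a)) <=
  cn D * h b - (x * complex.Re (f b) + y * complex.Im (f b)).
  apply: H; apply: (ae_imply _ le) => z hz /hz {}hz.
  rewrite !mul0r !add0r subr_ge0.
  apply: (@le_trans _ _ (cn D * cn (f' z))); last by rewrite ler_wpM2l// ltW.
  apply: le_trans (ler_norm _) _; rewrite -(@ler_pXn2r _ 2) ?nnegrE ?mulr_ge0 ?cn_ge0//.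
  rewrite exprMn nE cn_sqr real_normK ?num_real//.
  set p := complex.Re _; set q := complex.Im _.
  by have := sqr_ge0 (x * q - y * p); nra.
have xE : x = complex.Re (f b) - complex.Re (f a) by rewrite /x /D cReD cReN.
have yE : y = complex.Im (f b) - complex.Im (f a) by rewrite /y /D cImD cImN.
move=> H; rewrite -(ler_pM2l n_gt0) -expr2 nE.
have : x ^+ 2 + y ^+ 2 = x * (complex.Re (f b) - complex.Re (f a)) +
    y * (complex.Im (f b) - complex.Im (f a)) by rewrite -xE -yE !expr2.
by move: H; lra.
Qed.

Lemma cacd_const f f' : cacd f f' -> {ae cmu, forall z, f' z = 0} ->
  forall a b, f a = f b.
Proof.
move=> hf h a b; wlog ab : a b / a <= b => [wl|].
  by have [|/ltW] := leP a b => /wl.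
have : cn (f b - f a) <= 0 - 0.
  apply: (cacd_mvt ab hf (acd_cst 0)); apply: (ae_imply _ h) => z -> _.
  by rewrite cn0.
rewrite subr0 le_eqVlt ltNge cn_ge0 orbF cn_eq0 subr_eq0.
by move=> /eqP.
Qed.

Lemma cacd_continuous f f' : cacd f f' ->
  continuous (fun z => complex.Re (f z)) /\ continuous (fun z => complex.Im (f z)).
Proof. by move=> [[/ac_continuous ? _] [/ac_continuous ? _]]. Qed.

Lemma cacd_bounded f f' a b : cacd f f' ->
  exists2 M, 0 <= M & forall x, a <= x <= b -> cn (f x) <= M.
Proof.
move=> [[f1 _] [f2 _]].
have [M M0 hM] := ac_bounded a b f1; have [N N0 hN] := ac_bounded a b f2.
exists (M + N) => [|x hx]; first exact: addr_ge0.
by apply: le_trans (cn_le _) _; rewrite lerD ?hM ?hN.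
Qed.

Definition mcacd m n (F F' : R -> 'M[R[i]]_(m, n)) :=
  forall i j, cacd (fun z => F z i j) (fun z => F' z i j).

Lemma mcacdM m n p (F F' : R -> 'M[R[i]]_(m, n)) (G G' : R -> 'M[R[i]]_(n, p)) :
  mcacd F F' -> mcacd G G' ->
  mcacd (fun z => F z *m G z) (fun z => F' z *m G z + F z *m G' z).
Proof.
move=> hF hG i j.
have := cacd_sum (index_enum 'I_n) (fun k => cacdM (hF i k) (hG k j)).
by apply: cacd_eq => z; rewrite !mxE // -big_split.
Qed.

Lemma mcacd_cst m n (A : 'M[R[i]]_(m, n)) : mcacd (fun=> A) (fun=> 0).
Proof. by move=> i j; apply: (cacd_eq _ _ (cacd_cst (A i j))) => z; rewrite ?mxE. Qed.

Lemma mcacd_eq m n (F F' G G' : R -> 'M[R[i]]_(m, n)) : (forall z, F z = G z) ->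
  (forall z, F' z = G' z) -> mcacd F F' -> mcacd G G'.
Proof. by move=> /funext -> /funext ->. Qed.

Lemma mcacd_shift m n (F F' : R -> 'M[R[i]]_(m, n)) c : mcacd F F' ->
  mcacd (fun z => F (z + c)) (fun z => F' (z + c)).
Proof. by move=> h i j; exact: cacd_shift (h i j). Qed.

Lemma mcacd_sub_derive m n (F F' F'' : R -> 'M[R[i]]_(m, n)) : mcacd F F' ->
  {ae cmu, forall z, F' z = F'' z} -> mcacd F F''.
Proof.
move=> h hae i j; apply: (cacd_sub_derive (h i j)).
by apply: (ae_imply _ hae) => z ->.
Qed.

Lemma mcacd_const m n (F F' : R -> 'M[R[i]]_(m, n)) : mcacd F F' ->
  {ae cmu, forall z, F' z = 0} -> forall a b, F a = F b.
Proof.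
move=> h hae a b; apply/matrixP => i j; apply: (cacd_const (h i j)).
by apply: (ae_imply _ hae) => z ->; rewrite mxE.
Qed.

Lemma adj2E (K : comNzRingType) (A : 'M[K]_2) :
  \adj A = mx2 (A 1 1) (- A 0 1) (- A 1 0) (A 0 0).
Proof.
have lift01 (k : 'I_1) : lift (0 : 'I_2) k = 1 by apply/val_inj; rewrite /= ord1.
have lift10 (k : 'I_1) : lift (1 : 'I_2) k = 0 by apply/val_inj; rewrite /= ord1.
apply/matrixP => i j; rewrite !mxE /cofactor (det_mx11 _) !mxE.
by case: (ord2P i) => ->; case: (ord2P j) => ->; rewrite ?lift01 ?lift10/=
  ?addn0 ?expr0 ?mul1r ?expr1 ?mulN1r ?sqrrN ?expr1n ?mul1r.
Qed.

(** In size two the adjugate is linear in the entries. For determinant one it is the inverse, so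
    inverses of fundamental matrices differentiate without division. *)
Lemma mcacd_adj (F F' : R -> 'M[R[i]]_2) : mcacd F F' ->
  mcacd (fun z => \adj (F z)) (fun z => \adj (F' z)).
Proof.
move=> h i j.
have E (G : R -> 'M[R[i]]_2) : (fun z => \adj (G z) i j) =
    (fun z => (mx2 (G z 1 1) (- G z 0 1) (- G z 1 0) (G z 0 0)) i j).
  by apply/funext => z; rewrite adj2E.
rewrite !E; apply: (@cacd_eq (fun z => if i == 0 then (if j == 0 then F z 1 1 else - F z 0 1)
                 else (if j == 0 then - F z 1 0 else F z 0 0))
  (fun z => if i == 0 then (if j == 0 then F' z 1 1 else - F' z 0 1)
                 else (if j == 0 then - F' z 1 0 else F' z 0 0)));
  try by move=> z; rewrite mxE.
by case: (i == 0); case: (j == 0); try exact: h; apply: cacdN; exact: h.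
Qed.

End ComplexAbsContinuity.

(** * Absolutely continuous majorants of integrable functions *)

Section BorelRepresentative.
Context {R : realType}.
Local Notation mu := (@lebesgue_measure R).
Local Notation cmu := (@completed_lebesgue_measure R).
Local Notation cara := ((@wlength R idfun)^*%mu.-cara.-measurable).

Lemma cara_measurable_borel (E : set R) : cara E ->
  exists A B : set R, [/\ measurable A, measurable B, mu B = 0 &
    E `\` B = A `\` B].
Proof.
rewrite -completed_caratheodory_measurable g_sigma_completed_algebra_genE.
move=> [A mA [N [B [mB B0 NB]] <-]]; exists A, B; split => //.
apply/seteqP; split => x [] /=; last by move=> Ax Bx; split => //; left.
by move=> [Ax|/NB Bx] nBx.
Qed.

Lemma measurable_fun_ratP (f : R -> R) :
  (forall q : rat, measurable [set x | ratr q < f x]) -> measurable_fun [set: R] f.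
Proof.
move=> H mD; apply: (measurability _ (RGenOInfty.measurableE R)) => //.
move=> /= _ [_ [y ->] <-]; rewrite setTI preimage_itvoy.
rewrite [X in measurable X](_ : _ = \bigcup_(q in [set q : rat | y < ratr q])
  [set x | ratr q < f x]).
  rewrite bigcup_mkcond; apply: bigcupT_measurable_rat => q.
  by case: ifP => // _; exact: H.
apply/seteqP; split => x /=.
  by move=> /rat_in_itvoo[q]; rewrite in_itv/= => /andP[yq qf]; exists q.
by move=> [q /= yq qf]; exact: lt_trans qf.
Qed.

(** The exceptional sets of the countably many rational rays are collected in one null set [Z] on
    which the function is set to zero; this also keeps [|g| <= |f|], hence integrability. *)
Lemma cara_measurable_fun_borel (f : R -> R) :
  (forall q : rat, cara [set x | ratr q < f x]) ->
  exists g : R -> R, [/\ measurable_fun [set: R] g,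
    forall x, `|g x| <= `|f x| & {ae cmu, forall x, g x = f x}].
Proof.
move=> H.
pose A q := projT1 (cid (cara_measurable_borel (H q))).
pose B q := projT1 (cid (projT2 (cid (cara_measurable_borel (H q))))).
have AB q : [/\ measurable (A q), measurable (B q), mu (B q) = 0 &
    [set x | ratr q < f x] `\` B q = A q `\` B q].
  by rewrite /A /B; case: cid => //= A' h; case: cid.
pose Z := \bigcup_(q : rat) B q.
have mZ : measurable Z by apply: bigcupT_measurable_rat => q; have [] := AB q.
have nZ : cmu.-negligible Z.
  apply/completed_negligibleP.
  rewrite /Z (_ : \bigcup_q B q = \bigcup_n (if unpickle n is Some q then B q else set0)).
    apply: negligible_bigcup => n; case: unpickle => [q|]; last exact: negligible_set0.
    by exists (B q); have [? ? ? ?] := AB q; split.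
  apply/seteqP; split => x [n _ /= Bx].
    by exists (pickle n); [exact: I|rewrite pickleK; exact: Bx].
  by move: Bx; case: unpickle => // q Bq; exists q.
exists (f \_ (~` Z)); split.
- apply: measurable_fun_ratP => q.
  have [mA mB _ E] := AB q.
  have EZ x : ~ Z x -> (ratr q < f x) = (x \in A q).
    move=> nZx; have nBx : ~ B q x by move=> Bx; apply: nZx; exists q.
    have Ex : ([set x | ratr q < f x] `\` B q) x = (A q `\` B q) x by rewrite E.
    apply/idP/idP => [h|]; rewrite ?inE.
      by have : (A q `\` B q) x by [rewrite -Ex; split]; case.
    by move=> Ax; have : (A q `\` B q) x by [split]; rewrite -Ex => -[].
  (* The value [0] taken on [Z] lies in the ray exactly when [q < 0], so [Z] is added to or removed
     from the Borel set [A q]. *)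
  have [q0|q0] := ltP (ratr q : R) 0.
    rewrite (_ : [set _ | _] = Z `|` A q); first exact: measurableU.
    apply/seteqP; split => x /=; rewrite patchE.
      case: ifPn => [|h _]; first by rewrite inE => nZx; rewrite (EZ x nZx) inE; right.
      by left; move: h; rewrite notin_setE; exact: contrapT.
    case: ifPn; first by rewrite inE => nZx [//|Ax]; rewrite (EZ x nZx) inE.
    by [].
  rewrite (_ : [set _ | _] = A q `\` Z); first exact: measurableD.
  apply/seteqP; split => x /=; rewrite patchE.
    case: ifPn; first by rewrite inE => nZx; rewrite (EZ x nZx) inE.
    by move=> _; rewrite ltNge q0.
  by move=> [Ax nZx]; rewrite ifT ?inE// (EZ x nZx) inE.
- by move=> x; rewrite patchE; case: ifP => // _; rewrite normr0.
- apply: negligibleS nZ => x /=; rewrite patchE; case: ifPn => //.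
  by rewrite notin_setE => + _; exact: contrapT.
Qed.

(** Lebesgue measure is the image of its completion under the identity, which is measurable from the
    larger sigma-algebra to the smaller. *)
Lemma integral_completed (f : R -> \bar R) : measurable_fun [set: R] f ->
  (forall x, 0 <= f x)%E -> (\int[mu]_x f x = \int[cmu]_x f x)%E.
Proof.
move=> mf f0.
have mid : measurable_fun [set: caratheodory_type (@wlength R idfun)^*%mu] (id : caratheodory_type (@wlength R idfun)^*%mu -> measurableTypeR R).
  by move=> _ A mA; rewrite setTI; exact: sub_caratheodory.
rewrite -[RHS](@ge0_integral_pushforward _ _ _ (measurableTypeR R) R _ mid cmu setT f)//.
Qed.

Lemma integrable_borel_representative (D : set R) (f : R -> R) :
  cara D -> cmu.-integrable D (fun z => (f z)%:E) ->
  exists g : R -> R, [/\ mu.-integrable [set: R] (EFin \o g),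
    {ae cmu, forall x, D x -> g x = f x} & forall x, ~ D x -> g x = 0].
Proof.
move=> mD intf.
have : cmu.-integrable setT ((EFin \o f) \_ D) by apply/(integrable_mkcond _ mD).
rewrite restrict_EFin => /integrableP[mf fi].
have [q|g [mg gf gae]] := @cara_measurable_fun_borel (f \_ D).
  have /measurable_EFinP := mf.
  move=> /(_ measurableT `]ratr q, +oo[%classic (measurable_itv _)).
  by rewrite setTI preimage_itvoy.
exists g; split.
- apply/integrableP; split; first exact/measurable_EFinP.
  rewrite integral_completed//; last first.
    by apply/measurable_EFinP; exact: measurableT_comp.
  have mcg : measurable_fun [set: caratheodory_type (@wlength R idfun)^*%mu]
      (g : caratheodory_type (@wlength R idfun)^*%mu -> measurableTypeR R).
    move=> _ A mA; rewrite setTI; apply: sub_caratheodory.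
    by rewrite -[X in measurable X]setTI; exact: mg.
  apply: le_lt_trans fi; apply: ge0_le_integral.
  + exact: measurableT.
  + by move=> x _; exact: abse_ge0.
  + apply: measurableT_comp; first exact: abse_measurable.
    by apply/measurable_EFinP; exact: mcg.
  + by apply: measurableT_comp mf; exact: abse_measurable.
  + by move=> x _; rewrite lee_fin; exact: gf.
- by apply: (ae_imply _ gae) => x -> Dx; rewrite patchE mem_set.
- move=> x nDx; apply/eqP; rewrite -normr_le0 (le_trans (gf x))//.
  by rewrite patchE memNset// normr0.
Qed.

End BorelRepresentative.

Section Majorant.
Context {R : realType}.
Local Notation mu := (@lebesgue_measure R).
Local Notation cmu := (@completed_lebesgue_measure R).

Lemma ae_completed (P : R -> Prop) :
  {ae mu, forall z, P z} -> {ae cmu, forall z, P z}.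
Proof. by move=> h; apply/completed_negligibleP. Qed.

(** Absolute continuity is that of the integral of [|g|] as a set function, applied to the union of
    the intervals. *)
Lemma indefinite_integral_acd (g : R -> R) : mu.-integrable [set: R] (EFin \o g) ->
  acd (fun x => \int[mu]_(t in `]-oo, x]) g t) g.
Proof.
move=> intg.
have intA (A : set (measurableTypeR R)) : measurable A -> mu.-integrable A (EFin \o g).
  by move=> mA; exact: (integrableS measurableT mA (@subsetT _ _) intg).
split; last first.
  apply: ae_completed; have lg : locally_integrable [set: R] g.
    by apply: open_integrable_locally => //; exact: openT.
  have := @FTC1Ny R g (fun y => intA _ (measurable_itv _)) lg.
  apply: (@filterS _ _ (ae_filter_ringOfSetsType mu)) => x [dF FE].
  by apply: DeriveDef; [exact: dF|rewrite -derive1E FE].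
move=> a b ab e e0.
have [d [d0 hd]] := integral_normr_continuous intg e0.
exists d => // n u v uv tI s.
have intA' (A : set (measurableTypeR R)) : measurable A -> mu.-integrable A (EFin \o (fun t => `|g t|)).
  by move=> mA; have := integrable_abse (intA _ mA).
pose D := \big[setU/set0]_(k < n) `]u k, v k[%classic.
have mD : measurable D.
  by apply: bigsetU_measurable => k _; exact: measurable_itv.
have DE : \int[mu]_(t in D) `|g t| = \sum_(k < n) \int[mu]_(t in `]u k, v k[) `|g t|.
  apply: EFin_inj; rewrite -sumEFin /Rintegral fineK; last first.
    exact: (integrable_fin_num _ (intA' _ mD)).
  rewrite /D ge0_integral_bigsetU//=.
  - by apply: eq_bigr => k _; rewrite fineK//; exact: (integrable_fin_num _ (intA' _ _)).
  - exact: index_enum_uniq.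
  - exact: sub_trivIset tI.
  - exact: (measurable_int _ (intA' _ mD)).
apply: (@le_lt_trans _ _ (\int[mu]_(t in D) `|g t|)).
  rewrite DE; apply: ler_sum => k _.
  have [_ [uvk _]] := uv k.
  rewrite Rintegral_itvB//; [|exact: intA].
  apply: le_trans (le_normr_Rintegral _ _) _; rewrite //; first exact: intA.
  by rewrite Rintegral_itv_bndo_bndc//; exact: intA'.
apply: hd => //.
rewrite /D measure_bigsetU_ord//=.
apply: (@le_lt_trans _ _ (\sum_(k < n) (v k - u k))%:E); last by rewrite lte_fin.
rewrite -sumEFin; apply: lee_sum => k _.
rewrite lebesgue_measure_itv/= lte_fin; case: ltP => // _.
by rewrite lee_fin subr_ge0; have [_ []] := uv k.
Qed.

Lemma periodic_mulrn (T : Type) (q : R -> T) (p : R) : (forall z, q (z + p) = q z) ->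
  forall n z, q (z + n%:R * p) = q z.
Proof.
move=> hq; elim=> [|n IH] z; first by rewrite mul0r addr0.
by rewrite -natr1 mulrDl mul1r addrA hq IH.
Qed.

(** [h] serves as an integral of [q]. It is a sum of translates of the indefinite integral over one
    period, stage [n] covering [[- m p, (n - m) p)], so [2 m] stages suffice. *)
Lemma exists_majorant (p : R) (q : R -> R) (m : nat) : 0 < p ->
  (forall z, q (z + p) = q z) ->
  cmu.-integrable `[0, p[%classic (fun z => (q z)%:E) ->
  exists h g, acd h g /\
    {ae cmu, forall z, - (m%:R * p) <= z < m%:R * p -> q z <= g z}.
Proof.
move=> p0 qp intq.
have [|g0 [ig g0q g00]] := @integrable_borel_representative R `[0, p[%classic q _ intq.
  by apply: sub_caratheodory; exact: measurable_itv.
have h0 := indefinite_integral_acd ig.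
set H := (fun x => _) in h0.
suff : forall n : nat, exists h g, [/\ acd h g,
    forall z, (n%:R - m%:R) * p <= z -> g z = 0 &
    {ae cmu, forall z, - (m%:R * p) <= z < (n%:R - m%:R) * p -> q z = g z}].
  move=> /(_ (m + m)%N)[h [g [hg _ gq]]]; exists h, g; split => //.
  by apply: (ae_imply _ gq) => z; rewrite natrD addrK => H' /H' ->.
elim=> [|n [h [g [hg gz gq]]]].
  exists (fun=> 0), (fun=> 0); split => //; first exact: acd_cst.
  by apply: aeW => z /andP[h1 h2]; exfalso; move: h1 h2; lra.
(* Translation by [c] brings the next period onto [[0, p)], outside which [g0] vanishes. *)
pose c := - ((n%:R - m%:R) * p).
exists (fun z => h z + H (z + c)), (fun z => g z + g0 (z + c)); split.
- by apply: acdD => //; exact: acd_shift.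
- move=> z hz; rewrite gz; last by move: hz; rewrite -natr1; nra.
  rewrite add0r g00//= in_itv/= => /andP[_].
  by move: hz; rewrite /c -natr1; nra.
- apply: (ae_imply2 _ gq (ae_shift c g0q)) => z gqz g0z /andP[z1 z2].
  have [zn|zn] := ltP z ((n%:R - m%:R) * p).
    rewrite gqz ?z1// g00 ?addr0//= in_itv/= => /andP[+ _].
    by move: zn; rewrite /c; nra.
  rewrite gz// add0r g0z.
    rewrite /c -(periodic_mulrn qp m) -[RHS](periodic_mulrn qp n); congr q; ring.
  rewrite /= in_itv/= /c; apply/andP; split; first by lra.
  by move: z2; rewrite -natr1; nra.
Qed.

End Majorant.

(** * Functions with Taylor expansions of all orders *)

Section PolynomialExpansions.
Context {R : realType}.
Local Notation C := R[i].
Implicit Types (f g d F G D : C -> C) (p q u : {poly C}).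

(** The point [h = 0] is excluded so that quotients by functions vanishing there can be estimated
    whatever their value at [0]. *)
Definition bigO (k : nat) F := exists M r : R, [/\ 0 <= M, 0 < r &
  forall h, h != 0 -> cn h <= r -> cn (F h) <= M * cn h ^+ k].

Lemma bigO_near k F G r : 0 < r ->
  (forall h, h != 0 -> cn h <= r -> F h = G h) -> bigO k F -> bigO k G.
Proof.
move=> r0 FG [M [s [M0 s0 H]]]; exists M, (Num.min r s); split => //.
  by rewrite lt_min r0.
by move=> h h0; rewrite le_min => /andP[hr hs]; rewrite -FG// H.
Qed.

Lemma bigO_ext k F G : (forall h, h != 0 -> F h = G h) -> bigO k F -> bigO k G.
Proof. by move=> FG; apply: (@bigO_near k F G 1) => // h h0 _; exact: FG. Qed.

Lemma bigO_le k l F : (k <= l)%N -> bigO l F -> bigO k F.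
Proof.
move=> kl [M [r [M0 r0 H]]]; exists M, (Num.min r 1); split => //.
  by rewrite lt_min r0 ltr01.
move=> h h0; rewrite le_min => /andP[hr h1].
by apply: le_trans (H h h0 hr) _; rewrite ler_wpM2l// ler_wiXn2l// cn_ge0.
Qed.

Lemma bigOD k F G : bigO k F -> bigO k G -> bigO k (fun h => F h + G h).
Proof.
move=> [M [r [M0 r0 HF]]] [N [s [N0 s0 HG]]].
exists (M + N), (Num.min r s); split; rewrite ?addr_ge0 ?lt_min ?r0//.
move=> h h0; rewrite le_min => /andP[hr hs].
by apply: le_trans (cnD _ _) _; rewrite mulrDl lerD ?HF ?HG.
Qed.

Lemma bigON k F : bigO k F -> bigO k (fun h => - F h).
Proof.
move=> [M [r [M0 r0 H]]]; exists M, r; split => // h h0 hr.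
by rewrite cnN H.
Qed.

Lemma bigOB k F G : bigO k F -> bigO k G -> bigO k (fun h => F h - G h).
Proof. by move=> hF hG; apply: bigOD => //; exact: bigON. Qed.

Lemma bigOM k l F G : bigO k F -> bigO l G -> bigO (k + l) (fun h => F h * G h).
Proof.
move=> [M [r [M0 r0 HF]]] [N [s [N0 s0 HG]]].
exists (M * N), (Num.min r s); split; rewrite ?mulr_ge0 ?lt_min ?r0//.
move=> h h0; rewrite le_min => /andP[hr hs].
by rewrite cnM exprD mulrACA ler_pM ?cn_ge0 ?HF ?HG.
Qed.

Lemma bigO_cst (c : C) : bigO 0 (fun=> c).
Proof. by exists (cn c), 1; split; rewrite ?cn_ge0// => h _ _; rewrite expr0 mulr1. Qed.

Lemma bigO_id : bigO 1 id.
Proof. by exists 1, 1; split => // h _ _; rewrite expr1 mul1r. Qed.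

Lemma bigO_exp n : bigO n (fun h => h ^+ n).
Proof. by exists 1, 1; split => // h _ _; rewrite cnX mul1r. Qed.

Lemma bigO_poly p : bigO 0 (fun h => p.[h]).
Proof.
elim/poly_ind: p => [|p c IH].
  by apply: bigO_ext (bigO_cst 0) => h _; rewrite horner0.
apply: (@bigO_ext 0 (fun h => p.[h] * h + c)) => [h _|].
  by rewrite hornerMXaddC.
by apply: bigOD (bigO_cst c); apply: (@bigO_le 0 (0 + 1)) => //; exact: bigOM bigO_id.
Qed.

Lemma exists_cn_small (r : R) : 0 < r -> exists2 h : C, h != 0 & cn h <= r.
Proof.
move=> r0; exists r%:C; last by rewrite cn_real ger0_norm// ltW.
by rewrite -cn_gt0 cn_real normr_gt0 gt_eqF.
Qed.

Lemma bigO_cst1 (c : C) : bigO 1 (fun=> c) -> c = 0.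
Proof.
move=> [M [r [M0 r0 H]]]; apply/eqP; rewrite -cn_eq0 eq_le cn_ge0 andbT.
apply/ler_addgt0Pr => e e0; rewrite add0r.
have : 0 < Num.min r (e / (M + 1)) by rewrite lt_min r0 divr_gt0// ltr_wpDl.
move=> /exists_cn_small[h h0]; rewrite le_min => /andP[hr he].
apply: le_trans (H h h0 hr) _; rewrite expr1.
move: he; rewrite ler_pdivlMr ?ltr_wpDl// => he.
by apply: le_trans he; rewrite mulrC ler_wpM2l ?cn_ge0// lerDl.
Qed.

Lemma poly_split0 p : exists q, p = p.[0]%:P + 'X * q.
Proof.
elim/poly_ind: p => [|p c _]; first by exists 0; rewrite horner0 mulr0 addr0.
by exists p; rewrite hornerMXaddC mulr0 add0r addrC mulrC.
Qed.

Lemma bigO_divX k G : bigO k.+1 (fun h => h * G h) -> bigO k G.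
Proof.
move=> [M [r [M0 r0 H]]]; exists M, r; split => // h h0 hr.
have := H h h0 hr; rewrite cnM exprS mulrCA ler_pM2l//.
by rewrite cn_gt0.
Qed.

Lemma bigO_poly0 p k : bigO k.+1 (fun h => p.[h]) -> p.[0] = 0.
Proof.
move=> hp; apply: bigO_cst1; have [q pE] := poly_split0 p.
apply: (@bigO_ext 1 (fun h => p.[h] - h * q.[h])) => [h _|].
  by rewrite {1}pE hornerD hornerC hornerM hornerX addrK.
apply: bigOB; first exact: bigO_le hp.
by have := bigOM bigO_id (bigO_poly q); rewrite addn0.
Qed.

Lemma bigO_poly_dvdX k p : bigO k (fun h => p.[h]) -> exists q, p = 'X^k * q.
Proof.
elim: k p => [|k IH] p hp; first by exists p; rewrite expr0 mul1r.
have [q pE] := poly_split0 p; move: pE; rewrite (bigO_poly0 hp) polyC0 add0r => pE.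
have [|q' qE] := IH q.
  apply: bigO_divX; apply: bigO_ext hp => h _.
  by rewrite pE hornerM hornerX.
by exists q'; rewrite pE qE exprS mulrA.
Qed.

(** [u] is the truncated reciprocal power series of [q]; at each stage [c] cancels the constant term
    of the error, which gains one order. *)
Lemma poly_inv_modX q n : q.[0] != 0 -> exists u w, q * u = 1 + 'X^n * w.
Proof.
move=> q0; elim: n => [|n [u [w E]]].
  by exists 0, (-1); rewrite mulr0 expr0 mul1r subrr.
pose c := - w.[0] / q.[0].
have [v vE] := poly_split0 (w + c *: q).
exists (u + c *: 'X^n), v.
have v0 : (w + c *: q).[0] = 0 by rewrite hornerD hornerZ /c divfK// subrr.
rewrite v0 polyC0 add0r in vE.
have -> : 1 + 'X^(n.+1) * v = 1 + 'X^n * ('X * v) by rewrite exprSr mulrA.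
by rewrite -vE mulrDr -scalerAr E mulrDr -scalerAr (mulrC q) addrA.
Qed.

Definition expandable F := forall n, exists p, bigO n (fun h => F h - p.[h]).

(** Expansions of different positive orders share their constant term, which is the value to assign
    at a removable singularity. *)
Lemma expandable_value F : expandable F ->
  exists v, forall n, exists p, p.[0] = v /\ bigO n (fun h => F h - p.[h]).
Proof.
move=> HF; have [p1 h1] := HF 1%N; exists p1.[0] => n.
have [p hp] := HF n.+1; exists p; split; last exact: bigO_le hp.
apply/eqP; rewrite -subr_eq0 -hornerN -hornerD; apply/eqP.
apply: (@bigO_poly0 _ 0).
apply: (@bigO_ext 1 (fun h => (F h - p1.[h]) - (F h - p.[h]))) => [h _|].
  by rewrite hornerD hornerN; ring.
by apply: bigOB => //; exact: bigO_le hp.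
Qed.

(** Both approximants are divisible by ['X^k]. After cancellation the denominator has nonzero
    constant term, by the lower bound, and its reciprocal modulo ['X^n] yields the approximant of
    the quotient. *)
Lemma expandable_quot k F D c r : expandable F -> expandable D ->
  bigO k F -> bigO k D -> 0 < c -> 0 < r ->
  (forall h, h != 0 -> cn h <= r -> c * cn h ^+ k <= cn (D h)) ->
  expandable (fun h => F h / D h).
Proof.
move=> HF HD Fk Dk c0 r0 low n.
(* One more order is asked of [D]: for [n = 0], order [k] alone would not determine the coefficient
   of ['X^k]. *)
have [pF hF] := HF (n + k)%N; have [pD hD] := HD (n.+1 + k)%N.
have factor G pG l : bigO k G -> bigO (l + k) (fun h => G h - pG.[h]) ->
    exists q, pG = 'X^k * q.
  move=> Gk Gp; apply: bigO_poly_dvdX.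
  apply: (@bigO_ext k (fun h => G h - (G h - pG.[h]))) => [h _|]; first by ring.
  by apply: bigOB => //; apply: bigO_le Gp; exact: leq_addl.
have [qF qFE] := factor _ _ _ Fk hF; have [qD qDE] := factor _ _ _ Dk hD.
have qD0 : qD.[0] != 0.
  apply/eqP => q0; have [q'] := poly_split0 qD; rewrite q0 polyC0 add0r => qE.
  have : bigO k.+1 D.
    apply: (@bigO_ext _ (fun h => (D h - pD.[h]) + h ^+ k * (h * q'.[h]))) => [h _|].
      by rewrite qDE qE !hornerM hornerXn hornerX subrK.
    apply: bigOD; first by apply: bigO_le hD; rewrite addSn ltnS leq_addl.
    have := bigOM (bigO_exp k) (bigOM bigO_id (bigO_poly q')).
    by rewrite addn0 addn1.
  move=> [M [s [M0 s0 H]]].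
  (* For [|h| <= c / (2 (M + 1))], the bound [|D h| <= M |h|^(k+1)] contradicts
     [c |h|^k <= |D h|]. *)
  have : 0 < Num.min (Num.min r s) (c / (M + 1) / 2).
    by rewrite !lt_min r0 s0 !divr_gt0// ltr_wpDl.
  move=> /exists_cn_small[h h0]; rewrite !le_min => /andP[/andP[hr hs]].
  rewrite -!mulrA -invfM ler_pdivlMr ?mulr_gt0 ?ltr_wpDl// => hc.
  have := le_trans (low h h0 hr) (H h h0 hs).
  have hk : 0 < cn h ^+ k by rewrite exprn_gt0// cn_gt0.
  rewrite exprS mulrA ler_pM2r// => cM.
  have := cn_ge0 h; move: c0 hc cM; set t := cn h; nra.
have [u [w uE]] := poly_inv_modX n qD0.
exists (qF * u).
have : bigO (n + k) (fun h => F h - D h * (qF * u).[h]).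
  apply: (@bigO_ext _ (fun h => (F h - pF.[h]) - (D h - pD.[h]) * (qF * u).[h]
      - h ^+ n * h ^+ k * (qF * w).[h])) => [h _|].
    have : (qD * u).[h] = (1 + 'X^n * w).[h] by rewrite uE.
    rewrite qFE qDE !hornerM hornerD hornerM !hornerXn hornerC => E.
    rewrite (_ : _ - _ - _ = F h - D h * (qF.[h] * u.[h]) +
      h ^+ k * qF.[h] * (qD.[h] * u.[h] - 1 - h ^+ n * w.[h])); last by ring.
    by rewrite E (_ : 1 + _ - 1 - _ = 0) ?mulr0 ?addr0//; ring.
  apply: bigOB; first apply: bigOB => //.
    have := bigOM hD (bigO_poly (qF * u)); rewrite addn0; apply: bigO_le.
    by rewrite leq_add2r.
  by have := bigOM (bigOM (bigO_exp n) (bigO_exp k)) (bigO_poly (qF * w)); rewrite addn0.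
move=> [M [s [M0 s0 H]]]; exists (M / c), (Num.min r s); split.
- by rewrite divr_ge0// ltW.
- by rewrite lt_min r0.
move=> h h0; rewrite le_min => /andP[hr hs].
have hk : 0 < cn h ^+ k by rewrite exprn_gt0// cn_gt0.
have Dgt : 0 < cn (D h) by apply: lt_le_trans (low h h0 hr); rewrite mulr_gt0.
have D0 : D h != 0 by rewrite -cn_gt0.
rewrite -(ler_pM2r Dgt) -cnM mulrBl divfK// (mulrC _ (D h)).
apply: le_trans (H h h0 hs) _.
rewrite exprD -!mulrA ler_wpM2l// mulrCA ler_wpM2l ?exprn_ge0 ?cn_ge0//.
by rewrite ler_pdivlMl// low.
Qed.

(** Substitute for analyticity, with no uniformity in [z] or [n]. Unlike [expandable], it ties the
    constant term to the value at the centre. *)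
Definition peano f (z : C) := forall n, exists p,
  p.[0] = f z /\ bigO n (fun h => f (z + h) - p.[h]).

Lemma peano_expandable f z : peano f z -> expandable (fun h => f (z + h)).
Proof. by move=> H n; have [p [_ hp]] := H n; exists p. Qed.

Lemma peano_cst (c : C) z : peano (fun=> c) z.
Proof.
move=> n; exists c%:P; split; first by rewrite hornerC.
exists 0, 1; split => // h _ _; by rewrite hornerC subrr cn0 mul0r.
Qed.

Lemma peano_id z : peano id z.
Proof.
move=> n; exists (z%:P + 'X); split; first by rewrite hornerD hornerC hornerX addr0.
by exists 0, 1; split => // h _ _; rewrite hornerD hornerC hornerX subrr cn0 mul0r.
Qed.

Lemma peanoD f g z : peano f z -> peano g z -> peano (fun x => f x + g x) z.
Proof.
move=> Hf Hg n; have [p [p0 hp]] := Hf n; have [q [q0 hq]] := Hg n.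
exists (p + q); split; first by rewrite hornerD p0 q0.
by apply: bigO_ext (bigOD hp hq) => h _; rewrite hornerD; ring.
Qed.

Lemma peanoM f g z : peano f z -> peano g z -> peano (fun x => f x * g x) z.
Proof.
move=> Hf Hg n; have [p [p0 hp]] := Hf n; have [q [q0 hq]] := Hg n.
exists (p * q); split; first by rewrite hornerM p0 q0.
apply: (@bigO_ext _ (fun h => (f (z + h) - p.[h]) * q.[h] +
    p.[h] * (g (z + h) - q.[h]) + (f (z + h) - p.[h]) * (g (z + h) - q.[h]))).
  by move=> h _; rewrite hornerM; ring.
apply: bigOD; first apply: bigOD.
- by have := bigOM hp (bigO_poly q); rewrite addn0.
- exact: bigOM (bigO_poly p) hq.
- by apply: bigO_le (bigOM hp hq); exact: leq_addr.
Qed.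

Lemma peanoN f z : peano f z -> peano (fun x => - f x) z.
Proof.
move=> Hf n; have [p [p0 hp]] := Hf n.
exists (- p); split; first by rewrite hornerN p0.
by apply: bigO_ext (bigON hp) => h _; rewrite hornerN; ring.
Qed.

Lemma peanoB f g z : peano f z -> peano g z -> peano (fun x => f x - g x) z.
Proof. by move=> hf hg; apply: peanoD => //; exact: peanoN. Qed.

Lemma peano_eq f g z : (forall x, f x = g x) -> peano f z -> peano g z.
Proof. by move=> /funext ->. Qed.

Lemma peano_shift f (w z : C) : peano f (w + z) -> peano (fun x => f (w + x)) z.
Proof.
move=> Hf n; have [p [p0 hp]] := Hf n; exists p; split => //.
by apply: bigO_ext hp => h _; rewrite addrA.
Qed.

Lemma peano_taylor2 f z : peano f z -> exists c1 c2,
  bigO 3 (fun h => f (z + h) - (f z + c1 * h + c2 * (h * h))).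
Proof.
move=> /(_ 3%N)[p [p0 hp]].
have [q pE] := poly_split0 p; have [q' qE] := poly_split0 q.
have [q'' q'E] := poly_split0 q'.
exists q.[0], q'.[0].
apply: (@bigO_ext _ (fun h => (f (z + h) - p.[h]) + h ^+ 3 * q''.[h])) => [h _|].
  rewrite -p0 [in LHS]pE [in LHS]qE [in LHS]q'E.
  by rewrite !(hornerD, hornerM, hornerX, hornerC); ring.
by apply: bigOD => //; have := bigOM (bigO_exp 3) (bigO_poly q''); rewrite addn0.
Qed.

Lemma peano_taylor1 f z : peano f z -> exists c1,
  bigO 2 (fun h => f (z + h) - f z - c1 * h).
Proof.
move=> /peano_taylor2[c1 [c2 h3]]; exists c1.
apply: (@bigO_ext _ (fun h => (f (z + h) - (f z + c1 * h + c2 * (h * h))) + c2 * (h * h))).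
  by move=> h _; ring.
apply: bigOD; first exact: bigO_le h3.
exact: bigOM (bigO_cst c2) (bigOM bigO_id bigO_id).
Qed.

Lemma peano_taylor0 f z : peano f z -> bigO 1 (fun h => f (z + h) - f z).
Proof.
move=> /peano_taylor1[c1 h2].
apply: (@bigO_ext _ (fun h => (f (z + h) - f z - c1 * h) + c1 * h)).
  by move=> h _; ring.
apply: bigOD; first exact: bigO_le h2.
exact: bigOM (bigO_cst c1) bigO_id.
Qed.

Lemma peano_near_neq0 f z : peano f z -> f z != 0 -> exists2 r, 0 < r &
  forall h, cn h <= r -> cn (f z) / 2 <= cn (f (z + h)).
Proof.
move=> /peano_taylor0[M [r [M0 r0 H]]] fz; have := fz; rewrite -cn_gt0 => fz0.
exists (Num.min r (cn (f z) / 2 / (M + 1))).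
  by rewrite lt_min r0 !divr_gt0// ltr_wpDl.
move=> h; rewrite le_min => /andP[hr]; rewrite ler_pdivlMr ?ltr_wpDl// => hM.
have [->|h0] := eqVneq h 0; first by rewrite addr0; lra.
have := H h h0 hr; rewrite expr1 => H1.
have : cn (f z) <= cn (f (z + h)) + cn (f (z + h) - f z).
  by apply: le_trans (cnB _ _); rewrite opprB addrC subrK.
by have := cn_ge0 h; nra.
Qed.

(* Removable singularities of a quotient, all zeros of the denominator having the
   same order [k]. *)
Lemma peano_quot k f d : (forall z, peano f z) -> (forall z, peano d z) ->
  (forall z, d z = 0 -> [/\ bigO k (fun h => f (z + h)), bigO k (fun h => d (z + h)) &
    exists c r, [/\ 0 < c, 0 < r &
      forall h, h != 0 -> cn h <= r -> c * cn h ^+ k <= cn (d (z + h))]]) ->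
  exists g, (forall z, peano g z) /\ forall z, d z != 0 -> g z = f z / d z.
Proof.
move=> Hf Hd H0.
have val z : exists v, d z = 0 -> forall n, exists p,
    p.[0] = v /\ bigO n (fun h => f (z + h) / d (z + h) - p.[h]).
  have [dz|dz] := pselect (d z = 0); last by exists 0.
  have [fk dk [c [r [c0 r0 low]]]] := H0 z dz.
  have := expandable_value (expandable_quot (peano_expandable (Hf z))
    (peano_expandable (Hd z)) fk dk c0 r0 low).
  by move=> [v hv]; exists v.
pose v z := projT1 (cid (val z)).
have vP z : d z = 0 -> forall n, exists p,
    p.[0] = v z /\ bigO n (fun h => f (z + h) / d (z + h) - p.[h]).
  by rewrite /v; case: cid.
exists (fun z => if d z == 0 then v z else f z / d z); split; last first.
  by move=> z /negPf ->.
move=> z n; case: ifPn => [/eqP dz|dz].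
  have [p [p0 hp]] := vP z dz n; exists p; split => //.
  have [_ _ [c [r [c0 r0 low]]]] := H0 z dz.
  apply: (bigO_near r0 _ hp) => h h0 hr.
  rewrite ifN// -cn_gt0; apply: lt_le_trans (low h h0 hr).
  by rewrite mulr_gt0// exprn_gt0// cn_gt0.
have [r r0 low] := peano_near_neq0 (Hd z) dz.
have dz0 : 0 < cn (d z) / 2 by rewrite divr_gt0// cn_gt0.
have bf : bigO 0 (fun h => f (z + h)).
  apply: (@bigO_ext _ (fun h => (f (z + h) - f z) + f z)) => [h _|]; first by rewrite subrK.
  by apply: bigOD (bigO_cst _); exact: bigO_le (peano_taylor0 (Hf z)).
have bd : bigO 0 (fun h => d (z + h)).
  apply: (@bigO_ext _ (fun h => (d (z + h) - d z) + d z)) => [h _|]; first by rewrite subrK.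
  by apply: bigOD (bigO_cst _); exact: bigO_le (peano_taylor0 (Hd z)).
(* Off the zeros of [d] the same quotient lemma applies with [k = 0]; the constant term [u] must
   then be identified with [f z / d z]. *)
have [|u hu] := expandable_value (expandable_quot (peano_expandable (Hf z))
    (peano_expandable (Hd z)) bf bd dz0 r0 _).
  by move=> h h0 hr; rewrite expr0 mulr1 low.
have near0 h : cn h <= r -> d (z + h) != 0.
  by move=> hr; rewrite -cn_gt0; apply: lt_le_trans (low h hr).
have uE : u = f z / d z.
  have [p [p0 hp]] := hu 1%N.
  apply/eqP; rewrite -subr_eq0; apply/eqP.
  apply: bigO_cst1.
  have [q qE] := poly_split0 p.
  apply: (@bigO_near _ (fun h => - (f (z + h) / d (z + h) - p.[h]) +
    ((f (z + h) - f z) - (f z / d z) * (d (z + h) - d z)) * (d (z + h))^-1 - h * q.[h]) _ r) => //.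
    move=> h _ hr; have dh := near0 h hr.
    have -> : p.[h] = u + h * q.[h].
      by rewrite qE hornerD hornerC hornerM hornerX p0.
    by field; rewrite dz dh.
  apply: bigOB; last by have := bigOM bigO_id (bigO_poly q); rewrite addn0.
  apply: bigOD; first exact: bigON.
  have binv : bigO 0 (fun h => (d (z + h))^-1).
    exists (cn (d z) / 2)^-1, r; split; rewrite ?invr_ge0 ?ltW// => h _ hr.
    rewrite expr0 mulr1 cnV lef_pV2 ?posrE// ?low//.
    by apply: lt_le_trans (low h hr).
  have := bigOM (bigOB (peano_taylor0 (Hf z)) (bigOM (bigO_cst (f z / d z)) (peano_taylor0 (Hd z)))) binv.
  by rewrite addn0.
have [p [p0 hp]] := hu n; exists p; split; first by rewrite p0 uE.
apply: (bigO_near r0 _ hp) => h _ hr.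
by rewrite ifN// near0.
Qed.

End PolynomialExpansions.

(** * The maximum principle on squares *)

Section MaximumPrinciple.
Context {R : realType}.
Local Notation C := R[i].
Implicit Types (f g : C -> C).

Lemma ler_cn_dist (u v : C) : `|cn u - cn v| <= cn (v - u).
Proof.
have main (a b : C) : cn a - cn b <= cn (a - b).
  by rewrite lerBlDr; apply: le_trans (cnD _ _); rewrite subrK.
by rewrite ler_norml lerNl opprB main cn_dist main.
Qed.

Lemma peano_cn_continuous f : (forall z, peano f z) ->
  continuous (fun u : R * R => cn (f (u.1 +i* u.2))).
Proof.
move=> Hf [x y]; apply/cvgrPdist_le => /= e e0.
have [M [r [M0 r0 H]]] := peano_taylor0 (Hf (x +i* y)).
pose s := Num.min r (e / (M + 1)) / 2.
have s0 : 0 < s by rewrite divr_gt0// lt_min r0 divr_gt0// ltr_wpDl.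
have /cvgrPdist_lt/(_ s s0) near1 : (fun u : R * R => u.1) @ (x, y) --> x by exact: cvg_fst.
have /cvgrPdist_lt/(_ s s0) near2 : (fun u : R * R => u.2) @ (x, y) --> y by exact: cvg_snd.
apply: filterS2 near1 near2 => -[x' y'] /=; rewrite distrC (distrC y) => hx hy.
pose h := (x' - x) +i* (y' - y).
have -> : x' +i* y' = (x +i* y) + h by apply: complex_eqP => /=; ring.
have hs : cn h <= Num.min r (e / (M + 1)).
  apply: le_trans (cn_le _) _ => /=.
  have -> : Num.min r (e / (M + 1)) = s + s by rewrite /s; field.
  by rewrite lerD// ltW.
have [->|h0] := eqVneq h 0; first by rewrite addr0 subrr normr0 ltW.
move: hs; rewrite le_min => /andP[hr].
rewrite ler_pdivlMr ?ltr_wpDl// => he.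
have := H h h0 hr; rewrite expr1 => H1.
apply: (@le_trans _ _ (cn (f (x +i* y + h) - f (x +i* y)))); last first.
  by apply: le_trans H1 _; have := cn_ge0 h; nra.
exact: ler_cn_dist.
Qed.

Lemma cn_sqr_near (u v : C) m K : cn (u - v) <= m -> cn v <= K -> 0 <= m ->
  cn v ^+ 2 - 2 * K * m <= cn u ^+ 2.
Proof.
move=> uv vK m0; have h : cn v - m <= cn u.
  rewrite lerBlDr; apply: (@le_trans _ _ (cn u + cn (u - v))); last by rewrite lerD2l.
  by apply: le_trans (cnB _ _); rewrite opprB addrC subrK.
have := cn_ge0 u; have := cn_ge0 v.
have [vm|vm] := leP m (cn v); first by nra.
by move=> ? ?; have := sqr_ge0 (cn u); nra.
Qed.

(** Discrete Parseval identity: the monomials of degree 0, 1 and 2 are orthogonal over the fourth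
    roots of unity. *)
Lemma sum4_cn_sqr (c0 c1 c2 : C) (t : R) :
  let h1 := t +i* 0 in let h2 := 0 +i* t in let h3 := (- t) +i* 0 in
  let h4 := 0 +i* (- t) in
  let P h := c0 + c1 * h + c2 * (h * h) in
  cn (P h1) ^+ 2 + cn (P h2) ^+ 2 + cn (P h3) ^+ 2 + cn (P h4) ^+ 2 =
  4 * (cn c0 ^+ 2 + t ^+ 2 * cn c1 ^+ 2 + t ^+ 4 * cn c2 ^+ 2).
Proof.
by rewrite /= !cn_sqr !(cReD, cImD, cReM, cImM) /=; ring.
Qed.

(* At an interior maximum [b] of [|f|^2 + e |z|^2] the mean over the four points
   [b + i^k t] exceeds the value at [b] by at least [e t^2 - O(t^3)]. *)
Lemma max_principle f (r B : R) : 0 < r -> (forall z, peano f z) ->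
  (forall z, `|complex.Re z| <= r -> `|complex.Im z| <= r ->
    `|complex.Re z| = r \/ `|complex.Im z| = r -> cn (f z) <= B) ->
  forall z, `|complex.Re z| <= r -> `|complex.Im z| <= r -> cn (f z) <= B.
Proof.
move=> r0 Hf bd z zr zi; rewrite leNgt; apply/negP => Bz.
have B0 : 0 <= B.
  have := bd (r +i* 0); rewrite /= normr0 (ger0_norm (ltW r0)).
  move=> /(_ (lexx _) (ltW r0) (or_introl erefl)).
  by apply: le_trans; exact: cn_ge0.
(* On the square the perturbation is at most [2 e r^2], half the gap between [|f z|^2] and [B^2]; so
   [psi] cannot be maximal on the boundary. *)
pose e := (cn (f z) ^+ 2 - B ^+ 2) / (4 * r ^+ 2).
have e0 : 0 < e.
  rewrite divr_gt0//; last by rewrite mulr_gt0// exprn_gt0.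
  by rewrite subr_gt0 ltr_pXn2r// nnegrE cn_ge0.
have eE : e * (4 * r ^+ 2) = cn (f z) ^+ 2 - B ^+ 2.
  by rewrite /e divfK// gt_eqF// mulr_gt0// exprn_gt0.
pose psi (u : R * R) := cn (f (u.1 +i* u.2)) ^+ 2 + e * (u.1 ^+ 2 + u.2 ^+ 2).
have cpsi : continuous psi.
  have -> : psi = (fun u => cn (f (u.1 +i* u.2)) * cn (f (u.1 +i* u.2)) +
      e * (u.1 * u.1 + u.2 * u.2)) by apply/funext => u; rewrite /psi !expr2.
  move=> u; have cf : (fun v : R * R => cn (f (v.1 +i* v.2))) @ u --> cn (f (u.1 +i* u.2)).
    exact: peano_cn_continuous.
  have c1 : (fun u : R * R => u.1) @ u --> u.1 by exact: cvg_fst.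
  have c2 : (fun u : R * R => u.2) @ u --> u.2 by exact: cvg_snd.
  apply: cvgD; first exact: cvgM.
  by apply: cvgM; [exact: cvg_cst|apply: cvgD; exact: cvgM].
pose S := `[- r, r]%classic `*` `[- r, r]%classic : set (R * R).
have inS x y : S (x, y) <-> `|x| <= r /\ `|y| <= r.
  by rewrite /S /= !in_itv/= !ler_norml.
have [|||[x y] Sb maxb] := @compact_EVT_max _ R psi S.
- by exists (complex.Re z, complex.Im z); apply/inS.
- by apply: (@compact_setX R R); exact: segment_compact.
- exact: continuous_subspaceT.
move: Sb; rewrite inE => /inS[xr yr].
have zE : z = complex.Re z +i* complex.Im z by case: (z).
have hz : cn (f z) ^+ 2 <= psi (x, y).
  have hm : psi (complex.Re z, complex.Im z) <= psi (x, y).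
    by apply: maxb; rewrite inE; apply/inS.
  apply: le_trans hm.
  by rewrite /psi /= -zE lerDl mulr_ge0 ?(ltW e0)// addr_ge0 ?sqr_ge0.
have x2 : x ^+ 2 <= r ^+ 2 by rewrite -(real_normK (num_real x)) ler_pXn2r ?nnegrE// ltW.
have y2 : y ^+ 2 <= r ^+ 2 by rewrite -(real_normK (num_real y)) ler_pXn2r ?nnegrE// ltW.
have [xlt ylt] : `|x| < r /\ `|y| < r.
  have nb : ~ (`|x| = r \/ `|y| = r).
    move=> /(bd (x +i* y) xr yr) fB.
    have : cn (f (x +i* y)) ^+ 2 <= B ^+ 2 by rewrite ler_pXn2r// nnegrE cn_ge0.
    have r2 : 0 < r ^+ 2 by rewrite exprn_gt0.
    by move: hz; rewrite /psi/=; nra.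
  by split; rewrite lt_neqAle ?xr ?yr andbT; apply/eqP => h; apply: nb; [left|right].
pose b := x +i* y.
have [c1 [c2 [M [s [M0 s0 H]]]]] := peano_taylor2 (Hf b).
pose K := cn (f b) + cn c1 + cn c2.
have K0 : 0 <= K by rewrite !addr_ge0 ?cn_ge0.
(* The first two bounds keep the four points in the square; the last makes the Taylor error
   [2 K M t^3] smaller than the gain [e t^2]. *)
pose t := Num.min (Num.min (r - `|x|) (r - `|y|)) (Num.min (Num.min s 1) (e / (2 * K * M + 1))).
have D0 : 0 < 2 * K * M + 1 by rewrite ltr_wpDl// !mulr_ge0.
have t0 : 0 < t by rewrite !lt_min !subr_gt0 xlt ylt s0 ltr01 divr_gt0.
have : t <= t by [].
rewrite {2}/t !le_min => /andP[/andP[tx ty] /andP[/andP[ts t1]]].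
rewrite ler_pdivlMr// => te.
have key (h : C) : cn h = t -> complex.Re h ^+ 2 + complex.Im h ^+ 2 = t ^+ 2 ->
    `|complex.Re h| <= t -> `|complex.Im h| <= t ->
    cn (f b + c1 * h + c2 * (h * h)) ^+ 2 - 2 * K * (M * t ^+ 3) +
    e * ((x + complex.Re h) ^+ 2 + (y + complex.Im h) ^+ 2) <= psi (x, y).
  move=> ht h2 hr hi.
  have h0 : h != 0 by rewrite -cn_gt0 ht.
  have hs : cn h <= s by rewrite ht.
  have Hm : psi (x + complex.Re h, y + complex.Im h) <= psi (x, y).
    apply: maxb; rewrite inE.
    apply/inS; split; apply: le_trans (ler_normD _ _) _.
      by apply: le_trans (lerD (lexx _) hr) _; move: tx; rewrite lerBrDr addrC.
    by apply: le_trans (lerD (lexx _) hi) _; move: ty; rewrite lerBrDr addrC.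
  apply: le_trans Hm; rewrite /psi/= lerD2r.
  have -> : (x + complex.Re h) +i* (y + complex.Im h) = b + h by apply: complex_eqP; case: (h).
  apply: cn_sqr_near; last by rewrite mulr_ge0// exprn_ge0// ltW.
    by have := H h h0 hs; rewrite ht.
  apply: le_trans (cnD _ _) _; apply: lerD.
    apply: le_trans (cnD _ _) _; rewrite lerD2l cnM ht.
    by rewrite ler_piMr ?cn_ge0.
  by rewrite !cnM ht ler_piMr ?cn_ge0// mulr_ile1// ltW.
have k1 := key (t +i* 0); have k2 := key (0 +i* t).
have k3 := key ((- t) +i* 0); have k4 := key (0 +i* (- t)).
have nt : Num.sqrt (t ^+ 2) = t by rewrite sqrtr_sqr ger0_norm// ltW.
have tt : `|t| <= t by rewrite ger0_norm// ltW.
have := sum4_cn_sqr (f b) c1 c2 t.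
move: k1 k2 k3 k4; rewrite /= ?expr0n/= ?sqrrN ?addr0 ?add0r ?normrN ?normr0 nt.
move=> /(_ erefl erefl tt (ltW t0)) k1 /(_ erefl erefl (ltW t0) tt) k2.
move=> /(_ erefl erefl tt (ltW t0)) k3 /(_ erefl erefl (ltW t0) tt) k4 sumE.
have c1p := sqr_ge0 (t * cn c1); have c2p := sqr_ge0 (t ^+ 2 * cn c2).
have : e * t ^+ 2 <= 2 * K * M * t * t ^+ 2.
  move: k1 k2 k3 k4 sumE c1p c2p; rewrite /psi/= -/b.
  set A1 := cn (_ + _ + _); set A2 := cn (_ + _ + _); set A3 := cn (_ + _ + _); set A4 := cn (_ + _ + _).
  by lra.
by rewrite ler_pM2r ?exprn_gt0//; move: te; nra.
Qed.

End MaximumPrinciple.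

(** * Liouville's theorem and the passage to complex derivatives *)

Section Liouville.
Context {R : realType}.
Local Notation C := R[i].
Implicit Types (f g : C -> C).

Lemma normr_itv (x y : R) : `|x| <= y -> - y <= x /\ x <= y.
Proof. by rewrite ler_norml => /andP[]. Qed.

(** The hypothesis is empty on the real axis, which the boundary meets only at [r] and [- r]. There
    [(z^2 - r^2)^2] vanishes to second order, matching the factor [(Im z)^2]. *)
Lemma square_bound f (M r : R) : 1 <= r -> 0 <= M ->
  (forall z, cn (f z) * complex.Im z ^+ 2 <= M * (1 + `|complex.Im z|) ^+ 2) ->
  forall z, `|complex.Re z| <= r -> `|complex.Im z| <= r ->
  `|complex.Re z| = r \/ `|complex.Im z| = r ->
  cn (f z * ((z * z - (r * r)%:C) * (z * z - (r * r)%:C))) <= 9 * r ^+ 2 * (M * (1 + r) ^+ 2).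
Proof.
move=> r1 M0 H z zr zi bd; rewrite cnM (cnM (z * z - _)).
set q := z * z - _; rewrite -(expr2 (cn q)) cn_sqr /q.
rewrite !(cReD, cImD, cReM, cImM, cReN, cImN)/=.
have := H z; have := cn_ge0 (f z); set F := cn (f z).
move: zr zi bd; set x := complex.Re z; set y := complex.Im z => zr zi bd F0 Hz.
have xE : x ^+ 2 = `|x| ^+ 2 by rewrite real_normK ?num_real.
have yE : y ^+ 2 = `|y| ^+ 2 by rewrite real_normK ?num_real.
have -> : (x * x - y * y - r * r) ^+ 2 + (x * y + y * x - 0) ^+ 2 =
    (x ^+ 2 - r ^+ 2) ^+ 2 + 2 * y ^+ 2 * (x ^+ 2 + r ^+ 2) + y ^+ 4 by ring.
have -> : y ^+ 4 = (y ^+ 2) ^+ 2 by rewrite -exprM.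
rewrite xE yE; rewrite yE in Hz.
move: zr zi bd F0 Hz; have := normr_ge0 x; have := normr_ge0 y.
move: {xE yE} `|x| `|y| => a b b0 a0 ar br bd F0 Hb.
have Fb : F * b ^+ 2 <= M * (1 + r) ^+ 2.
  apply: le_trans Hb _; rewrite ler_wpM2l// ler_pXn2r ?nnegrE ?addr_ge0//; lra.
have b2 : b ^+ 2 <= r ^+ 2 by rewrite ler_pXn2r ?nnegrE//; lra.
have a2 : a ^+ 2 <= r ^+ 2 by rewrite ler_pXn2r ?nnegrE//; lra.
have r2 : 0 <= r ^+ 2 by exact: sqr_ge0.
case: bd => E.
  rewrite (_ : _ * _ = (F * b ^+ 2) * (4 * r ^+ 2 + b ^+ 2)); last by rewrite E; ring.
  rewrite (mulrC (9 * r ^+ 2)).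
  have h1 : 0 <= F * b ^+ 2 by rewrite mulr_ge0// sqr_ge0.
  have h2 : 0 <= 4 * r ^+ 2 + b ^+ 2 by apply: addr_ge0; [apply: mulr_ge0|exact: sqr_ge0].
  have h3 : 4 * r ^+ 2 + b ^+ 2 <= 9 * r ^+ 2 by lra.
  exact: ler_pM.
rewrite (_ : _ * _ = F * (a ^+ 2 * a ^+ 2 + 4 * (r ^+ 2 * r ^+ 2))); last by rewrite E; ring.
rewrite E in Fb.
apply: (@le_trans _ _ (F * (9 * (r ^+ 2 * r ^+ 2)))).
  have : a ^+ 2 * a ^+ 2 <= r ^+ 2 * r ^+ 2 by rewrite ler_pM ?sqr_ge0.
  have : 0 <= r ^+ 2 * r ^+ 2 by rewrite mulr_ge0.
  by move=> ? ?; rewrite ler_wpM2l//; lra.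
rewrite (_ : F * _ = 9 * r ^+ 2 * (F * r ^+ 2)); last by ring.
by rewrite ler_wpM2l// mulr_ge0.
Qed.

(** For [r = 2 |z| + 2] one has [|z^2 - r^2| >= 3 r^2 / 4], so the maximum principle gives
    [(9 / 16) r^4 |f z| <= 9 r^2 M (1 + r)^2]. With [1 + r <= 2 r] the constant is [16 * 4]. *)
Lemma bounded_of_strip_growth f (M : R) : (forall z, peano f z) ->
  (forall z, cn (f z) * complex.Im z ^+ 2 <= M * (1 + `|complex.Im z|) ^+ 2) ->
  forall z, cn (f z) <= 64 * M.
Proof.
move=> Hf H.
have M0 : 0 <= M by have := H 0; rewrite /= normr0 expr0n/= mulr0 addr0 expr1n mulr1.
move=> z; pose r := 2 * cn z + 2.
have z0 := cn_ge0 z; have r1 : 1 <= r by rewrite /r; lra.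
have r0 : 0 < r by rewrite /r; lra.
pose g w := f w * ((w * w - (r * r)%:C) * (w * w - (r * r)%:C)).
have pq w : peano (fun w => w * w - (r * r)%:C) w.
  by apply: peanoB; [apply: peanoM; exact: peano_id|exact: peano_cst].
have Hg w : peano g w by apply: peanoM => //; exact: peanoM.
have zr : cn z <= r by rewrite /r; lra.
have := max_principle r0 Hg (square_bound r1 M0 H) (le_trans (Re_le_cn z) zr)
  (le_trans (Im_le_cn z) zr).
rewrite /g cnM (cnM (z * z - _)).
have : 3 / 4 * r ^+ 2 <= cn (z * z - (r * r)%:C).
  have := @ler_cn_dist R (r * r)%:C (z * z).
  rewrite cn_real cnM (ger0_norm (mulr_ge0 (ltW r0) (ltW r0))) => /normr_itv[_].
  by rewrite /r; nra.
set q := cn (_ - _) => hq.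
have F0 := cn_ge0 (f z); set F := cn (f z) in F0 *.
have r2 : 0 < r ^+ 2 by rewrite exprn_gt0.
have : F * (3 / 4 * r ^+ 2 * (3 / 4 * r ^+ 2)) <= F * (q * q).
  have r34 : 0 <= 3 / 4 * r ^+ 2 by lra.
  by rewrite ler_wpM2l// ler_pM.
move=> /le_trans h /h {}h.
have : F * r ^+ 2 <= 16 * (M * (1 + r) ^+ 2).
  rewrite -(ler_pM2l r2); move: h; lra.
have : M * (1 + r) ^+ 2 <= M * (4 * r ^+ 2).
  by rewrite ler_wpM2l//; nra.
by move=> h1 h2; rewrite -(ler_pM2r r2); lra.
Qed.

Lemma slope_extension f z0 : (forall z, peano f z) ->
  exists g, (forall z, peano g z) /\ forall z, z != 0 -> g z = (f (z0 + z) - f z0) / z.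
Proof.
move=> Hf.
apply: (@peano_quot _ 1 (fun z => f (z0 + z) - f z0) id).
- by move=> z; apply: peanoB; [exact: peano_shift|exact: peano_cst].
- exact: peano_id.
move=> z ->; split.
- by apply: bigO_ext (peano_taylor0 (Hf z0)) => h _; rewrite add0r.
- by apply: bigO_ext bigO_id => h _; rewrite add0r.
- by exists 1, 1; split => // h _ _; rewrite add0r mul1r.
Qed.

(** The slope at [0] is at most [2 B / |w|] at distance [|w|], so the maximum principle on large
    squares makes it zero. *)
Theorem liouville f (M : R) : (forall z, peano f z) ->
  (forall z, cn (f z) * complex.Im z ^+ 2 <= M * (1 + `|complex.Im z|) ^+ 2) ->
  forall z, f z = f 0.
Proof.
move=> Hf H z; have Hb := bounded_of_strip_growth Hf H.
have [->//|z0] := eqVneq z 0.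
have [g [Hg gE]] := slope_extension 0 Hf.
set B := 64 * M in Hb.
have B0 : 0 <= B by apply: le_trans (Hb 0); exact: cn_ge0.
suff : g z = 0.
  rewrite gE// add0r => /eqP; rewrite mulf_eq0 invr_eq0 (negPf z0) orbF subr_eq0.
  by move=> /eqP.
apply/eqP; rewrite -cn_eq0 eq_le cn_ge0 andbT; apply/ler_addgt0Pr => e e0.
rewrite add0r; pose r := cn z + 2 * B / e + 1.
have Be : 0 <= 2 * B / e by apply: divr_ge0; [exact: mulr_ge0|exact: ltW].
have zp := cn_ge0 z; have r0 : 0 < r by rewrite /r; lra.
have zr : cn z <= r by rewrite /r; lra.
suff bd : forall w, `|complex.Re w| <= r -> `|complex.Im w| <= r ->
    `|complex.Re w| = r \/ `|complex.Im w| = r -> cn (g w) <= e.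
  exact: (max_principle r0 Hg bd (le_trans (Re_le_cn z) zr) (le_trans (Im_le_cn z) zr)).
move=> w wr wi bd.
have rw : r <= cn w.
  by case: bd => <-; [exact: Re_le_cn|exact: Im_le_cn].
have w0 : 0 < cn w by exact: lt_le_trans rw.
rewrite gE -?cn_gt0// cnM cnV ler_pdivrMr//.
apply: (@le_trans _ _ (2 * B)).
  by apply: le_trans (cnB _ _) _; rewrite mulr_natl mulr2n lerD.
have -> : 2 * B = e * (2 * B / e) by rewrite [RHS]mulrC divfK// gt_eqF.
apply: ler_wpM2l; first exact: ltW.
by apply: le_trans rw; rewrite /r; lra.
Qed.

(* The derivative at [z + w] is the value at [0] of the slope of [f] at [z + w], to
   which the maximum principle applies on the square of half side [|w|]. *)
Lemma peano_derivative_lipschitz f (c : C -> C) z : (forall z, peano f z) ->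
  (forall z, bigO 2 (fun h => f (z + h) - f z - c z * h)) ->
  bigO 1 (fun w => c (z + w) - c z).
Proof.
move=> Hf Hc; have [M [r [M0 r0 H]]] := Hc z.
(* On the boundary [|w| <= |k| <= 2 |w|], so increments from [z] are at most [3 |w|]. The two errors
   add up to [(9 + 1) M |w|^2], to be divided by [|k|]. *)
exists (10 * M), (r / 3); split; rewrite ?mulr_ge0 ?divr_gt0// => w w0 wr.
have wp : 0 < cn w by rewrite cn_gt0.
have [g [Hg gE]] := slope_extension (z + w) Hf.
have g0 : g 0 = c (z + w).
  apply/eqP; rewrite -subr_eq0; apply/eqP; apply: bigO_cst1.
  have H2 : bigO 1 (fun h => (f (z + w + h) - f (z + w)) / h - c (z + w)).
    apply: bigO_divX; apply: bigO_ext (Hc (z + w)) => h h0.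
    by rewrite mulrBr mulrCA divff// mulr1 (mulrC h).
  apply: (bigO_ext _ (bigOB H2 (peano_taylor0 (Hg 0)))) => h h0.
  by rewrite add0r gE//; ring.
rewrite -g0 expr1.
have := @max_principle R (fun k => g k - c z) (cn w) (10 * M * cn w) wp.
move=> /(_ _ _ 0)-> //=; rewrite ?normr0 ?ltW//.
  by move=> x; apply: peanoB => //; exact: peano_cst.
move=> k kr ki bd.
have wk : cn w <= cn k by case: bd => <-; [exact: Re_le_cn|exact: Im_le_cn].
have k0 : 0 < cn k by exact: lt_le_trans wk.
have k2 : cn k <= 2 * cn w.
  by apply: le_trans (cn_le _) _; rewrite mulr_natl mulr2n lerD.
rewrite gE -?cn_gt0// -(ler_pM2r k0) -cnM mulrBl divfK -?cn_gt0//.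
have bound u : cn u <= 3 * cn w -> cn (f (z + u) - f z - c z * u) <= M * cn u ^+ 2.
  move=> u3; have [->|u0] := eqVneq u 0.
    by rewrite addr0 mulr0 subrr subr0 !cn0 mulr_ge0// sqr_ge0.
  by apply: H => //; move: wr; rewrite ler_pdivlMr//; lra.
have wk3 : cn (w + k) <= 3 * cn w by apply: le_trans (cnD _ _) _; lra.
rewrite (_ : _ - _ - _ = (f (z + (w + k)) - f z - c z * (w + k)) -
  (f (z + w) - f z - c z * w)); last by rewrite addrA; ring.
apply: le_trans (cnB _ _) _.
apply: (@le_trans _ _ (M * (3 * cn w) ^+ 2 + M * cn w ^+ 2)).
  apply: lerD; last by apply: bound; lra.
  apply: le_trans (bound _ wk3) _; rewrite ler_wpM2l// ler_pXn2r// nnegrE ?cn_ge0//.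
  by rewrite mulr_ge0// ltW.
rewrite (_ : _ + _ = 10 * M * cn w * cn w); last by ring.
by rewrite ler_wpM2l// !mulr_ge0// ltW.
Qed.

Local Notation K := (R[i] : numFieldType).

Lemma bigO_is_derive (f : K -> K) (z c : K) :
  bigO 2 (fun h => f (z + h) - f z - c * h) -> is_derive z (1 : K) f c.
Proof.
move=> [M [r [M0 r0 H]]]; apply: bound_is_derive => e.
rewrite ltcE => /andP[/eqP ei /= er].
pose s := Num.min r (complex.Re e / (M + 1)).
have s0 : 0 < s by rewrite lt_min r0 divr_gt0// ltr_wpDl.
exists s%:C; first by rewrite ltcR.
move=> h; rewrite normcE ltcR lt_min => /andP[hr].
rewrite ltr_pdivlMr ?ltr_wpDl// => he.
have -> : e = (complex.Re e)%:C by apply: complex_eqP => //=; rewrite -ei.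
rewrite !normcE -rmorphM lecR.
have [->|h0] := eqVneq h 0; first by rewrite addr0 mulr0 subrr subr0 cn0 mulr0.
apply: le_trans (H h h0 (ltW hr)) _; rewrite expr2 mulrA.
by rewrite ler_wpM2r ?cn_ge0//; have := cn_ge0 h; nra.
Qed.

End Liouville.

(** * Growth of solutions of the Zakharov-Shabat system *)

Section ZakharovShabat.
Context {R : realType}.
Local Notation C := R[i].
Local Notation cmu := (@completed_lebesgue_measure R).
Implicit Types (a b w : R -> C) (lam : C).

Definition iC : C := 0 +i* 1.

Lemma cn_iC : cn iC = 1.
Proof. by rewrite /= expr0n/= add0r expr1n sqrtr1. Qed.

(** This is [e^(i lam z)], the free solution in the second component. *)
Definition cexp lam (z : R) : C :=
  (expR (- (complex.Im lam * z)) * cos (complex.Re lam * z)) +i*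
  (expR (- (complex.Im lam * z)) * sin (complex.Re lam * z)).

Lemma cn_cexp lam z : cn (cexp lam z) = expR (- (complex.Im lam * z)).
Proof.
by rewrite /= !exprMn -mulrDr cos2Dsin2 mulr1 sqrtr_sqr ger0_norm ?expR_ge0.
Qed.

Lemma cexp0 lam : cexp lam 0 = 1.
Proof.
by apply: complex_eqP => /=; rewrite !mulr0 oppr0 expR0 ?cos0 ?sin0 ?mulr1 ?mulr0.
Qed.

Lemma acd_mulr (c : R) : acd (fun z : R => c * z) (fun=> c).
Proof.
by apply: (acd_eq _ _ (acdM (acd_cst c) acd_id)) => z; rewrite ?mul0r ?add0r ?mulr1.
Qed.

Lemma acd_expR (f f' : R -> R) : acd f f' ->
  acd (fun z => expR (f z)) (fun z => f' z * expR (f z)).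
Proof. by apply: acd_comp => //; exact: continuous_expR. Qed.

Lemma cacd_cexp lam : cacd (cexp lam) (fun z => iC * lam * cexp lam z).
Proof.
pose tau := complex.Im lam; pose sig := complex.Re lam.
have hE := acd_expR (acdN (acd_mulr tau)).
have hcos : acd (fun z : R => cos (sig * z)) (fun z => sig * - sin (sig * z)).
  apply: (@acd_comp _ cos (fun x => - sin x)); last exact: acd_mulr.
  by move=> x; apply: continuousN; exact: continuous_sin.
have hsin : acd (fun z : R => sin (sig * z)) (fun z => sig * cos (sig * z)).
  by apply: (@acd_comp _ sin cos); [exact: continuous_cos|exact: acd_mulr].
split.
  apply: (acd_eq _ _ (acdM hE hcos)) => z //.
  by rewrite !(cReM, cImM) /= -/tau -/sig; ring.
apply: (acd_eq _ _ (acdM hE hsin)) => z //.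
by rewrite !(cReM, cImM) /= -/tau -/sig; ring.
Qed.

(** [S * expR (- k)] is nonincreasing. [S] may have either sign, so lower bounds follow by passing
    to [- S] and [- k]. *)
Lemma gronwall (S S' k k' : R -> R) (s t : R) : s <= t -> acd S S' -> acd k k' ->
  {ae cmu, forall z, s < z < t -> S' z <= k' z * S z} ->
  S t <= S s * expR (k t - k s).
Proof.
move=> st hS hk H.
have hF := acdN (acdM hS (acd_expR (acdN hk))).
have := acd_le st hF; rewrite lerN2 => h.
have {h} : S t * expR (- k t) <= S s * expR (- k s).
  apply: h; apply: (ae_imply _ H) => z hz /hz {}hz.
  rewrite (_ : - _ = (k' z * S z - S' z) * expR (- k z)); last by ring.
  by rewrite mulr_ge0 ?expR_ge0// subr_ge0.
by rewrite !expRN ler_pdivrMr ?expR_gt0// -mulrA (mulrC (_^-1)) -expRB.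
Qed.

Definition akns w lam a b :=
  cacd a (fun z => - (iC * lam) * a z + iC * (w z)^*%C * b z) /\
  cacd b (fun z => iC * lam * b z - iC * w z * a z).

(** [h t - h s] plays the role of the integral of [|w|]; only such differences enter the
    estimates. *)
Definition majorized w (h g : R -> R) (s t : R) := acd h g /\
  {ae cmu, forall z, s < z < t -> `|complex.Re (w z)| + `|complex.Im (w z)| <= g z}.

Lemma majorized_sub w h g s t s' t' : s <= s' -> t' <= t ->
  majorized w h g s t -> majorized w h g s' t'.
Proof.
move=> ss tt [hh H]; split => //; apply: (ae_imply _ H) => z Hz /andP[z1 z2].
by apply: Hz; rewrite (le_lt_trans ss)// (lt_le_trans z2).
Qed.

Lemma majorized_le w h g s t : s <= t -> majorized w h g s t -> h s <= h t.
Proof.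
move=> st [hh H]; apply: (acd_le st hh); apply: (ae_imply _ H) => z Hz /Hz.
by apply: le_trans; rewrite addr_ge0.
Qed.

(** [Re lam] drops out. There remain [2 Im lam (|x|^2 - |y|^2)] and the coupling [4 (q U - p V)],
    where [U] and [V] are the real and imaginary parts of [conj x y], each at most half the sum of
    squares. *)
Lemma akns_sum_sqr_derivative (x y v lam : C) (g : R) :
  `|complex.Re v| + `|complex.Im v| <= g ->
  `|2 * (complex.Re x * complex.Re (- (iC * lam) * x + iC * v^*%C * y) +
      complex.Im x * complex.Im (- (iC * lam) * x + iC * v^*%C * y)) +
   2 * (complex.Re y * complex.Re (iC * lam * y - iC * v * x) +
      complex.Im y * complex.Im (iC * lam * y - iC * v * x))| <=
  2 * (`|complex.Im lam| + g) * (cn x ^+ 2 + cn y ^+ 2).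
Proof.
move=> vg; rewrite !cn_sqr.
case: x => x1 x2; case: y => y1 y2; case: v vg => p q /= vg; case: lam => sg tau.
rewrite !(cReD, cImD, cReN, cImN, cReM, cImM)/=.
set A := x1 ^+ 2 + x2 ^+ 2; set B := y1 ^+ 2 + y2 ^+ 2.
pose U := x1 * y1 + x2 * y2; pose V := x1 * y2 - x2 * y1.
rewrite (_ : 2 * _ + 2 * _ = 2 * tau * (A - B) + 4 * (q * U - p * V)); last first.
  by rewrite /A /B /U /V; ring.
have A0 : 0 <= A by rewrite addr_ge0 ?sqr_ge0.
have B0 : 0 <= B by rewrite addr_ge0 ?sqr_ge0.
have hU : `|2 * U| <= A + B.
  rewrite ler_norml /U /A /B; have := sqr_ge0 (x1 - y1); have := sqr_ge0 (x2 - y2).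
  have := sqr_ge0 (x1 + y1); have := sqr_ge0 (x2 + y2).
  by move=> *; apply/andP; split; lra.
have hV : `|2 * V| <= A + B.
  rewrite ler_norml /V /A /B; have := sqr_ge0 (x1 - y2); have := sqr_ge0 (x2 - y1).
  have := sqr_ge0 (x1 + y2); have := sqr_ge0 (x2 + y1).
  by move=> *; apply/andP; split; lra.
have hAB : `|A - B| <= A + B by rewrite ler_norml; apply/andP; split; lra.
apply: le_trans (ler_normD _ _) _.
rewrite (_ : 4 * _ = 2 * (q * (2 * U) - p * (2 * V))); last by ring.
rewrite !normrM (ger0_norm (ler0n R 2)).
have : `|q * (2 * U) - p * (2 * V)| <= g * (A + B).
  apply: le_trans (ler_normB _ _) _; rewrite !(normrM q) !(normrM p).
  apply: (@le_trans _ _ (`|q| * (A + B) + `|p| * (A + B))).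
    by apply: lerD; rewrite ler_wpM2l.
  rewrite -mulrDl; apply: ler_wpM2r; first exact: addr_ge0.
  by rewrite addrC.
have : `|tau| * `|A - B| <= `|tau| * (A + B) by rewrite ler_wpM2l.
by lra.
Qed.

(** The two off-diagonal coefficients are complex conjugates, so the coupling cancels in the
    difference. *)
Lemma akns_diff_sqr_derivative (x y v lam : C) :
  2 * (complex.Re x * complex.Re (- (iC * lam) * x + iC * v^*%C * y) +
      complex.Im x * complex.Im (- (iC * lam) * x + iC * v^*%C * y)) -
   2 * (complex.Re y * complex.Re (iC * lam * y - iC * v * x) +
      complex.Im y * complex.Im (iC * lam * y - iC * v * x)) =
  2 * complex.Im lam * (cn x ^+ 2 + cn y ^+ 2).
Proof.
rewrite !cn_sqr.
case: x => x1 x2; case: y => y1 y2; case: v => p q /=; case: lam => sg tau.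
by rewrite !(cReD, cImD, cReN, cImN, cReM, cImM)/=; ring.
Qed.

Lemma akns_growth w lam a b h g s t : s <= t -> akns w lam a b ->
  majorized w h g s t ->
  cn (a t) ^+ 2 + cn (b t) ^+ 2 <= (cn (a s) ^+ 2 + cn (b s) ^+ 2) *
    expR (2 * (`|complex.Im lam| * (t - s) + (h t - h s))) /\
  (cn (a s) ^+ 2 + cn (b s) ^+ 2) *
    expR (- (2 * (`|complex.Im lam| * (t - s) + (h t - h s)))) <=
  cn (a t) ^+ 2 + cn (b t) ^+ 2.
Proof.
move=> st [ha hb] [hh H].
have hS := acdD (acd_cn_sqr ha) (acd_cn_sqr hb).
have hk := acdM (acd_cst 2) (acdD (acd_mulr `|complex.Im lam|) hh).
split.
  have := gronwall st hS hk.
  rewrite (_ : 2 * _ - 2 * _ = 2 * (`|complex.Im lam| * (t - s) + (h t - h s))); last by ring.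
  apply; apply: (ae_imply _ H) => z Hz /Hz /akns_sum_sqr_derivative Hz'.
  rewrite mul0r add0r; apply: le_trans (ler_norm _) _; exact: Hz'.
have := gronwall st (acdN hS) (acdN hk).
rewrite (_ : - (2 * _) - - (2 * _) = - (2 * (`|complex.Im lam| * (t - s) + (h t - h s)))); last by ring.
rewrite mulNr lerN2; apply; apply: (ae_imply _ H) => z Hz /Hz /akns_sum_sqr_derivative Hz'.
rewrite mul0r add0r mulrNN; have := Hz' (a z) (b z) lam.
by rewrite ler_norml => /andP[+ _]; rewrite lerNl.
Qed.

(** The derivative of the difference of squares is bounded below by a constant, the sum of squares
    at [s] with the worst decay over the whole interval. *)
Lemma akns_indefinite_form w lam a b h g s t : s <= t -> akns w lam a b ->
  majorized w h g s t -> 0 <= complex.Im lam ->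
  2 * complex.Im lam * (t - s) * ((cn (a s) ^+ 2 + cn (b s) ^+ 2) *
    expR (- (2 * (complex.Im lam * (t - s) + (h t - h s))))) <=
  (cn (a t) ^+ 2 - cn (b t) ^+ 2) - (cn (a s) ^+ 2 - cn (b s) ^+ 2).
Proof.
move=> st ab hw tau0; have [ha hb] := ab; have [hh H] := hw.
set c := _ * expR _.
have hE := acdB (acd_cn_sqr ha) (acd_cn_sqr hb).
have hF := acdB hE (acd_mulr (2 * complex.Im lam * c)).
suff : {ae cmu, forall z : R, s < z < t -> 0 <=
    2 * (complex.Re (a z) * complex.Re (- (iC * lam) * a z + iC * (w z)^*%C * b z) +
      complex.Im (a z) * complex.Im (- (iC * lam) * a z + iC * (w z)^*%C * b z)) -
    2 * (complex.Re (b z) * complex.Re (iC * lam * b z - iC * w z * a z) +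
      complex.Im (b z) * complex.Im (iC * lam * b z - iC * w z * a z)) -
    2 * complex.Im lam * c}.
  by move=> /(acd_le st hF); lra.
apply: aeW => z /andP[sz zt].
rewrite akns_diff_sqr_derivative -mulrBr mulr_ge0 ?mulr_ge0// subr_ge0.
have [_] := akns_growth (ltW sz) ab (majorized_sub (lexx _) (ltW zt) hw).
apply: le_trans; rewrite /c ler_wpM2l ?addr_ge0 ?sqr_ge0// ler_expR lerN2 ler_pM2l//.
rewrite ger0_norm// lerD//; first by rewrite ler_wpM2l// lerD2r ltW.
by rewrite lerD2r; exact: majorized_le (ltW zt) (majorized_sub (ltW sz) (lexx _) hw).
Qed.

End ZakharovShabat.

(** * Lower bound for the monodromy near the real axis *)

Section TransferEstimates.
Context {R : realType}.
Local Notation C := R[i].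
Implicit Types (a b w : R -> C) (lam : C).

Lemma le_of_sqr (x y : R) : 0 <= y -> x ^+ 2 <= y ^+ 2 -> x <= y.
Proof.
move=> y0; have [x0|x0 _] := leP 0 x; last by rewrite (le_trans _ y0)// ltW.
by rewrite ler_pXn2r ?nnegrE.
Qed.

(* With [E = |a|^2 - |b|^2], [E' = 2 (Im lam) (|a|^2 + |b|^2)]. *)
Lemma monodromy_lower_bound w h g (s t tau0 : R) : s < t -> 0 < tau0 ->
  majorized w h g s t -> exists2 kappa, 0 < kappa & forall lam a b (eps : C),
    0 < complex.Im lam <= tau0 -> akns w lam a b -> cn eps = 1 ->
    kappa * complex.Im lam * (cn (a s) + cn (b s)) <=
      cn (a t - eps * a s) + cn (b t - eps * b s).
Proof.
move=> st tau00 hw.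
have H0 : 0 <= h t - h s by rewrite subr_ge0; exact: majorized_le (ltW st) hw.
pose m := tau0 * (t - s) + (h t - h s).
have m0 : 0 <= m by rewrite addr_ge0// mulr_ge0 ?subr_ge0 ?ltW.
pose e := expR m; have e0 : 0 < e by exact: expR_gt0.
have e1 : 1 <= e by rewrite -expR0 ler_expR.
have ts : 0 < t - s by rewrite subr_gt0.
(* [e ^+ 2] bounds the decay of the sum of squares; [1 + 2 * e] bounds the moduli at both ends
   against those at [s]. *)
pose kappa := (t - s) / (e ^+ 2 * (1 + 2 * e)).
have D0 : 0 < e ^+ 2 * (1 + 2 * e).
  by rewrite mulr_gt0 ?exprn_gt0// addr_gt0// mulr_gt0.
have kE : kappa * (e ^+ 2 * (1 + 2 * e)) = t - s by rewrite /kappa divfK// gt_eqF.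
have k0 : 0 < kappa by rewrite divr_gt0.
exists kappa => // lam a b eps /andP[tau_gt0 tau_le] hab eps1.
have := akns_indefinite_form (ltW st) hab hw (ltW tau_gt0).
have [up _] := akns_growth (ltW st) hab hw.
move: up; rewrite (ger0_norm (ltW tau_gt0)).
set tau := complex.Im lam in tau_gt0 tau_le *.
set m' := tau * (t - s) + (h t - h s).
have m'm : m' <= m by rewrite lerD2r ler_wpM2r// ltW.
set P := cn (a s); set Q := cn (b s); set P' := cn (a t); set Q' := cn (b t).
have P0 : 0 <= P by exact: cn_ge0.
have Q0 : 0 <= Q by exact: cn_ge0.
have P0' : 0 <= P' by exact: cn_ge0.
have Q0' : 0 <= Q' by exact: cn_ge0.
have ex2 x : expR (2 * x) = expR x ^+ 2 by rewrite mulrC expRM_natr.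
rewrite expRN !ex2 => up low.
have em : expR m' <= e by rewrite ler_expR.
have em0 : 0 < expR m' by exact: expR_gt0.
have em2 : expR m' ^+ 2 <= e ^+ 2 by rewrite ler_pXn2r// nnegrE; exact: ltW.
have em20 : 0 < expR m' ^+ 2 by rewrite exprn_gt0.
have e20 : 0 < e ^+ 2 by rewrite exprn_gt0.
set r1 := cn (a t - eps * a s); set r2 := cn (b t - eps * b s).
have n1 : P' - P <= r1 /\ P - P' <= r1.
  have := @ler_cn_dist R (eps * a s) (a t).
  by rewrite cnM eps1 mul1r -/P -/P' -/r1 ler_norml => /andP[]; lra.
have n2 : Q' - Q <= r2 /\ Q - Q' <= r2.
  have := @ler_cn_dist R (eps * b s) (b t).
  by rewrite cnM eps1 mul1r -/Q -/Q' -/r2 ler_norml => /andP[]; lra.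
have r10 : 0 <= r1 by exact: cn_ge0.
have r20 : 0 <= r2 by exact: cn_ge0.
have S0 : 0 <= P ^+ 2 + Q ^+ 2 by rewrite addr_ge0 ?sqr_ge0.
have nt : P' + Q' <= 2 * e * (P + Q).
  apply: le_of_sqr; first by rewrite !mulr_ge0 ?addr_ge0// ltW.
  apply: (@le_trans _ _ (2 * (P' ^+ 2 + Q' ^+ 2))).
    by have := sqr_ge0 (P' - Q'); lra.
  rewrite (_ : (2 * e * _) ^+ 2 = 4 * e ^+ 2 * (P + Q) ^+ 2); last by ring.
  have : (P ^+ 2 + Q ^+ 2) * expR m' ^+ 2 <= (P + Q) ^+ 2 * e ^+ 2.
    apply: ler_pM; [exact: S0|exact: (ltW em20)| |exact: em2].
    by have := mulr_ge0 P0 Q0; lra.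
  have : 0 <= (P + Q) ^+ 2 * e ^+ 2 by rewrite mulr_ge0 ?sqr_ge0// ltW.
  by lra.
have [n0|n0] := leP (P + Q) 0.
  have -> : P + Q = 0 by apply/eqP; rewrite eq_le n0 addr_ge0.
  by rewrite mulr0 addr_ge0.
(* The growth of [P^2 - Q^2] is factored into [P' - P] and [Q - Q'], at most [r1] and [r2], times
   sums of moduli. *)
have low2 : 2 * tau * (t - s) * ((P ^+ 2 + Q ^+ 2) / e ^+ 2) <=
    (r1 + r2) * ((1 + 2 * e) * (P + Q)).
  apply: (@le_trans _ _ ((P' ^+ 2 - Q' ^+ 2) - (P ^+ 2 - Q ^+ 2))).
    apply: le_trans low; apply: ler_wpM2l; first by rewrite !mulr_ge0// ltW.
    by apply: ler_wpM2l => //; rewrite lef_pV2 ?posrE.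
  apply: (@le_trans _ _ (r1 * (P' + P) + r2 * (Q' + Q))).
    rewrite (_ : _ - _ = (P' - P) * (P' + P) + (Q - Q') * (Q' + Q)); last by ring.
    by apply: lerD; apply: ler_wpM2r; rewrite ?addr_ge0//; lra.
  have pq : P' + P <= (1 + 2 * e) * (P + Q) by lra.
  have qp : Q' + Q <= (1 + 2 * e) * (P + Q) by lra.
  by rewrite mulrDl; apply: lerD; apply: ler_wpM2l.
have half : (P + Q) ^+ 2 <= 2 * (P ^+ 2 + Q ^+ 2) by have := sqr_ge0 (P - Q); lra.
rewrite -(ler_pM2r (x := (e ^+ 2 * (1 + 2 * e)) * (P + Q))); last by rewrite mulr_gt0.
rewrite (_ : kappa * tau * _ * _ = kappa * (e ^+ 2 * (1 + 2 * e)) * tau * (P + Q) ^+ 2); last by ring.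
rewrite kE; apply: (@le_trans _ _ ((t - s) * tau * (2 * (P ^+ 2 + Q ^+ 2)))).
  by rewrite ler_wpM2l// mulr_ge0// ltW.
move: low2; rewrite mulrA ler_pdivrMr//; lra.
Qed.

End TransferEstimates.

(** * Asymptotics of solutions high in the upper half-plane *)

Section TransferAsymptotics.
Context {R : realType}.
Local Notation C := R[i].
Implicit Types (a b w : R -> C) (lam : C).

Lemma expRN_le_inv (x : R) : 0 < x -> expR (- x) <= x^-1.
Proof.
move=> x0; rewrite expRN lef_pV2 ?posrE ?expR_gt0//.
by apply: le_trans (expR_ge1Dx x); rewrite lerDr.
Qed.

Lemma ac_uniform (f : R -> R) (a b e : R) : a <= b -> loc_abs_continuous f -> 0 < e ->
  exists2 d, 0 < d & forall u v, a <= u -> u <= v -> v <= b -> v - u < d ->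
    `|f v - f u| < e.
Proof.
move=> ab acf e0; have [d d0 hd] := acf a b ab e e0.
exists d => // u v zu uv vz uvd; have := hd 1%N (fun=> u) (fun=> v).
rewrite !big_ord1; apply => //.
by apply/trivIsetP => i j; rewrite !ord1 eqxx.
Qed.

(* In the upper half-plane [e^(i lam z) b] decays, uniformly away from [s], and then
   [e^(i lam z) a] is almost constant. *)
Lemma transfer_asymptotics w h g (s t eta : R) : s < t -> 0 < eta ->
  majorized w h g s t -> exists2 T, 0 < T & forall lam a b,
    T <= complex.Im lam -> akns w lam a b -> cn (a s) <= 1 -> cn (b s) <= 1 ->
    cn (cexp lam (t - s) * a t - a s) <= eta /\ cn (cexp lam (t - s) * b t) <= eta.
Proof.
move=> st eta0 hw.
have H0 : 0 <= h t - h s by rewrite subr_ge0; exact: majorized_le (ltW st) hw.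
set H := h t - h s in H0.
pose K := 2 * expR H; have K0 : 0 < K by rewrite mulr_gt0// expR_gt0.
have KE : K = 2 * expR H by []; clearbody K.
(* [K] will bound both rescaled components; the final errors [K om (1 + 2 H)] and [2 K om] then stay
   below [eta]. *)
pose om := eta / (4 * K * (1 + H)).
have H1 : 0 < 1 + H by lra.
have D0 : 0 < 4 * K * (1 + H) by rewrite !mulr_gt0.
have om0 : 0 < om by rewrite divr_gt0.
have omE : om * (4 * K * (1 + H)) = eta by rewrite /om divfK// gt_eqF.
clearbody om.
have [d d0 hd] := ac_uniform (ltW st) hw.1.1 om0.
pose rho := Num.min (t - s) (d / 2).
have rho0 : 0 < rho by rewrite lt_min subr_gt0 st divr_gt0.
have rho_ts : rho <= t - s by rewrite ge_min lexx.
have rho_d : rho < d.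
  by rewrite (@le_lt_trans _ _ (d / 2)) ?ge_min ?lexx ?orbT//; lra.
(* Chosen so that [expR (- (2 * tau * rho)) <= om], by [expR (- x) <= x^-1]. *)
pose T := (2 * rho * om)^-1.
have T0 : 0 < T by rewrite invr_gt0 !mulr_gt0.
have TE : T * (2 * rho * om) = 1 by rewrite /T mulVf// gt_eqF// !mulr_gt0.
clearbody T.
exists T => // lam a b Tl hab as1 bs1.
set tau := complex.Im lam in Tl.
have tau0 : 0 < tau by exact: lt_le_trans Tl.
have [ha hb] := hab; have [hh Hw] := hw.
pose E z := cexp lam (z - s).
have cnE z : cn (E z) = expR (- (tau * (z - s))) by rewrite cn_cexp.
have bound z : s <= z -> z <= t -> cn (E z * a z) <= K /\ cn (E z * b z) <= K.
  move=> sz zt.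
  have hz := majorized_sub (lexx s) zt hw.
  have [+ _] := akns_growth sz hab hz.
  rewrite (ger0_norm (ltW tau0)) => up.
  have hzt : h z <= h t by exact: majorized_le zt (majorized_sub sz (lexx _) hw).
  have : cn (E z * a z) ^+ 2 + cn (E z * b z) ^+ 2 <= K ^+ 2.
    rewrite !cnM !exprMn -mulrDr cnE.
    have -> : expR (- (tau * (z - s))) ^+ 2 = (expR (2 * (tau * (z - s))))^-1.
      by rewrite -expRN -expRM_natr; congr expR; ring.
    rewrite mulrC ler_pdivrMr ?expR_gt0//; apply: le_trans up _.
    rewrite (mulrDr 2) expRD mulrCA (mulrC (K ^+ 2)) ler_pM2l ?expR_gt0//.
    have -> : K ^+ 2 = 4 * expR (2 * H).
      by rewrite KE exprMn (mulrC 2 H) expRM_natr; ring.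
    apply: ler_pM; rewrite ?addr_ge0 ?sqr_ge0 ?expR_ge0//.
      apply: (@le_trans _ _ (1 + 1)); last by lra.
      by apply: lerD; rewrite exprn_ile1// cn_ge0.
    by rewrite ler_expR ler_pM2l// /H lerD2r.
  by split; apply: le_of_sqr => //; [exact: ltW| |exact: ltW|];
    have := sqr_ge0 (cn (E z * a z)); have := sqr_ge0 (cn (E z * b z)); lra.
have cnw z : cn (w z) <= `|complex.Re (w z)| + `|complex.Im (w z)| by exact: cn_le.
have expsmall : expR (- (2 * tau * rho)) <= om.
  apply: le_trans (expRN_le_inv _) _; first by rewrite !mulr_gt0.
  rewrite -(invrK om) lef_pV2 ?posrE ?invr_gt0 ?mulr_gt0//.
  rewrite -(ler_pM2r om0) mulVf ?gt_eqF//.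
  have : 0 <= (tau - T) * (rho * om) by rewrite mulr_ge0 ?subr_ge0// mulr_ge0// ltW.
  lra.

(* Variation of constants on [[z - rho, z]]: the past is damped by [expR (- (2 * tau * rho))], and
   the source is small because [h] varies by at most [om]. Each contributes [K * om]. *)
have decay z : s + rho <= z -> z <= t -> cn (E z * b z) <= 2 * K * om.
  move=> sz zt.
  have szr : s <= z - rho by lra.
  have zrz : z - rho <= z by lra.
  pose G x := cexp (- lam) (x - z) * b x.
  have hG : cacd G (fun x => - (iC * cexp (- lam) (x - z) * w x * a x)).
    have := cacdM (cacd_shift (- z) (cacd_cexp (- lam))) hb.
    by apply: cacd_eq => // x; ring.
  have hKh := acdM (acd_cst (K * expR (tau * (z - s)))) hh.
  have hGb : cn (G z - G (z - rho)) <= K * expR (tau * (z - s)) * h z - K * expR (tau * (z - s)) * h (z - rho).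
    apply: (cacd_mvt zrz hG hKh).
    apply: (ae_imply _ Hw) => x Hx /andP[x1 x2].
    have {}Hx : cn (w x) <= g x by apply: le_trans (cnw x) (Hx _); lra.
    rewrite mul0r add0r cnN !cnM cn_iC mul1r cn_cexp cImN mulNr opprK.
    have [ba _] := bound x ltac:(lra) ltac:(lra).
    move: ba; rewrite cnM cnE expRN mulrC ler_pdivrMr ?expR_gt0// => ba.
    apply: (@le_trans _ _ (expR (tau * (x - z)) * g x * (K * expR (tau * (x - s))))).
      apply: ler_pM => //; rewrite ?mulr_ge0 ?expR_ge0 ?cn_ge0//.
      by rewrite ler_wpM2l ?expR_ge0.
    rewrite (_ : _ * _ * _ = (expR (tau * (x - z)) * expR (tau * (x - s))) * (K * g x)); last by ring.
    rewrite (_ : K * _ * _ = expR (tau * (z - s)) * (K * g x)); last by ring.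
    rewrite ler_wpM2r//; first by rewrite mulr_ge0 ?(ltW K0)// (le_trans _ Hx)// cn_ge0.
    by rewrite -expRD ler_expR -mulrDr ler_pM2l//; lra.
  rewrite -mulrBr in hGb.
  have hom : h z - h (z - rho) <= om.
    apply: le_trans (ler_norm _) _; apply: ltW; apply: hd => //; lra.
  have Gz : G z = b z by rewrite /G subrr cexp0 mul1r.
  have [_ bzr] := bound (z - rho) szr ltac:(lra).
  have Gzr : cn (G (z - rho)) <= om * (K * expR (tau * (z - s))).
    rewrite /G cnM cn_cexp cImN mulNr opprK.
    move: bzr; rewrite cnM cnE expRN mulrC ler_pdivrMr ?expR_gt0// => bzr.
    apply: (@le_trans _ _ (expR (tau * (z - rho - z)) * (K * expR (tau * (z - rho - s))))).
      by rewrite ler_wpM2l ?expR_ge0.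
    rewrite mulrCA (mulrCA om) ler_pM2l//.
    have -> : expR (tau * (z - rho - z)) * expR (tau * (z - rho - s)) =
        expR (- (2 * tau * rho)) * expR (tau * (z - s)).
      by rewrite -!expRD; congr expR; ring.
    by rewrite ler_pM2r ?expR_gt0.
  rewrite cnM cnE expRN mulrC ler_pdivrMr ?expR_gt0//.
  have : cn (b z) <= cn (G z - G (z - rho)) + cn (G (z - rho)).
    by apply: le_trans (cnD _ _); rewrite subrK Gz.
  have : K * expR (tau * (z - s)) * (h z - h (z - rho)) <= K * expR (tau * (z - s)) * om.
    by rewrite ler_wpM2l// mulr_ge0 ?expR_ge0// ltW.
  by move: hGb Gzr; lra.
have bt := decay t ltac:(lra) (lexx t).
have hEa : cacd (fun z => E z * a z) (fun z => iC * E z * (w z)^*%C * b z).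
  have := cacdM (cacd_shift (- s) (cacd_cexp lam)) ha.
  by apply: cacd_eq => // z; rewrite /E; ring.
(* The derivative of [E * a] is [i w^* (E * b)], so [E * a] moves as much as [E * b] allows: bounded
   by [K] over the first [rho], by [decay] afterwards. *)
have drift M u v : s <= u -> u <= v -> v <= t ->
    (forall z, u < z < v -> cn (E z * b z) <= M) ->
    cn (E v * a v - E u * a u) <= M * (h v - h u).
  move=> su uv vt HM; rewrite mulrBr.
  apply: (cacd_mvt uv hEa (acdM (acd_cst M) hh)); apply: (ae_imply _ Hw) => z Hz zuv.
  have {}Hz : cn (w z) <= g z.
    by apply: le_trans (cnw z) (Hz _); move: zuv => /andP[? ?]; lra.
  rewrite mul0r add0r (_ : iC * E z * _ * b z = iC * ((w z)^*%C * (E z * b z))); last by ring.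
  rewrite cnM cn_iC mul1r cnM cnJ mulrC; apply: ler_pM; rewrite ?cn_ge0//.
  exact: HM.
have E0 : E s * a s = a s by rewrite /E subrr cexp0 mul1r.
have d1 : cn (E (s + rho) * a (s + rho) - a s) <= K * om.
  rewrite -E0; apply: le_trans (drift K _ _ _ _ _ _) _; rewrite ?lerDl ?(ltW rho0)//; first by lra.
    by move=> z /andP[? ?]; have [] := bound z ltac:(lra) ltac:(lra).
  rewrite ler_pM2l//; apply: le_trans (ler_norm _) _; apply: ltW; apply: hd; lra.
have d2 : cn (E t * a t - E (s + rho) * a (s + rho)) <= 2 * K * om * H.
  apply: le_trans (drift (2 * K * om) _ _ _ _ _ _) _; rewrite ?lerDl ?(ltW rho0)//; first by lra.
    by move=> z /andP[? ?]; apply: decay; lra.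
  apply: ler_wpM2l; first by rewrite !mulr_ge0// ltW.
  rewrite /H lerD2l lerN2.
  by apply: majorized_le (majorized_sub (lexx s) _ hw); lra.
rewrite -/(E t); split.
  apply: le_trans (_ : cn ((E t * a t - E (s + rho) * a (s + rho)) +
    (E (s + rho) * a (s + rho) - a s)) <= _).
    by rewrite addrA subrK.
  apply: le_trans (cnD _ _) _.
  have := mulr_ge0 (ltW K0) (ltW om0).
  have := mulr_ge0 (mulr_ge0 (ltW K0) (ltW om0)) H0.
  by move: d1 d2; rewrite -omE; lra.
apply: le_trans bt _; rewrite -omE.
have := mulr_ge0 (ltW K0) (ltW om0).
have := mulr_ge0 (mulr_ge0 (ltW K0) (ltW om0)) H0.
by lra.
Qed.

End TransferAsymptotics.

(** * Algebra of two by two matrices *)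

Section TwoByTwo.
Context {K : comNzRingType}.
Implicit Types A B : 'M[K]_2.

Lemma matrix2P A B : A 0 0 = B 0 0 -> A 0 1 = B 0 1 -> A 1 0 = B 1 0 ->
  A 1 1 = B 1 1 -> A = B.
Proof.
move=> h00 h01 h10 h11; apply/matrixP => i j.
by case: (ord2P i) => ->; case: (ord2P j) => ->.
Qed.

Lemma mulmx2E m n (A : 'M[K]_(m, 2)) (B : 'M[K]_(2, n)) i j :
  (A *m B) i j = A i 0 * B 0 j + A i 1 * B 1 j.
Proof.
rewrite !mxE !big_ord_recl big_ord0 addr0.
by have -> : lift ord0 ord0 = 1 :> 'I_2 by exact/val_inj.
Qed.

Lemma det2E A : \det A = A 0 0 * A 1 1 - A 0 1 * A 1 0.
Proof.
have := congr1 (fun M : 'M[K]_2 => M 0 0) (mul_mx_adj A).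
by rewrite mulmx2E adj2E !mxE /= mulr1n mulrN => <-.
Qed.

Lemma tr2E A : \tr A = A 0 0 + A 1 1.
Proof.
rewrite /mxtrace !big_ord_recl big_ord0 addr0.
by have -> : lift ord0 ord0 = 1 :> 'I_2 by exact/val_inj.
Qed.

Lemma mx2E (a b c d : K) : [/\ (mx2 a b c d) 0 0 = a, (mx2 a b c d) 0 1 = b,
  (mx2 a b c d) 1 0 = c & (mx2 a b c d) 1 1 = d].
Proof. by split; rewrite mxE. Qed.

Lemma adj2M A B : \adj (A *m B) = \adj B *m \adj A.
Proof.
rewrite !adj2E.
by apply: matrix2P; rewrite !mulmx2E !mxE /= ; ring.
Qed.

Lemma adj2K A : \adj (\adj A) = A.
Proof. by rewrite !adj2E; apply: matrix2P; rewrite !mxE/= ?opprK. Qed.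

Lemma adj2_det1 A : \det A = 1 -> A *m \adj A = 1%:M /\ \adj A *m A = 1%:M.
Proof. by move=> d1; rewrite mul_mx_adj mul_adj_mx d1. Qed.

Lemma det_adj2 A : \det (\adj A) = \det A.
Proof. by rewrite !det2E adj2E !mxE/=; ring. Qed.

End TwoByTwo.

(** * Fundamental solutions and their dependence on the spectral parameter *)

Section FundamentalSolution.
Context {R : realType}.
Local Notation C := R[i].
Local Notation cmu := (@completed_lebesgue_measure R).
Implicit Types (w : R -> C) (lam v : C).

Definition bmat v lam : 'M[C]_2 :=
  mx2 (- (iC * lam)) (iC * v^*%C) (- (iC * v)) (iC * lam).

Definition solves w lam n (V : R -> 'M[C]_(2, n)) :=
  mcacd V (fun z => bmat (w z) lam *m V z).

Lemma solves_akns w lam n (V : R -> 'M[C]_(2, n)) j : solves w lam V ->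
  akns w lam (fun z => V z 0 j) (fun z => V z 1 j).
Proof.
move=> hV; split.
  by apply: (cacd_eq _ _ (hV 0 j)) => z //; rewrite mulmx2E !mxE/=.
by apply: (cacd_eq _ _ (hV 1 j)) => z //; rewrite mulmx2E !mxE/=; ring.
Qed.

Lemma solvesM w lam m n (V : R -> 'M[C]_(2, m)) (A : 'M[C]_(m, n)) :
  solves w lam V -> solves w lam (fun z => V z *m A).
Proof.
move=> hV; apply: (mcacd_eq _ _ (mcacdM hV (mcacd_cst A))) => z //.
by rewrite mulmx0 addr0 mulmxA.
Qed.

Lemma adj_bmat v lam : \adj (bmat v lam) = - bmat v lam.
Proof. by rewrite adj2E /bmat; apply: matrix2P; rewrite !mxE/= ?opprK. Qed.

Lemma solves_shift w lam n (V : R -> 'M[C]_(2, n)) c : solves w lam V ->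
  solves (fun z => w (z + c)) lam (fun z => V (z + c)).
Proof. by move=> /(mcacd_shift c). Qed.

Lemma solves_ae w w' lam n (V : R -> 'M[C]_(2, n)) :
  {ae cmu, forall z, w z = w' z} -> solves w lam V -> solves w' lam V.
Proof.
move=> ww hV; apply: (mcacd_sub_derive hV); apply: (ae_imply _ ww) => z.
by move=> ->.
Qed.

(** [bmat] has trace zero, so [\adj X] solves the adjoint equation. [V = X] yields the constancy of
    the determinant, a general [V] uniqueness. *)
Lemma wronskian_const w lam (X : R -> 'M[C]_2) n (V : R -> 'M[C]_(2, n)) :
  solves w lam X -> solves w lam V ->
  forall z z', \adj (X z) *m V z = \adj (X z') *m V z'.
Proof.
move=> hX hV; apply: (mcacd_const (mcacdM (mcacd_adj hX) hV)).
by apply: aeW => z; rewrite adj2M adj_bmat mulmxN mulNmx -!mulmxA addNr.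
Qed.

Lemma solves_det w lam (X : R -> 'M[C]_2) : solves w lam X -> X 0 = 1%:M ->
  forall z, \det (X z) = 1.
Proof.
move=> hX X0 z; have := wronskian_const hX hX z 0.
rewrite !mul_adj_mx X0 det1 => /(congr1 (fun M : 'M[C]_2 => M 0 0)).
by rewrite !mxE /= !mulr1n.
Qed.

Lemma solves_unique w lam (X : R -> 'M[C]_2) n (V : R -> 'M[C]_(2, n)) :
  solves w lam X -> X 0 = 1%:M -> solves w lam V -> forall z, V z = X z *m V 0.
Proof.
move=> hX X0 hV z; have [XX _] := adj2_det1 (solves_det hX X0 z).
have := wronskian_const hX hV z 0.
rewrite X0 (_ : \adj 1%:M = 1%:M) ?mul1mx => [<-|]; first by rewrite mulmxA XX mul1mx.
by have := mul_mx_adj (1%:M : 'M[C]_2); rewrite mul1mx det1.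
Qed.

(** The adjugate stands for the inverse, fundamental matrices having determinant one. *)
Definition transfer (X : R -> 'M[C]_2) (s t : R) := X t *m \adj (X s).

Lemma transfer_solves w lam (X : R -> 'M[C]_2) s : solves w lam X ->
  solves w lam (transfer X s).
Proof. exact: solvesM. Qed.

Lemma transfer_trans w lam (X : R -> 'M[C]_2) s t u : solves w lam X -> X 0 = 1%:M ->
  transfer X s u = transfer X t u *m transfer X s t.
Proof.
move=> hX X0; rewrite /transfer mulmxA -(mulmxA (X u)).
by have [_ ->] := adj2_det1 (solves_det hX X0 t); rewrite mulmx1.
Qed.

Lemma transfer_id w lam (X : R -> 'M[C]_2) s : solves w lam X -> X 0 = 1%:M ->
  transfer X s s = 1%:M.
Proof. by move=> hX X0; have [] := adj2_det1 (solves_det hX X0 s). Qed.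

Lemma transfer_det w lam (X : R -> 'M[C]_2) s t : solves w lam X -> X 0 = 1%:M ->
  \det (transfer X s t) = 1.
Proof. by move=> hX X0; rewrite det_mulmx det_adj2 !(solves_det hX X0) mulr1. Qed.

(* The system is real: complex conjugation combined with the exchange of the two
   components maps solutions for [lam] to solutions for its conjugate. *)
Definition swapconj2 (A : 'M[C]_2) : 'M[C]_2 :=
  mx2 (A 1 1)^*%C (A 1 0)^*%C (A 0 1)^*%C (A 0 0)^*%C.

Lemma iCJ : (iC : C)^*%C = - iC.
Proof. by apply: complex_eqP => /=; rewrite ?oppr0. Qed.

Lemma cJM (x y : C) : (x * y)^*%C = x^*%C * y^*%C.
Proof. exact: rmorphM. Qed.

Lemma cJD (x y : C) : (x + y)^*%C = x^*%C + y^*%C.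
Proof. exact: rmorphD. Qed.

Lemma cJN (x : C) : (- x)^*%C = - x^*%C.
Proof. exact: rmorphN. Qed.

Lemma solves_conj w lam (X : R -> 'M[C]_2) : solves w lam X ->
  solves w lam^*%C (fun z => swapconj2 (X z)).
Proof.
move=> hX i j.
by case: (ord2P i) => ->; case: (ord2P j) => ->;
  [apply: (cacd_eq _ _ (cacd_conj (hX 1 1)))|apply: (cacd_eq _ _ (cacd_conj (hX 1 0)))|
   apply: (cacd_eq _ _ (cacd_conj (hX 0 1)))|apply: (cacd_eq _ _ (cacd_conj (hX 0 0)))] => z;
  rewrite ?mulmx2E !mxE/= ?(cJD, cJM, cJN, iCJ, conjcK); ring.
Qed.

Lemma swapconj2_fundamental w lam (X : R -> 'M[C]_2) (X' : R -> 'M[C]_2) :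
  solves w lam X -> X 0 = 1%:M -> solves w lam^*%C X' -> X' 0 = 1%:M ->
  forall z, X' z = swapconj2 (X z).
Proof.
move=> hX X0 hX' X0' z.
rewrite (solves_unique hX' X0' (solves_conj hX)) X0 (_ : swapconj2 1%:M = 1%:M) ?mulmx1//.
by apply: matrix2P; rewrite !mxE; apply: complex_eqP; rewrite ?cReJ ?cImJ /= ?oppr0.
Qed.

End FundamentalSolution.

(** * Expansion of solutions in the spectral parameter *)

Section SpectralExpansion.
Context {R : realType}.
Local Notation C := R[i].
Local Notation mu := (@lebesgue_measure R).
Implicit Types (w : R -> C) (lam : C).

Lemma acd_antiderivative (f : R -> R) (T : R) : continuous f ->
  exists G G', [/\ acd G G', G 0 = 0 & forall z, 0 <= z <= T -> G' z = f z].
Proof.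
move=> cf.
have intf : mu.-integrable `[0, T]%classic (EFin \o f).
  apply: continuous_compact_integrable; first exact: segment_compact.
  exact: continuous_subspaceT.
have : mu.-integrable [set: R] (EFin \o (f \_ `[0, T]%classic)).
  have := (@integrable_mkcond _ _ R mu `[0, T]%classic (EFin \o f) (measurable_itv _)).1 intf.
  by rewrite restrict_EFin.
move=> /indefinite_integral_acd hF; set F := (fun x => _) in hF.
exists (fun z => F z - F 0), (f \_ `[0, T]%classic); split.
- by apply: (acd_eq _ _ (acdB hF (acd_cst (F 0)))) => z; rewrite ?subr0.
- exact: subrr.
- by move=> z hz; rewrite patchE mem_set//= in_itv.
Qed.

Lemma mcacd_antiderivative m n (F F' : R -> 'M[C]_(m, n)) (T : R) : mcacd F F' ->
  exists G G', [/\ mcacd G G', G 0 = 0 & forall z, 0 <= z <= T -> G' z = F z].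
Proof.
move=> hF.
have H i j : exists G G', [/\ cacd G G', G 0 = 0 & forall z, 0 <= z <= T -> G' z = F z i j].
  have [c1 c2] := cacd_continuous (hF i j).
  have [G1 [G1' [h1 z1 e1]]] := acd_antiderivative T c1.
  have [G2 [G2' [h2 z2 e2]]] := acd_antiderivative T c2.
  exists (fun z => G1 z +i* G2 z), (fun z => G1' z +i* G2' z); split => //.
    by rewrite z1 z2.
  by move=> z hz; rewrite e1// e2//; case: (F z i j).
pose G i j := projT1 (cid (H i j)).
pose G' i j := projT1 (cid (projT2 (cid (H i j)))).
have HG i j : [/\ cacd (G i j) (G' i j), G i j 0 = 0 &
    forall z, 0 <= z <= T -> G' i j z = F z i j].
  by rewrite /G /G'; case: cid => /= G0 h; case: cid.
exists (fun z => \matrix_(i, j) G i j z), (fun z => \matrix_(i, j) G' i j z); split.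
- by move=> i j; have [h _ _] := HG i j; apply: (cacd_eq _ _ h) => z; rewrite mxE.
- by apply/matrixP => i j; rewrite !mxE; have [] := HG i j.
- by move=> z hz; apply/matrixP => i j; rewrite !mxE; have [_ _ ->] := HG i j.
Qed.

Section Window.
Variables (w : R -> C) (X : C -> R -> 'M[C]_2) (T : R) (h g : R -> R).
Hypotheses (hX : forall lam, solves w lam (X lam)) (X0 : forall lam, X lam 0 = 1%:M).
Hypotheses (T0 : 0 <= T) (hw : majorized w h g 0 T).

Lemma fundamental_bound (tau0 : R) : exists2 M, 0 <= M & forall lam z i j,
  `|complex.Im lam| <= tau0 -> 0 <= z <= T -> cn (X lam z i j) <= M.
Proof.
pose m := tau0 * T + (h T - h 0).
exists (expR m) => [|lam z i j ht /andP[z0 zT]]; first exact: expR_ge0.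
have [up _] := akns_growth z0 (solves_akns j (hX lam)) (majorized_sub (lexx _) zT hw).
have init : cn (X lam 0 0 j) ^+ 2 + cn (X lam 0 1 j) ^+ 2 = 1.
  have d (k l : 'I_2) : cn ((1%:M : 'M[C]_2) k l) = (k == l)%:R.
    by rewrite mxE; case: (k == l); rewrite ?cn1 ?cn0.
  by rewrite X0 !d; case: (ord2P j) => ->; rewrite /=; ring.
rewrite init mul1r in up.
have ex : expR (2 * (`|complex.Im lam| * (z - 0) + (h z - h 0))) <= expR m ^+ 2.
  rewrite -expRM_natr ler_expR mulrC ler_pM2r// /m lerD//.
    by rewrite subr0 ler_pM.
  by rewrite lerD2r; exact: majorized_le zT (majorized_sub z0 (lexx _) hw).
apply: le_of_sqr; first exact: expR_ge0.
apply: le_trans ex; apply: le_trans up.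
by case: (ord2P i) => ->; rewrite ?lerDl ?lerDr sqr_ge0.
Qed.

Section Perturbation.
Variable lam0 : C.

Let K z := \adj (X lam0 z) *m (mx2 (- iC) 0 0 iC *m X lam0 z).

Let W hh z := \adj (X lam0 z) *m X (lam0 + hh) z.

(** The potential cancels in the difference of the coefficient matrices, which is [hh] times a
    constant diagonal matrix. So the kernel [K] is continuous although [w] need not be. *)
Lemma perturbation_solves hh : mcacd (W hh) (fun z => hh *: (K z *m W hh z)).
Proof.
apply: (mcacd_eq _ _ (mcacdM (mcacd_adj (hX lam0)) (hX (lam0 + hh)))) => z //.
rewrite adj2M adj_bmat mulmxN mulNmx -!mulmxA addrC -mulmxBr -mulmxBl /K /W.
rewrite -?mulmxA (mulmxA (X lam0 z)).
have [-> _] := adj2_det1 (solves_det (hX lam0) (X0 lam0) z).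
rewrite mul1mx scalemxAr scalemxAl; congr (_ *m (_ *m _)).
by apply: matrix2P; rewrite !mxE/=; ring.
Qed.

Lemma kernel_mcacd : exists K', mcacd K K'.
Proof.
eexists; apply: mcacdM; first exact: mcacd_adj (hX lam0).
by apply: mcacdM; [exact: mcacd_cst|exact: hX].
Qed.

Lemma dyson_coefficients : exists P P' : nat -> R -> 'M[C]_2,
  [/\ forall k, mcacd (P k) (P' k), P 0%N = (fun=> 1%:M),
      forall k, P k.+1 0 = 0 &
      forall k z, 0 <= z <= T -> P' k.+1 z = K z *m P k z] /\ P' 0%N = (fun=> 0).
Proof.
have [K' hK] := kernel_mcacd.
(* The iteration runs on pairs, since integrating [K *m P k] relies on the absolute continuity of
   [P k]. *)
pose S := {FF : (R -> 'M[C]_2) * (R -> 'M[C]_2) | mcacd FF.1 FF.2}.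
have H (s : S) : exists s' : S, (sval s').1 0 = 0 /\
    forall z, 0 <= z <= T -> (sval s').2 z = K z *m (sval s).1 z.
  case: s => -[F F'] /= hF.
  have [G [G' [hG G0 GE]]] := mcacd_antiderivative T (mcacdM hK hF).
  by exists (exist _ (G, G') hG).
pose next s := projT1 (cid (H s)).
pose s0 : S := exist _ (fun=> 1%:M, fun=> 0) (mcacd_cst 1%:M).
pose Q k := iter k next s0.
exists (fun k => (sval (Q k)).1), (fun k => (sval (Q k)).2); split => //; split => //.
- by move=> k; exact: (svalP (Q k)).
- by move=> k; rewrite /= /next; case: cid => s' [].
- by move=> k z hz; rewrite /= {1}/next; case: cid => s' [_ /= ->].
Qed.

(** The remainder after [n + 1] terms vanishes at [0], and its derivative is [hh K] times the
    remainder after [n] terms; each integration gains a power of [hh]. *)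
Lemma dyson_expansion (P P' : nat -> R -> 'M[C]_2) :
  (forall k, mcacd (P k) (P' k)) -> P 0%N = (fun=> 1%:M) -> P' 0%N = (fun=> 0) ->
  (forall k, P k.+1 0 = 0) ->
  (forall k z, 0 <= z <= T -> P' k.+1 z = K z *m P k z) ->
  forall n, exists2 M, 0 <= M & forall hh z i j, cn hh <= 1 -> 0 <= z <= T ->
    cn ((W hh z - \sum_(k < n) hh ^+ k *: P k z) i j) <= M * cn hh ^+ n.
Proof.
move=> hP P0 P0' Pz PE.
have [KM KM0 hKM] : exists2 KM, 0 <= KM & forall z i j, 0 <= z <= T -> cn (K z i j) <= KM.
  have [K' hK] := kernel_mcacd.
  have [b Hb] : exists b : 'I_2 -> 'I_2 -> R, forall i j, 0 <= b i j /\
      forall z, 0 <= z <= T -> cn (K z i j) <= b i j.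
    pose b i j := s2val (cid2 (cacd_bounded 0 T (hK i j))).
    by exists b => i j; rewrite /b; case: cid2.
  exists (\sum_i \sum_j b i j) => [|z i j hz].
    by apply: sumr_ge0 => i _; apply: sumr_ge0 => j _; have [] := Hb i j.
  apply: le_trans ((Hb i j).2 z hz) _.
  rewrite (bigD1 i)//= (bigD1 j)//= -addrA lerDl addr_ge0//.
    by apply: sumr_ge0 => k _; have [] := Hb i k.
  by apply: sumr_ge0 => k _; apply: sumr_ge0 => l _; have [] := Hb k l.
elim=> [|n [M M0 IH]].
  have [M M0 hM] := fundamental_bound (`|complex.Im lam0| + 1).
  exists (M * M + M * M); first by rewrite addr_ge0 ?mulr_ge0.
  move=> hh z i j h1 hz; rewrite big_ord0 subr0 expr0 mulr1 /W mulmx2E.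
  have b1 k l : cn (X lam0 z k l) <= M by apply: hM => //; rewrite lerDl.
  have b2 k l : cn (X (lam0 + hh) z k l) <= M.
    apply: hM => //; rewrite cImD; apply: le_trans (ler_normD _ _) _.
    by rewrite lerD2l; apply: le_trans (Im_le_cn _) h1.
  have b3 k l : cn ((\adj (X lam0 z)) k l) <= M.
    by rewrite adj2E mxE; case: ifP => _; case: ifP => _; rewrite ?cnN.
  apply: le_trans (cnD _ _) _; rewrite !cnM.
  by apply: lerD; apply: ler_pM; rewrite ?cn_ge0.
exists (2 * KM * M * T); first by rewrite !mulr_ge0.
move=> hh z i j h1 /andP[z0 zT].
pose E m x := W hh x - \sum_(k < m) hh ^+ k *: P k x.
have hE : mcacd (E n.+1) (fun x => hh *: (K x *m W hh x) - \sum_(k < n.+1) hh ^+ k *: P' k x).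
  move=> i' j'.
  have hs := cacd_sum (index_enum 'I_n.+1) (fun k : 'I_n.+1 => cacdZ (hh ^+ k) (hP k i' j')).
  have := cacdB (perturbation_solves hh i' j') hs.
  apply: cacd_eq => x; rewrite !mxE summxE; congr (_ - _);
  by apply: eq_bigr => k _; rewrite mxE.
have E0 : E n.+1 0 = 0.
  rewrite /E /W X0 X0 big_ord_recl P0 expr0 scale1r big1 => [|k _]; last first.
    by rewrite lift0 Pz scaler0.
  by rewrite addr0 mul_adj_mx det1 subrr.
have := cacd_mvt z0 (hE i j) (acd_mulr (2 * KM * M * cn hh ^+ n.+1)).
rewrite E0 mulr0 subr0 [X in _ - X]mxE subr0 => H.
apply: le_trans (H _) _; last first.
  rewrite (_ : 2 * KM * M * T * _ = 2 * KM * M * cn hh ^+ n.+1 * T); last by ring.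
  by rewrite ler_wpM2l// !mulr_ge0 ?exprn_ge0 ?cn_ge0.
apply: aeW => x /andP[x0 xz].
have hx : 0 <= x <= T by rewrite (ltW x0) (le_trans (ltW xz)).
rewrite big_ord_recl P0' scaler0 add0r.
have -> : \sum_(i0 < n) hh ^+ lift ord0 i0 *: P' (lift ord0 i0) x =
    hh *: (K x *m \sum_(k < n) hh ^+ k *: P k x).
  rewrite mulmx_sumr scaler_sumr; apply: eq_bigr => k _.
  by rewrite lift0 PE// -scalemxAr scalerA exprS.
rewrite -scalerBr -mulmxBr mxE cnM mulmx2E.
have b k l : cn ((E n x) k l) <= M * cn hh ^+ n by exact: IH.
rewrite exprS (_ : _ * (cn hh * _) = cn hh * (KM * (M * cn hh ^+ n) + KM * (M * cn hh ^+ n))); last by ring.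
rewrite ler_wpM2l ?cn_ge0//; apply: le_trans (cnD _ _) _; rewrite !cnM.
by apply: lerD; apply: ler_pM; rewrite ?cn_ge0 ?hKM ?b.
Qed.

Lemma peano_fundamental i j : peano (fun lam => X lam T i j) lam0.
Proof.
have [P [P' [[hP P0 Pz PE] P0']]] := dyson_coefficients.
move=> n.
(* A positive order makes the bound vanish at [hh = 0], which yields [p.[0]] also when [n = 0]. *)
have [M M0 HM] := dyson_expansion hP P0 P0' Pz PE n.+1.
pose q k l : {poly C} := \sum_(m < n.+1) (P m T k l) *: 'X^m.
pose p : {poly C} := (X lam0 T i 0) *: q 0 j + (X lam0 T i 1) *: q 1 j.
have hT : 0 <= T <= T by rewrite T0 lexx.
have qE k l hh : (q k l).[hh] = (\sum_(m < n.+1) hh ^+ m *: P m T) k l.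
  rewrite summxE horner_sum; apply: eq_bigr => m _.
  by rewrite hornerZ hornerXn mxE mulrC.
have XE hh : X (lam0 + hh) T = X lam0 T *m W hh T.
  rewrite /W mulmxA; have [-> _] := adj2_det1 (solves_det (hX lam0) (X0 lam0) T).
  by rewrite mul1mx.
have [B B0 HB] := fundamental_bound `|complex.Im lam0|.
have b k l : cn (X lam0 T k l) <= B by exact: HB.
have key hh : cn hh <= 1 ->
    cn (X (lam0 + hh) T i j - p.[hh]) <= 2 * B * M * cn hh ^+ n.+1.
  move=> h1; rewrite XE mulmx2E /p hornerD !hornerZ !qE.
  set S := \sum_(_ < _) _.
  rewrite (_ : _ - _ = X lam0 T i 0 * (W hh T - S) 0 j + X lam0 T i 1 * (W hh T - S) 1 j).
    apply: le_trans (cnD _ _) _; rewrite !cnM.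
    rewrite (_ : 2 * B * M * _ = B * (M * cn hh ^+ n.+1) + B * (M * cn hh ^+ n.+1)); last by ring.
    by apply: lerD; apply: ler_pM; rewrite ?cn_ge0 ?b ?HM.
  by rewrite !mxE; ring.
exists p; split.
  have := key 0; rewrite cn0 => /(_ ler01).
  rewrite exprS mul0r mulr0 addr0 => hle.
  have : cn (X lam0 T i j - p.[0]) == 0 by rewrite eq_le hle cn_ge0.
  by rewrite cn_eq0 subr_eq0 eq_sym => /eqP.
apply: (@bigO_le _ n n.+1) => //.
by exists (2 * B * M), 1; split => //; [rewrite !mulr_ge0|move=> hh _ /key].
Qed.

End Perturbation.
End Window.
End SpectralExpansion.

(** * From half periodicity to double zeros *)

Section HalfPeriod.
Context {R : realType}.
Local Notation C := R[i].
Local Notation cmu := (@completed_lebesgue_measure R).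
Variables (w : R -> C) (X : C -> R -> 'M[C]_2) (L : R) (eps : C).
Hypotheses (hX : forall lam, solves w lam (X lam)) (X0 : forall lam, X lam 0 = 1%:M).
Hypotheses (L0 : 0 < L) (wp : forall z, w (z + 2 * L) = w z).
Hypothesis hmaj : forall T : R, exists h g, majorized w h g 0 T.
Hypothesis epsE : eps = 1 \/ eps = -1.

Definition disc lam : C := \tr (X lam (2 * L)) - 2 * eps.

Let L2 : 0 < 2 * L. Proof. by rewrite mulr_gt0. Qed.

Lemma eps_sqr : eps * eps = 1.
Proof. by case: epsE => ->; ring. Qed.

Lemma cn_eps : cn eps = 1.
Proof. by case: epsE => ->; rewrite ?cnN cn1. Qed.

Lemma fundamental_period lam z : X lam (z + 2 * L) = X lam z *m X lam (2 * L).
Proof.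
have hV : solves w lam (fun z => X lam (z + 2 * L)).
  have := solves_shift (2 * L) (hX lam).
  by rewrite (_ : (fun z => w (z + 2 * L)) = w)//; apply/funext.
by rewrite (solves_unique (hX lam) (X0 lam) hV z) add0r.
Qed.

Lemma monodromy_conj lam s : transfer (X lam) s (s + 2 * L) =
  X lam s *m X lam (2 * L) *m \adj (X lam s).
Proof. by rewrite /transfer fundamental_period. Qed.

Lemma tr_monodromy lam s : \tr (transfer (X lam) s (s + 2 * L)) = disc lam + 2 * eps.
Proof.
rewrite monodromy_conj mxtrace_mulC mulmxA.
have [_ ->] := adj2_det1 (solves_det (hX lam) (X0 lam) s).
by rewrite mul1mx /disc subrK.
Qed.

(** The characteristic polynomial at [eps], simplified by [eps * eps = 1]. It links [M - eps] to
    [d]: [|det (M - eps)| = |d|]. *)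
Lemma det_sub_scalar2 (A : 'M[C]_2) : \det A = 1 ->
  \det (A - eps%:M) = - (eps * (\tr A - 2 * eps)).
Proof.
rewrite !det2E tr2E => d1; rewrite !mxE /= ?mulr1n ?mulr0n.
have e2 := eps_sqr; move: d1.
set a := A 0 0; set b := A 0 1; set c := A 1 0; set d := A 1 1 => d1.
rewrite (_ : _ - _ * _ = (a * d - b * c) - eps * (a + d) + eps * eps); last by ring.
by rewrite d1 mulrBr mulrCA e2; ring.
Qed.

Lemma det_monodromy_sub lam s :
  \det (transfer (X lam) s (s + 2 * L) - eps%:M) = - (eps * disc lam).
Proof.
rewrite det_sub_scalar2 ?eps_sqr// ?tr_monodromy ?addrK//.
exact: transfer_det (hX lam) (X0 lam).
Qed.

(** Let [N = M - eps]. On the columns of [\adj N] the lower bound gives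
    [kappa Im lam |\adj N| <= |det N| = |d|], and [\adj N] has the entries of [N] up to sign. On the
    first basis vector it bounds the first column of [N] from below, whence the quadratic bound. *)
Lemma monodromy_sub_bound s tau0 : 0 <= s -> 0 < tau0 -> exists2 kappa, 0 < kappa &
  forall lam, 0 < complex.Im lam <= tau0 ->
    (forall i j, kappa * complex.Im lam *
      cn ((transfer (X lam) s (s + 2 * L) - eps%:M) i j) <= cn (disc lam)) /\
    kappa * complex.Im lam ^+ 2 <= cn (disc lam).
Proof.
move=> s0 tau00; have [h [g hw]] := hmaj (s + 2 * L).
have st : s < s + 2 * L by rewrite ltrDl.
have [kappa k0 H] := monodromy_lower_bound st tau00 (majorized_sub s0 (lexx _) hw).
pose k1 := Num.min kappa (kappa ^+ 2 / 2).
have k1k : k1 <= kappa by rewrite ge_min lexx.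
have k1k2 : k1 <= kappa ^+ 2 / 2 by rewrite ge_min lexx orbT.
exists k1; first by rewrite lt_min k0 divr_gt0// exprn_gt0.
move=> lam ht; have [tau_gt0 _] := andP ht; set A := transfer _ _ _.
set tau := complex.Im lam in tau_gt0 *.
have key (v : 'cV[C]_2) : kappa * tau * (cn (v 0 0) + cn (v 1 0)) <=
    cn (((A - eps%:M) *m v) 0 0) + cn (((A - eps%:M) *m v) 1 0).
  have hV := solvesM v (transfer_solves s (hX lam)).
  have := H lam _ _ eps ht (solves_akns 0 hV) cn_eps.
  rewrite /= (transfer_id s (hX lam) (X0 lam)) mul1mx -/A.
  have E (B : 'M[C]_2) i : ((B - eps%:M) *m v) i 0 = (B *m v) i 0 - eps * v i 0.
    by rewrite mulmxBl mul_scalar_mx !mxE.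
  by rewrite !E.
set N := A - eps%:M in key *.
have detN : cn (\det N) = cn (disc lam).
  by rewrite /N /A det_monodromy_sub cnN cnM cn_eps mul1r.
have entry i j : kappa * tau * cn (N i j) <= cn (disc lam).
  have adjb k l : kappa * tau * cn ((\adj N) k l) <= cn (disc lam).
    have E (B B' : 'M[C]_2) m : (B *m col l B') m 0 = (B *m B') m l.
      by rewrite !mulmx2E !mxE.
    have E' (B : 'M[C]_2) m : (col l B) m 0 = B m l by rewrite mxE.
    have := key (col l (\adj N)); rewrite !E !E' mul_mx_adj.
    have E'' (x : C) (m : 'I_2) : (x%:M : 'M[C]_2) m l = x *+ (m == l) by rewrite mxE.
    rewrite !E''.
    have -> : cn (\det N *+ (0 == l)) + cn (\det N *+ (1 == l)) = cn (disc lam).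
      have cnb (x : C) (q : bool) : cn (x *+ q) = if q then cn x else 0.
        by case: q; rewrite ?mulr1n ?mulr0n ?cn0.
      by rewrite -detN !cnb; case: (ord2P l) => ->; rewrite /= ?addr0 ?add0r.
    apply: le_trans; rewrite ler_wpM2l ?mulr_ge0 ?(ltW k0) ?(ltW tau_gt0)//.
    by case: (ord2P k) => ->; rewrite ?lerDl ?lerDr cn_ge0.
  have [i' [j' E]] : exists i' j', cn (N i j) = cn ((\adj N) i' j').
    rewrite adj2E.
    case: (ord2P i) => ->; case: (ord2P j) => ->;
    [exists 1, 1|exists 0, 1|exists 1, 0|exists 0, 0]; by rewrite [in RHS]mxE/= ?cnN.
  by rewrite E.
split=> [i j|].
  apply: le_trans (entry i j); rewrite ler_wpM2r ?cn_ge0//.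
  by rewrite ler_wpM2r// ltW.
have h1 : kappa * tau <= cn (N 0 0) + cn (N 1 0).
  have := key (delta_mx 0 0).
  have E (B : 'M[C]_2) i : (B *m (delta_mx 0 0 : 'cV_2)) i 0 = B i 0 by rewrite -colE mxE.
  have D (m : 'I_2) : cn ((delta_mx 0 0 : 'cV[C]_2) m 0) = if m == 0 then 1 else 0.
    by rewrite mxE eqxx andbT; case: (m == 0); rewrite ?cn1 ?cn0.
  by rewrite !E !D /= addr0 mulr1.
have e0 := entry 0 0; have e1 := entry 1 0.
have h2 : kappa * tau * (kappa * tau) <= 2 * cn (disc lam).
  apply: (@le_trans _ _ (kappa * tau * (cn (N 0 0) + cn (N 1 0)))).
    by rewrite ler_wpM2l ?mulr_ge0 ?(ltW k0) ?(ltW tau_gt0).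
  by rewrite mulrDr; lra.
apply: (@le_trans _ _ (kappa ^+ 2 / 2 * tau ^+ 2)).
  by rewrite ler_wpM2r// sqr_ge0.
by lra.
Qed.

Lemma disc_conj lam : disc lam^*%C = (disc lam)^*%C.
Proof.
have tr_sc (A : 'M[C]_2) : \tr (swapconj2 A) = (\tr A)^*%C.
  by rewrite !tr2E !mxE /= cJD addrC.
have c2 : (2 : C)^*%C = 2 := conjc_nat R 2.
have c2e : (2 * eps)^*%C = 2 * eps.
  by case: epsE => ->; rewrite ?mulrN ?mulr1 ?cJN c2.
rewrite /disc (swapconj2_fundamental (hX lam) (X0 lam) (hX _) (X0 _)) tr_sc.
by rewrite [RHS]cJD cJN c2e.
Qed.

Lemma disc_zero_real lam : disc lam = 0 -> complex.Im lam = 0.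
Proof.
have main l : 0 < complex.Im l -> disc l != 0.
  move=> hl; have [k k0 H] := monodromy_sub_bound (lexx 0) hl.
  have [|_ h] := H l; first by rewrite hl lexx.
  by rewrite -cn_gt0; apply: lt_le_trans h; rewrite mulr_gt0// exprn_gt0.
move=> d0; have [||//] := ltgtP (complex.Im lam) 0 => hl.
  have := main lam^*%C; rewrite cImJ oppr_gt0 => /(_ hl).
  by rewrite disc_conj d0 conjc0 eqxx.
by have := main lam hl; rewrite d0 eqxx.
Qed.

Lemma transfer_peano s t i j lam : 0 <= s -> 0 <= t ->
  peano (fun l => transfer (X l) s t i j) lam.
Proof.
move=> s0 t0.
have pX z k l : 0 <= z -> peano (fun x => X x z k l) lam.
  by move=> z0; have [h [g hw]] := hmaj z; exact: (peano_fundamental hX X0 z0 hw).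
have pA k l : peano (fun x => \adj (X x s) k l) lam.
  apply: (@peano_eq _ (fun x => if k == 0 then (if l == 0 then X x s 1 1 else - X x s 0 1)
                 else (if l == 0 then - X x s 1 0 else X x s 0 0))).
    by move=> x; rewrite adj2E mxE.
  by case: (k == 0); case: (l == 0); try exact: pX; apply: peanoN; exact: pX.
apply: (@peano_eq _ (fun x => X x t i 0 * \adj (X x s) 0 j + X x t i 1 * \adj (X x s) 1 j)).
  by move=> x; rewrite /transfer mulmx2E.
by apply: peanoD; apply: peanoM => //; exact: pX.
Qed.

Lemma disc_peano lam : peano disc lam.
Proof.
apply: (@peano_eq _ (fun l => transfer (X l) 0 (0 + 2 * L) 0 0 +
  transfer (X l) 0 (0 + 2 * L) 1 1 - 2 * eps)).
  by move=> l; rewrite -tr2E tr_monodromy addrK.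
have h : 0 <= 0 + 2 * L by rewrite add0r ltW.
by apply: peanoB; [apply: peanoD; exact: transfer_peano|exact: peano_cst].
Qed.

Let Sg : 'M[C]_2 := mx2 1 0 0 (- eps).

(** Conjugation by [Sg] keeps the diagonal of [bmat] and multiplies the off-diagonal entries by
    [- eps]. *)
Lemma solves_reflect (w' : R -> C) lam (V : R -> 'M[C]_2) :
  solves w' lam V -> solves (fun z => - eps * w' z) lam (fun z => Sg *m V z *m Sg).
Proof.
move=> hV; apply: solvesM.
apply: (mcacd_eq _ _ (mcacdM (mcacd_cst Sg) hV)) => z //.
rewrite mul0mx add0r !mulmxA; congr (_ *m _).
have eJ : eps^*%C = eps by case: epsE => ->; rewrite ?cJN conjc1.
apply: matrix2P; rewrite !mulmx2E !mxE/= ?cJM ?cJN ?eJ ?(mulr0, mul0r, addr0, add0r, mul1r, mulr1).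
- by [].
- by rewrite -[LHS]mulr1 -eps_sqr; ring.
- by ring.
- by ring.
Qed.

(** [X (2 L)] is the square of [Sg *m X L], of determinant [- eps]; the trace of a square is the
    squared trace minus twice the determinant. *)
Lemma disc_square : {ae cmu, forall z, w (z + L) = - eps * w z} ->
  forall lam, disc lam = (X lam L 0 0 - eps * X lam L 1 1) * (X lam L 0 0 - eps * X lam L 1 1).
Proof.
move=> hae lam.
have hV : solves (fun z => - eps * w z) lam (fun z => X lam (z + L)).
  exact: solves_ae hae (solves_shift L (hX lam)).
have S0 : Sg *m X lam 0 *m Sg = 1%:M.
  rewrite X0 mulmx1; apply: matrix2P; rewrite mulmx2E !mxE/= ?(mulr0, mul0r, addr0, add0r, mul1r)//.
  by rewrite mulrNN eps_sqr.
have := solves_unique (solves_reflect (hX lam)) S0 hV L.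
rewrite add0r (_ : L + L = 2 * L); last by ring.
rewrite /disc => ->.
have d1 := solves_det (hX lam) (X0 lam) L.
have tr_sq (B : 'M[C]_2) : \det B = 1 -> \tr (Sg *m B *m Sg *m B) - 2 * eps =
    (B 0 0 - eps * B 1 1) * (B 0 0 - eps * B 1 1).
  rewrite det2E tr2E !mulmx2E !mxE/= => dB.
  set a := B 0 0 in dB *; set b := B 0 1 in dB *; set c := B 1 0 in dB *; set d := B 1 1 in dB *.
  have e2 := eps_sqr.
  apply/eqP; rewrite -subr_eq0; apply/eqP.
  transitivity (2 * eps * (a * d - b * c - 1)); last by rewrite dB subrr mulr0.
  by ring.
exact: tr_sq.
Qed.

End HalfPeriod.

(** * Zeros of the discriminant of a half-periodic potential *)

Section DoubleZeros.
Context {R : realType}.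
Local Notation C := R[i].
Local Notation K := (R[i] : numFieldType).
Local Notation cmu := (@completed_lebesgue_measure R).
Variables (w : R -> C) (X : C -> R -> 'M[C]_2) (L : R) (eps : C).
Hypotheses (hX : forall lam, solves w lam (X lam)) (X0 : forall lam, X lam 0 = 1%:M).
Hypotheses (L0 : 0 < L) (wp : forall z, w (z + 2 * L) = w z).
Hypothesis hmaj : forall T : R, exists h g, majorized w h g 0 T.
Hypothesis epsE : eps = 1 \/ eps = -1.

Local Notation disc := (disc X L eps).

Lemma cn_small_eq0 (x : C) (M r : R) : 0 < r ->
  (forall t, 0 < t <= r -> cn x <= M * t) -> x = 0.
Proof.
move=> r0 H; apply/eqP; rewrite -cn_eq0 eq_le cn_ge0 andbT.
apply/ler_addgt0Pr => e e0; rewrite add0r.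
have M0 : 0 <= M.
  have := H r; rewrite r0 lexx => /(_ isT) /(le_trans (cn_ge0 x)).
  by rewrite pmulr_lge0.
have t0 : 0 < Num.min r (e / (M + 1)) by rewrite lt_min r0 divr_gt0// ltr_wpDl.
apply: le_trans (H _ _) _; first by apply/andP; split; [exact: t0|rewrite ge_min lexx].
apply: (@le_trans _ _ (M * (e / (M + 1)))); first by rewrite ler_wpM2l// ge_min lexx orbT.
by rewrite mulrA ler_pdivrMr ?ltr_wpDl// mulrC ler_pM2l// lerDl.
Qed.

Lemma cn_imag (t : R) : 0 <= t -> cn (0 +i* t) = t.
Proof. by move=> t0 /=; rewrite expr0n add0r sqrtr_sqr ger0_norm. Qed.

Lemma disc_lower_imag lam : complex.Im lam = 0 -> exists2 kappa, 0 < kappa &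
  forall t : R, 0 < t <= 1 -> kappa * t ^+ 2 <= cn (disc (lam + (0 +i* t))).
Proof.
move=> hl; have [k k0 H] := monodromy_sub_bound hX X0 L0 wp hmaj epsE (lexx 0) ltr01.
exists k => // t ht; have [|_] := H (lam + (0 +i* t)); first by rewrite cImD hl add0r.
by rewrite cImD hl add0r.
Qed.

(** If [nu'] vanished at a zero of [nu], then [d = nu^2] would be of fourth order there, against the
    quadratic lower bound in the imaginary direction. *)
Theorem only_double_zeros_of_half_period :
  {ae cmu, forall z, w (z + L) = - eps * w z} -> only_double_zeros (disc : K -> K).
Proof.
move=> hae.
pose nu lam := X lam L 0 0 - eps * X lam L 1 1.
have dE lam : disc lam = nu lam * nu lam by exact: disc_square hX X0 epsE hae lam.
have hnu lam : peano nu lam.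
  have [h [g hw]] := hmaj L.
  by apply: peanoB; [|apply: peanoM; [exact: peano_cst|]]; apply: (peano_fundamental hX X0 (ltW L0) hw).
pose c lam := projT1 (cid (peano_taylor1 (hnu lam))).
have hc lam : bigO 2 (fun h => nu (lam + h) - nu lam - c lam * h).
  by rewrite /c; case: cid.
have d1 (lam : K) : is_derive lam (1 : K) (disc : K -> K) (2 * nu lam * c lam).
  apply: bigO_is_derive.
  have h1 := peano_taylor0 (hnu lam).
  apply: (@bigO_ext _ _ (fun h => (nu (lam + h) - nu lam) * (nu (lam + h) - nu lam) +
    2 * nu lam * (nu (lam + h) - nu lam - c lam * h))) => [h _|].
    by rewrite !dE; ring.
  apply: bigOD; first exact: (bigOM h1 h1).
  exact: bigOM (bigO_cst _) (hc lam).
have d1E : derive1 (disc : K -> K) = fun lam : K => 2 * nu lam * c lam.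
  by apply/funext => lam; rewrite derive1E; have [_ ->] := d1 lam.
move=> z fz.
have nz : nu z = 0.
  by move: fz; rewrite dE => /eqP; rewrite mulf_eq0 orbb => /eqP.
pose dd (lam : K) : K := 2 * nu lam * c lam.
(* Differentiating [2 nu nu'] at a zero of [nu] uses the Lipschitz bound for [nu'] at that point. *)
have d2 : is_derive (z : K) (1 : K) dd (2 * c z * c z).
  apply: bigO_is_derive.
  have hcz := peano_derivative_lipschitz z hnu hc.
  apply: (@bigO_ext _ _ (fun h => 2 * ((nu (z + h) - nu z - c z * h) * (c (z + h) - c z) +
     (nu (z + h) - nu z - c z * h) * c z + c z * (h * (c (z + h) - c z))))) => [h _|].
    by rewrite /dd nz; ring.
  apply: (bigOM (bigO_cst 2)); apply: bigOD; first apply: bigOD.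
  - by apply: (@bigO_le _ 2 (2 + 1)) => //; exact: bigOM (hc z) hcz.
  - by have := bigOM (hc z) (bigO_cst (c z)); rewrite addn0.
  - exact: bigOM (bigO_cst _) (bigOM bigO_id hcz).
split; last first.
  rewrite /derive1n /= d1E derive1E; have [_ ->] := d2.
  have im0 := disc_zero_real hX X0 L0 wp hmaj epsE fz.
  have [k k0 Hk] := disc_lower_imag im0.
  move=> /eqP; rewrite -mulrA !mulf_eq0 pnatr_eq0 /= orbb => /eqP cz0.
  have [M [r [M0 r0 H]]] := hc z.
  suff : (k%:C : C) = 0 by move=> [k_0]; move: k0; rewrite k_0 ltxx.
  apply: (@cn_small_eq0 _ (M ^+ 2) (Num.min r 1)); first by rewrite lt_min r0 ltr01.
  move=> t /andP[t0]; rewrite le_min => /andP[tr t1].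
  have := Hk t; rewrite t0 t1 => /(_ isT); rewrite dE cnM.
  have ti : (0 +i* t : C) != 0 by rewrite -cn_gt0 cn_imag ?ltW.
  have := H _ ti; rewrite cn_imag ?(ltW t0)// => /(_ tr).
  rewrite nz subr0 cz0 mul0r subr0 => hnt hk.
  have hn0 := cn_ge0 (nu (z + (0 +i* t))).
  rewrite cn_real (ger0_norm (ltW k0)).
  have : k * t ^+ 2 <= (M * t ^+ 2) * (M * t ^+ 2) by apply: le_trans hk _; rewrite ler_pM.
  rewrite (_ : _ * _ * (_ * _) = M ^+ 2 * t ^+ 2 * t ^+ 2); last by ring.
  rewrite ler_pM2r ?exprn_gt0// => /le_trans; apply.
  by rewrite ler_wpM2l ?sqr_ge0// expr2 ler_piMr// ltW.
case=> [|[|//]] _; first exact: fz.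
by rewrite /derive1n /= d1E nz mulr0 mul0r.
Qed.

End DoubleZeros.

(** * From double zeros to half periodicity *)

Section Converse.
Context {R : realType}.
Local Notation C := R[i].
Variables (w : R -> C) (X : C -> R -> 'M[C]_2) (L : R) (eps : C).
Hypotheses (hX : forall lam, solves w lam (X lam)) (X0 : forall lam, X lam 0 = 1%:M).
Hypotheses (L0 : 0 < L) (wp : forall z, w (z + 2 * L) = w z).
Hypothesis hmaj : forall T : R, exists h g, majorized w h g 0 T.
Hypothesis epsE : eps = 1 \/ eps = -1.

Local Notation disc := (disc X L eps).

Definition hdiff s lam : 'M[C]_2 := transfer (X lam) (s + L) (s + 2 * L) -
  eps *: \adj (transfer (X lam) s (s + L)).

Lemma hdiffE s lam : hdiff s lam =
  (transfer (X lam) s (s + 2 * L) - eps%:M) *m \adj (transfer (X lam) s (s + L)).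
Proof.
rewrite /hdiff (transfer_trans s (s + L) (s + 2 * L) (hX lam) (X0 lam)).
move: (transfer_det s (s + L) (hX lam) (X0 lam)).
move: (transfer _ s (s + L)) (transfer _ (s + L) _) => A D dA.
by have [AA _] := adj2_det1 dA; rewrite mulmxBl mul_scalar_mx -mulmxA AA mulmx1.
Qed.

(** The columns start from the basis vectors, and only the upper left entry is comparable to
    [e^(- i lam L)]. *)
Lemma transfer_entries_asymptotics s (eta : R) : 0 <= s -> 0 < eta ->
  exists2 T, 0 < T & forall lam, T <= complex.Im lam ->
    let B := transfer (X lam) s (s + L) in let e := cexp lam L in
    [/\ cn (e * B 0 0 - 1) <= eta, cn (e * B 0 1) <= eta, cn (e * B 1 0) <= eta &
        cn (e * B 1 1) <= eta].
Proof.
move=> s0 eta0; have [h [g hw]] := hmaj (s + L).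
have sL : s < s + L by rewrite ltrDl.
have [T T0 H] := transfer_asymptotics sL eta0 (majorized_sub s0 (lexx _) hw).
exists T => // lam hT B e.
have hV := transfer_solves s (hX lam).
have d (k l : 'I_2) : transfer (X lam) s s k l = (k == l)%:R.
  by rewrite (transfer_id s (hX lam) (X0 lam)) mxE.
have db (b : bool) : cn (b%:R : C) <= 1 by case: b; rewrite ?cn1 ?cn0.
have sE : s + L - s = L by ring.
have H' j : cn (e * B 0 j - (0 == j)%:R) <= eta /\ cn (e * B 1 j) <= eta.
  have := H lam _ _ hT (solves_akns j hV).
  by rewrite /= !d !db sE => /(_ isT isT).
have [h00 h10] := H' 0; have [h01 h11] := H' 1.
by split => //; rewrite subr0 in h01.
Qed.

(** Scaled by [e], [D] is close to the upper left matrix unit and [\adj A] to the lower right one;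
    [tr (D A)] is governed by the two upper left entries. *)
Lemma half_period_algebra (A D : 'M[C]_2) (e : C) (eta : R) : 0 < eta -> eta <= 1 ->
  cn e <= eta ->
  [/\ cn (e * A 0 0 - 1) <= eta, cn (e * A 0 1) <= eta, cn (e * A 1 0) <= eta &
      cn (e * A 1 1) <= eta] ->
  [/\ cn (e * D 0 0 - 1) <= eta, cn (e * D 0 1) <= eta, cn (e * D 1 0) <= eta &
      cn (e * D 1 1) <= eta] ->
  let N := D - eps *: \adj A in
  [/\ cn (e * N 0 0 - 1) <= 2 * eta, cn (e * N 0 1) <= 2 * eta,
      cn (e * N 1 0) <= 2 * eta & cn (e * N 1 1 + eps) <= 2 * eta] /\
  cn (e * e * (\tr (D *m A) - 2 * eps) - 1) <= 8 * eta.
Proof.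
move=> eta0 eta1 he [a00 a01 a10 a11] [d00 d01 d10 d11].
have ceps := cn_eps epsE.
split.
  have hE (A' D' : 'M[C]_2) : let N' := D' - eps *: \adj A' in
      [/\ N' 0 0 = D' 0 0 - eps * A' 1 1, N' 0 1 = D' 0 1 + eps * A' 0 1,
          N' 1 0 = D' 1 0 + eps * A' 1 0 & N' 1 1 = D' 1 1 - eps * A' 0 0].
    by move=> N'; rewrite /N' adj2E; split; rewrite !mxE/=; ring.
  have [n00 n01 n10 n11] := hE A D.
  rewrite /= n00 n01 n10 n11 mulr_natl mulr2n; split.
  - rewrite (_ : _ - 1 = (e * D 0 0 - 1) - eps * (e * A 1 1)); last by ring.
    by apply: le_trans (cnB _ _) _; rewrite (cnM eps) ceps mul1r lerD.
  - rewrite (_ : e * _ = e * D 0 1 + eps * (e * A 0 1)); last by ring.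
    by apply: le_trans (cnD _ _) _; rewrite (cnM eps) ceps mul1r lerD.
  - rewrite (_ : e * _ = e * D 1 0 + eps * (e * A 1 0)); last by ring.
    by apply: le_trans (cnD _ _) _; rewrite (cnM eps) ceps mul1r lerD.
  - rewrite (_ : _ + eps = e * D 1 1 - eps * (e * A 0 0 - 1)); last by ring.
    by apply: le_trans (cnB _ _) _; rewrite (cnM eps) ceps mul1r lerD.
rewrite tr2E !mulmx2E.
pose p := e * D 0 0 - 1; pose q := e * A 0 0 - 1.
rewrite (_ : _ - 1 = p + q + p * q + (e * D 0 1) * (e * A 1 0) +
  (e * D 1 0) * (e * A 0 1) + (e * D 1 1) * (e * A 1 1) - (2 * eps) * (e * e)); last first.
  by rewrite /p /q; ring.
have c2 : cn (2 * eps) <= 2.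
  by rewrite cnM ceps mulr1 (_ : (2 : C) = (2 : R)%:C) ?cn_real ?ger0_norm// rmorph_nat.
have prod (x y : C) : cn x <= eta -> cn y <= eta -> cn (x * y) <= eta.
  move=> hx hy; rewrite cnM -[leRHS]mulr1; apply: ler_pM; rewrite ?cn_ge0//.
  exact: le_trans hy eta1.
apply: le_trans (cnB _ _) _.
have : cn ((2 * eps) * (e * e)) <= 2 * eta.
  by rewrite cnM; apply: ler_pM; rewrite ?cn_ge0 ?prod.
(* Six terms of size [eta], and [2 * eta] from [2 * eps], make up the constant 8. *)
set r1 := _ + _ + _ + _ + _ + _; have : cn r1 <= eta + eta + eta + eta + eta + eta.
  rewrite /r1; do 4 (apply: le_trans (cnD _ _) _; apply: lerD; last exact: prod).
  by apply: le_trans (cnD _ _) _; apply: lerD; [exact: d00|exact: a00].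
by lra.
Qed.

Lemma hdiff_asymptotics s (eta : R) : 0 <= s -> 0 < eta -> eta <= 1 ->
  exists2 T, 0 < T & forall lam, T <= complex.Im lam ->
    let N := hdiff s lam in let e := cexp lam L in
    [/\ cn (e * N 0 0 - 1) <= 2 * eta, cn (e * N 0 1) <= 2 * eta,
        cn (e * N 1 0) <= 2 * eta & cn (e * N 1 1 + eps) <= 2 * eta] /\
    cn (e * e * disc lam - 1) <= 8 * eta.
Proof.
move=> s0 eta0 eta1.
have sL0 : 0 <= s + L by rewrite addr_ge0// ltW.
have [T1 T10 H1] := transfer_entries_asymptotics s0 eta0.
have [T2 T20 H2] := transfer_entries_asymptotics sL0 eta0.
(* Beyond [T3] the modulus of [e^(i lam L)] is at most [eta], which controls the term [2 eps] of
   [d]. *)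
pose T3 := (eta * L)^-1.
have T30 : 0 < T3 by rewrite invr_gt0 mulr_gt0.
exists (T1 + T2 + T3); first by rewrite !addr_gt0.
move=> lam hT N e.
have he : cn e <= eta.
  rewrite (_ : cn e = expR (- (complex.Im lam * L))); last exact: cn_cexp.
  have tau0 : 0 < complex.Im lam by lra.
  apply: le_trans (expRN_le_inv _) _; first by rewrite mulr_gt0.
  rewrite -(invrK eta) lef_pV2 ?posrE ?invr_gt0 ?mulr_gt0//.
  apply: (@le_trans _ _ (T3 * L)); last by rewrite ler_pM2r//; lra.
  by rewrite /T3 invfM -mulrA mulVf ?mulr1// gt_eqF.
have t1 : T1 <= complex.Im lam by lra.
have t2 : T2 <= complex.Im lam by lra.
have sLL : s + L + L = s + 2 * L by ring.
have := H1 lam t1; have := H2 lam t2.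
rewrite sLL /= -/e.
set A := transfer (X lam) s (s + L); set D := transfer (X lam) (s + L) (s + 2 * L).
move=> hD hA; have := half_period_algebra eta0 eta1 he hA hD.
rewrite /D /A -(transfer_trans s (s + L) (s + 2 * L) (hX lam) (X0 lam)).
by rewrite (tr_monodromy eps hX X0 wp) addrK.
Qed.

End Converse.

(** * Conjugation symmetry and growth of the matrix [N] *)

Section ConverseMain.
Context {R : realType}.
Local Notation C := R[i].
Variables (w : R -> C) (X : C -> R -> 'M[C]_2) (L : R) (eps : C).
Hypotheses (hX : forall lam, solves w lam (X lam)) (X0 : forall lam, X lam 0 = 1%:M).
Hypotheses (L0 : 0 < L) (wp : forall z, w (z + 2 * L) = w z).
Hypothesis hmaj : forall T : R, exists h g, majorized w h g 0 T.
Hypothesis epsE : eps = 1 \/ eps = -1.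

Local Notation dsc := (disc X L eps).
Local Notation hdf := (hdiff X L eps).

Lemma swapconj2M (A B : 'M[C]_2) : swapconj2 (A *m B) = swapconj2 A *m swapconj2 B.
Proof.
by apply: matrix2P; rewrite !mulmx2E [LHS]mxE !(mxE matrix_key) /= mulmx2E cJD !cJM addrC.
Qed.

Lemma swapconj2_adj (A : 'M[C]_2) : swapconj2 (\adj A) = \adj (swapconj2 A).
Proof.
by rewrite !adj2E; apply: matrix2P; rewrite !mxE /= ?cJN.
Qed.

Lemma swapconj2_entry (A : 'M[C]_2) i j :
  swapconj2 A i j = ((A (if i == 0 then 1 else 0) (if j == 0 then 1 else 0))^*)%C.
Proof. by rewrite mxE; case: (i == 0); case: (j == 0). Qed.

Lemma hdiff_conj s lam : hdf s lam^*%C = swapconj2 (hdf s lam).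
Proof.
have tr t t' : transfer (X lam^*%C) t t' = swapconj2 (transfer (X lam) t t').
  rewrite /transfer swapconj2M swapconj2_adj.
  by rewrite -!(swapconj2_fundamental (hX lam) (X0 lam) (hX _) (X0 _)).
have eJ : eps^*%C = eps by case: epsE => ->; rewrite ?cJN conjc1.
rewrite /hdiff !tr -swapconj2_adj; move: (transfer _ _ _) (\adj _) => A B.
by apply/matrixP => i j; rewrite !(swapconj2_entry, mxE) cJD cJN cJM eJ.
Qed.

Lemma hdiff_peano s i j lam : 0 <= s -> peano (fun l => hdf s l i j) lam.
Proof.
move=> s0; have sL : 0 <= s + L by rewrite addr_ge0// ltW.
have s2L : 0 <= s + 2 * L by rewrite addr_ge0// mulr_ge0// ltW.
have adjE l : \adj (transfer (X l) s (s + L)) = transfer (X l) (s + L) s.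
  by rewrite /transfer adj2M adj2K.
apply: (@peano_eq _ (fun l => transfer (X l) (s + L) (s + 2 * L) i j -
   eps * transfer (X l) (s + L) s i j)).
  by move=> l; rewrite /hdiff adjE; move: (transfer _ _ _) (transfer _ _ _) => A B; rewrite !mxE.
apply: peanoB; first exact: transfer_peano.
by apply: peanoM; [exact: peano_cst|exact: transfer_peano].
Qed.

(** For [0 < Im lam <= T], [N = (M - eps) C^-1] with [|M - eps| <= |d| / (kappa Im lam)], and one of
    the two resulting factors [|d|] is bounded. Above [T] the asymptotics apply; conjugation covers
    the lower half-plane. *)
Lemma hdiff_product_bound s : 0 <= s -> exists2 M, 0 <= M &
  forall lam i j k l, cn (hdf s lam i j * hdf s lam k l) * complex.Im lam ^+ 2 <=
    M * (1 + `|complex.Im lam|) ^+ 2 * cn (dsc lam).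
Proof.
move=> s0.
suff [M M0 H] : exists2 M, 0 <= M & forall lam i j k l, 0 < complex.Im lam ->
    cn (hdf s lam i j * hdf s lam k l) * complex.Im lam ^+ 2 <=
    M * (1 + `|complex.Im lam|) ^+ 2 * cn (dsc lam).
  exists M => // lam i j k l.
  have [il|il|il] := ltgtP (complex.Im lam) 0; last first.
  - rewrite il expr0n mulr0 normr0; apply: mulr_ge0; last exact: cn_ge0.
    by rewrite mulr_ge0// sqr_ge0.
  - exact: H.
  have := H lam^*%C (if i == 0 then 1 else 0) (if j == 0 then 1 else 0)
    (if k == 0 then 1 else 0) (if l == 0 then 1 else 0).
  rewrite cImJ oppr_gt0 => /(_ il).
  rewrite hdiff_conj (disc_conj L hX X0 epsE) cnJ sqrrN normrN.
  have sw (m : 'I_2) : (if (if m == 0 then 1 else 0 : 'I_2) == 0 then 1 else 0) = m.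
    by case: m => [[|[|//]] hm]; exact/val_inj.
  by rewrite !swapconj2_entry !sw -cJM cnJ.
(* With [eta = 1 / 32] the asymptotics give [|e^2 d| >= 1 / 2] and [|e N_ij| <= 2], whence the
   constant [8 = 2 * 2 * 2] above the strip. *)
have e32 : 0 < 32^-1 :> R by rewrite invr_gt0.
have e32' : 32^-1 <= 1 :> R by rewrite invf_le1// ler1n.
have [T T0 HT] := hdiff_asymptotics hX X0 L0 wp hmaj epsE s0 e32 e32'.
have [kappa k0 Hk] := monodromy_sub_bound hX X0 L0 wp hmaj epsE s0 T0.
have s2L : 0 <= s + 2 * L by rewrite addr_ge0// mulr_ge0// ltW.
have [h [g hw]] := hmaj (s + 2 * L).
have [B B0 HB] := fundamental_bound hX X0 hw T.
(* In the strip [Q] bounds [|d|] and [2 * B * B] bounds the entries of [C^-1]. *)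
pose Q := 2 * B + 2; pose P := 4 * (2 * B * B) ^+ 2 * Q / kappa ^+ 2.
have Q0 : 0 <= Q by rewrite addr_ge0// mulr_ge0.
have P0 : 0 <= P by rewrite divr_ge0 ?sqr_ge0// !mulr_ge0// sqr_ge0.
exists (8 + P); first by rewrite addr_ge0.
move=> lam i j k l tau0; set tau := complex.Im lam in tau0 *.
rewrite (ger0_norm (ltW tau0)) cnM.
have ceps := cn_eps epsE.
have dp := cn_ge0 (dsc lam).
have t1 : tau ^+ 2 <= (1 + tau) ^+ 2.
  by rewrite ler_pXn2r ?nnegrE ?addr_ge0 ?(ltW tau0)// lerDr.
have one : 1 <= (1 + tau) ^+ 2 by rewrite expr_ge1 ?lerDl// ?addr_ge0// ltW.
have [tT|Tt] := leP tau T.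
  have [Hn _] := Hk lam ltac:(apply/andP; split => //).
  have bX z a b : 0 <= z <= s + 2 * L -> cn (X lam z a b) <= B.
    by move=> hz; apply: HB => //; rewrite (ger0_norm (ltW tau0)).
  have hs : 0 <= s <= s + 2 * L by rewrite s0 lerDl mulr_ge0// ltW.
  have hsL : 0 <= s + L <= s + 2 * L by apply/andP; split; lra.
  have h2L : 0 <= 2 * L <= s + 2 * L by apply/andP; split; lra.
  have bA z a b : 0 <= z <= s + 2 * L -> cn ((\adj (X lam z)) a b) <= B.
    move=> hz; rewrite adj2E mxE.
    by case: (a == 0); case: (b == 0); rewrite ?cnN; exact: bX.
  have bt a b : cn ((\adj (transfer (X lam) s (s + L))) a b) <= 2 * B * B.
    rewrite /transfer adj2M adj2K mulmx2E; apply: le_trans (cnD _ _) _; rewrite !cnM.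
    rewrite (_ : 2 * B * B = B * B + B * B); last by ring.
    by apply: lerD; apply: ler_pM; rewrite ?cn_ge0 ?bX ?bA.
  have dQ : cn (dsc lam) <= Q.
    rewrite /disc tr2E; apply: le_trans (cnB _ _) _; apply: lerD.
      rewrite (_ : 2 * B = B + B); last by ring.
      by apply: le_trans (cnD _ _) _; apply: lerD; exact: bX.
    rewrite cnM ceps mulr1 (_ : (2 : C) = (2 : R)%:C) ?cn_real ?ger0_norm//.
    by rewrite rmorph_nat.
  have nb a b : kappa * tau * cn (hdf s lam a b) <= 2 * (2 * B * B) * cn (dsc lam).
    rewrite (hdiffE L eps hX X0) mulmx2E.
    apply: (@le_trans _ _ (kappa * tau * (cn ((transfer (X lam) s (s + 2 * L) - eps%:M) a 0) * (2 * B * B) +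
       cn ((transfer (X lam) s (s + 2 * L) - eps%:M) a 1) * (2 * B * B)))).
      apply: ler_wpM2l; first by rewrite mulr_ge0// ltW.
      apply: le_trans (cnD _ _) _; rewrite !cnM.
      by apply: lerD; apply: ler_wpM2l; rewrite ?cn_ge0.
    have := Hn a 0; have := Hn a 1; move: (cn (_ a 0)) (cn (_ a 1)) => x y hy hx.
    rewrite (_ : kappa * tau * _ = (kappa * tau * x + kappa * tau * y) * (2 * B * B)); last by ring.
    rewrite (_ : 2 * (2 * B * B) * _ = (cn (dsc lam) + cn (dsc lam)) * (2 * B * B)); last by ring.
    apply: ler_wpM2r; first by rewrite !mulr_ge0.
    exact: lerD.
  have kt0 : 0 <= kappa * tau by rewrite mulr_ge0// ltW.
  have := ler_pM (mulr_ge0 kt0 (cn_ge0 _)) (mulr_ge0 kt0 (cn_ge0 _)) (nb i j) (nb k l).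
  have k2 : 0 < kappa ^+ 2 by rewrite exprn_gt0.
  move=> hh; rewrite -(ler_pM2l k2).
  rewrite (_ : kappa ^+ 2 * (_ * _ * _) = kappa * tau * cn (hdf s lam i j) *
    (kappa * tau * cn (hdf s lam k l))); last by ring.
  apply: le_trans hh _.
  rewrite (_ : _ * (_ * cn (dsc lam)) = 4 * (2 * B * B) ^+ 2 * (cn (dsc lam) * cn (dsc lam))); last by ring.
  apply: (@le_trans _ _ (4 * (2 * B * B) ^+ 2 * (Q * cn (dsc lam)))).
    by rewrite ler_wpM2l ?mulr_ge0 ?sqr_ge0// ler_wpM2r.
  have PE : kappa ^+ 2 * P = 4 * (2 * B * B) ^+ 2 * Q.
    by rewrite /P mulrC divfK// gt_eqF.
  rewrite (mulrA (4 * _)) -PE -(mulrA (kappa ^+ 2)) ler_pM2l//.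
  apply: ler_wpM2r => //; rewrite -[leLHS]mulr1; apply: ler_pM => //.
  by rewrite lerDr.
have := HT lam (ltW Tt); set e := cexp lam L.
have e0 : 0 < cn e by rewrite /e cn_cexp expR_gt0.
case=> -[n00 n01 n10 n11] hd.
have big a b : cn (e * hdf s lam a b) <= 2.
  have b1 : 2 * 32^-1 <= 1 :> R by lra.
  case: (ord2P a) => ->; case: (ord2P b) => ->.
  - by rewrite -(subrK 1 (e * _)); apply: le_trans (cnD _ _) _; rewrite cn1; lra.
  - by lra.
  - by lra.
  - by rewrite -(addrK eps (e * _)); apply: le_trans (cnB _ _) _; rewrite ceps; lra.
have dlow : 2^-1 <= cn (e * e * dsc lam).
  have : cn (1 : C) <= cn (e * e * dsc lam) + cn (e * e * dsc lam - 1).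
    by apply: le_trans (cnB _ _); rewrite opprB addrC subrK.
  by rewrite cn1; lra.
have e2 : 0 < cn e * cn e by rewrite mulr_gt0.
rewrite !cnM in dlow.
have {}big a b : cn e * cn (hdf s lam a b) <= 2 by rewrite -cnM.
have hNN : cn (hdf s lam i j) * cn (hdf s lam k l) <= 8 * cn (dsc lam).
  rewrite -(ler_pM2l e2).
  have := ler_pM (mulr_ge0 (ltW e0) (cn_ge0 _)) (mulr_ge0 (ltW e0) (cn_ge0 _)) (big i j) (big k l).
  by lra.
apply: (@le_trans _ _ (8 * cn (dsc lam) * (1 + tau) ^+ 2)).
  by apply: ler_pM => //; rewrite ?sqr_ge0// mulr_ge0 ?cn_ge0.
rewrite mulrAC ler_wpM2r// ler_wpM2r ?sqr_ge0// lerDl.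
exact: P0.
Qed.

End ConverseMain.

(** * The entire quotients and the relation between the two half-period transfers *)

Section HalfPeriodFromDoubleZeros.
Context {R : realType}.
Local Notation C := R[i].
Local Notation K := (R[i] : numFieldType).
Variables (w : R -> C) (X : C -> R -> 'M[C]_2) (L : R) (eps : C).
Hypotheses (hX : forall lam, solves w lam (X lam)) (X0 : forall lam, X lam 0 = 1%:M).
Hypotheses (L0 : 0 < L) (wp : forall z, w (z + 2 * L) = w z).
Hypothesis hmaj : forall T : R, exists h g, majorized w h g 0 T.
Hypothesis epsE : eps = 1 \/ eps = -1.

Local Notation dsc := (disc X L eps).
Local Notation hdf := (hdiff X L eps).

Lemma peano_zero (f : C -> C) z : peano f z -> f z = 0 -> bigO 1 (fun h => f (z + h)).
Proof.
by move=> /peano_taylor0 h fz; apply: bigO_ext h => h _; rewrite fz subr0.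
Qed.

(** Numerator and denominator are multiplied by [e^2]; [eta <= 1 / 16] keeps [|e^2 d|] above
    [1 / 2]. *)
Lemma quotient_limit (x y d e sx sy : C) (eta : R) : 0 < eta -> eta <= 16^-1 ->
  cn (e * x - sx) <= 2 * eta -> cn (e * y - sy) <= 2 * eta ->
  cn sx <= 1 -> cn sy <= 1 -> cn (e * e * d - 1) <= 8 * eta ->
  cn (x * y / d - sx * sy) <= 32 * eta.
Proof.
move=> eta0 eta1 hx hy sx1 sy1 hd.
have low : 2^-1 <= cn (e * e * d).
  have : cn (1 : C) <= cn (e * e * d) + cn (e * e * d - 1).
    by apply: le_trans (cnB _ _); rewrite opprB addrC subrK.
  by rewrite cn1; lra.
have ed0 : e * e * d != 0 by rewrite -cn_gt0; apply: lt_le_trans low; rewrite invr_gt0.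
have [e0 d0] : e != 0 /\ d != 0.
  by move: ed0; rewrite !mulf_eq0 !negb_or => /andP[/andP[? _] ?].
have -> : x * y / d - sx * sy = ((e * x - sx) * (e * y - sy) + sx * (e * y - sy) +
    (e * x - sx) * sy - sx * sy * (e * e * d - 1)) / (e * e * d).
  by field; rewrite e0 d0.
rewrite cnM cnV ler_pdivrMr; last by rewrite cn_gt0.
apply: (@le_trans _ _ (16 * eta)); last first.
  by have := ler_wpM2l (ltW eta0) low; lra.
have p1 : cn ((e * x - sx) * (e * y - sy)) <= eta.
  rewrite cnM; apply: (@le_trans _ _ (2 * eta * (2 * eta))).
    by apply: ler_pM; rewrite ?cn_ge0.
  by nra.
have p2 : cn (sx * (e * y - sy)) <= 2 * eta.
  by rewrite cnM -[leRHS]mul1r; apply: ler_pM; rewrite ?cn_ge0.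
have p3 : cn ((e * x - sx) * sy) <= 2 * eta.
  by rewrite cnM -[leRHS]mulr1; apply: ler_pM; rewrite ?cn_ge0.
have p4 : cn (sx * sy * (e * e * d - 1)) <= 8 * eta.
  rewrite cnM -[leRHS]mul1r; apply: ler_pM; rewrite ?cn_ge0//.
  by rewrite cnM -[leRHS]mulr1; apply: ler_pM; rewrite ?cn_ge0.
apply: le_trans (cnB _ _) _; apply: (@le_trans _ _ (eta + 2 * eta + 2 * eta + 8 * eta)); last by lra.
apply: lerD => //; apply: le_trans (cnD _ _) _; apply: lerD => //.
by apply: le_trans (cnD _ _) _; exact: lerD.
Qed.

Hypothesis dbl : only_double_zeros (dsc : K -> K).

(** The vanishing derivative gives the upper order; the coefficient of [h^2] is nonzero by the lower
    bound in the imaginary direction. This two-sided form is what the quotient lemma takes. *)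
Lemma disc_double_zero z0 : dsc z0 = 0 -> bigO 2 (fun h => dsc (z0 + h)) /\
  exists c r, [/\ 0 < c, 0 < r &
    forall h, h != 0 -> cn h <= r -> c * cn h ^+ 2 <= cn (dsc (z0 + h))].
Proof.
move=> dz; have [hd _] := dbl dz.
have pd := disc_peano eps hX X0 L0 wp hmaj z0.
have d2 : bigO 2 (fun h => dsc (z0 + h)).
  have [c hc] := peano_taylor1 pd.
  have der : is_derive (z0 : K) (1 : K) (dsc : K -> K) c by exact: bigO_is_derive.
  have c0 : c = 0.
    have := hd 1%N isT; rewrite /derive1n /= derive1E; have [_ ->] := der.
    by [].
  by apply: bigO_ext hc => h _; rewrite c0 dz mul0r !subr0.
split => //.
have [c1 [c2 h3]] := peano_taylor2 pd.
have c10 : c1 = 0.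
  apply: bigO_cst1; apply: bigO_divX.
  apply: (@bigO_ext _ _ (fun h => dsc (z0 + h) - (dsc (z0 + h) - (dsc z0 + c1 * h + c2 * (h * h)))
     - c2 * (h * h))) => [h _|]; first by rewrite dz; ring.
  apply: bigOB; last exact: (bigOM (bigO_cst c2) (bigOM bigO_id bigO_id)).
  by apply: bigOB => //; exact: bigO_le h3.
have [M [r [M0 r0 H]]] := h3.
have {}H h : h != 0 -> cn h <= r -> cn (dsc (z0 + h) - c2 * (h * h)) <= M * cn h ^+ 3.
  by move=> h0 hr; have := H h h0 hr; rewrite dz c10 mul0r !add0r.
have im0 := disc_zero_real hX X0 L0 wp hmaj epsE dz.
have [k k0 Hk] := disc_lower_imag hX X0 L0 wp hmaj epsE im0.
have c20 : 0 < cn c2.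
  rewrite cn_gt0; apply/eqP => c20.
  suff : (k%:C : C) = 0 by move=> [k_0]; move: k0; rewrite k_0 ltxx.
  apply: (@cn_small_eq0 _ _ M (Num.min r 1)); first by rewrite lt_min r0 ltr01.
  move=> t /andP[t0]; rewrite le_min => /andP[tr t1].
  have := Hk t; rewrite t0 t1 => /(_ isT).
  have ti : (0 +i* t : C) != 0 by rewrite -cn_gt0 cn_imag ?ltW.
  have := H _ ti; rewrite cn_imag ?(ltW t0)// => /(_ tr).
  rewrite c20 mul0r subr0 => hnt hk.
  rewrite cn_real (ger0_norm (ltW k0)).
  have := le_trans hk hnt.
  by rewrite (_ : M * t ^+ 3 = M * t * t ^+ 2) ?ler_pM2r ?exprn_gt0//; ring.
exists (cn c2 / 2), (Num.min r (cn c2 / 2 / (M + 1))); split.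
- by rewrite divr_gt0.
- by rewrite lt_min r0 !divr_gt0// ltr_wpDl.
move=> h h0; rewrite le_min => /andP[hr]; rewrite ler_pdivlMr ?ltr_wpDl// => hM.
have := H h h0 hr.
have : cn (c2 * (h * h)) <= cn (dsc (z0 + h)) + cn (dsc (z0 + h) - c2 * (h * h)).
  by apply: le_trans (cnB _ _); rewrite opprB addrC subrK.
rewrite !cnM => h1 h2.
have hh : 0 <= cn h ^+ 2 by rewrite sqr_ge0.
have : cn h * M * cn h ^+ 2 <= cn c2 / 2 * cn h ^+ 2.
  by rewrite ler_wpM2r//; apply: le_trans hM; rewrite mulrDr mulr1 lerDl cn_ge0.
by move: h1 h2; rewrite !exprS !expr0; lra.
Qed.

(** Approaching the real zero vertically, [|M - eps| <= |d| / (kappa t)] with [d = O(t^2)], so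
    [M = eps] there. *)
Lemma hdiff_eq0 s z0 i j : 0 <= s -> dsc z0 = 0 -> hdf s z0 i j = 0.
Proof.
move=> s0 dz; have [d2 _] := disc_double_zero dz.
have s2L : 0 <= s + 2 * L by rewrite addr_ge0// mulr_ge0// ltW.
have im0 := disc_zero_real hX X0 L0 wp hmaj epsE dz.
have [kappa k0 Hk] := monodromy_sub_bound hX X0 L0 wp hmaj epsE s0 ltr01.
suff A0 a b : (transfer (X z0) s (s + 2 * L) - eps%:M) a b = 0.
  by rewrite (hdiffE L eps hX X0) mulmx2E !A0 !mul0r addr0.
pose f l := (transfer (X l) s (s + 2 * L) - eps%:M) a b.
have pf : peano f z0.
  apply: (@peano_eq _ (fun l => transfer (X l) s (s + 2 * L) a b - (eps%:M : 'M[C]_2) a b)).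
    by move=> l; rewrite /f; move: (transfer _ _ _) => B; rewrite !mxE.
  apply: peanoB; last exact: peano_cst.
  exact: (transfer_peano hX X0 hmaj).
have [M [r [M0 r0 H]]] := peano_taylor0 pf.
have [M' [r' [M0' r0' H']]] := d2.
apply: (@cn_small_eq0 _ (f z0) (M + M' / kappa) (Num.min (Num.min r r') 1)).
  by rewrite !lt_min r0 r0' ltr01.
move=> t /andP[t0]; rewrite !le_min => /andP[/andP[tr tr'] t1].
have ti : (0 +i* t : C) != 0 by rewrite -cn_gt0 cn_imag ?ltW.
have := H _ ti; rewrite cn_imag ?(ltW t0)// => /(_ tr); rewrite expr1 => h1.
have := H' _ ti; rewrite cn_imag ?(ltW t0)// => /(_ tr') h2.
have [|h3 _] := Hk (z0 + (0 +i* t)); first by rewrite cImD im0 /= add0r t0.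
have := h3 a b; rewrite -/(f _) cImD im0 /= add0r => {}h3.
have h4 : cn (f (z0 + (0 +i* t))) <= M' / kappa * t.
  rewrite mulrAC ler_pdivlMr// mulrC -(ler_pM2r t0).
  rewrite (_ : _ * _ * t = kappa * t * cn (f (z0 + (0 +i* t)))); last by ring.
  by apply: le_trans h3 _; apply: le_trans h2 _; rewrite expr2 mulrA.
have : cn (f z0) <= cn (f (z0 + (0 +i* t))) + cn (f (z0 + (0 +i* t)) - f z0).
  by apply: le_trans (cnB _ _); rewrite opprB addrC subrK.
by move=> /le_trans; apply; rewrite mulrDl [leRHS]addrC; exact: lerD h4 h1.
Qed.

(** The quotient extends to an entire function, constant by [liouville]; its value is read off at
    [i T] for large [T]. *)
Lemma hdiff_product_const s i j k l (sx sy : C) : 0 <= s -> cn sx <= 1 -> cn sy <= 1 ->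
  (forall eta : R, 0 < eta -> eta <= 1 -> exists2 T, 0 < T & forall lam, T <= complex.Im lam ->
    [/\ cn (cexp lam L * hdf s lam i j - sx) <= 2 * eta,
        cn (cexp lam L * hdf s lam k l - sy) <= 2 * eta &
        cn (cexp lam L * cexp lam L * dsc lam - 1) <= 8 * eta]) ->
  forall lam, dsc lam != 0 -> hdf s lam i j * hdf s lam k l = sx * sy * dsc lam.
Proof.
move=> s0 sx1 sy1 Hlim.
have pN a b z : peano (fun l => hdf s l a b) z by exact: (hdiff_peano eps hX X0 L0 hmaj).
have [||z dz|g [Hg gE]] := @peano_quot R 2 (fun l' => hdf s l' i j * hdf s l' k l) dsc.
- by move=> z; apply: peanoM.
- exact: (disc_peano eps hX X0 L0 wp hmaj).
- have [d2 low] := disc_double_zero dz; split => //.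
  have N1 a b : bigO 1 (fun h => hdf s (z + h) a b).
    exact: (peano_zero (pN a b z) (hdiff_eq0 a b s0 dz)).
  exact: (bigOM (N1 i j) (N1 k l)).
have dneq z : complex.Im z != 0 -> dsc z != 0.
  move=> iz; apply: contraNneq iz => dz.
  by rewrite (disc_zero_real hX X0 L0 wp hmaj epsE dz).
have [M M0 HM] := hdiff_product_bound hX X0 L0 wp hmaj epsE s0.
have gb z : cn (g z) * complex.Im z ^+ 2 <= M * (1 + `|complex.Im z|) ^+ 2.
  have [->|iz] := eqVneq (complex.Im z) 0.
    by rewrite expr0n mulr0 normr0 mulr_ge0// sqr_ge0.
  have dz := dneq z iz; have dz0 : 0 < cn (dsc z) by rewrite cn_gt0.
  by rewrite gE// cnM cnV mulrAC ler_pdivrMr.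
have gc := liouville Hg gb.
have g0 : g 0 - sx * sy = 0.
  apply: (@cn_small_eq0 _ _ 32 16^-1); first by rewrite invr_gt0.
  move=> eta /andP[eta0 eta1].
  have [T T0 HT] := Hlim eta eta0 ltac:(lra).
  have [|h1 h2 h3] := HT (0 +i* T); first by [].
  have iT : complex.Im (0 +i* T : C) != 0 by rewrite /= gt_eqF.
  rewrite -(gc (0 +i* T)) gE; last exact: dneq.
  exact: (quotient_limit eta0 eta1 h1 h2 sx1 sy1 h3).
move=> lam dl; have := gE lam dl; rewrite gc => gl.
have -> : sx * sy = g 0 by apply/esym/eqP; rewrite -subr_eq0 g0.
by rewrite gl divfK.
Qed.

(** The products force [N = diag (nu, - eps nu)] with [nu] nonzero. Then [det D = det A], for
    [D = N + eps \adj A], becomes [eps nu (A00 - eps A11 - nu) = 0], which fixes [nu]. *)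
Lemma half_period_algebra_converse (A D : 'M[C]_2) (d : C) : \det A = 1 -> \det D = 1 ->
  d != 0 -> let N := D - eps *: \adj A in
  N 0 0 * N 0 0 = d -> N 0 0 * N 0 1 = 0 -> N 0 0 * N 1 0 = 0 -> N 0 0 * N 1 1 = - eps * d ->
  [/\ D 0 0 = A 0 0, D 0 1 = - eps * A 0 1, D 1 1 = A 1 1 & A 0 0 - eps * A 1 1 != 0].
Proof.
move=> dA dD d0 N n00 n01 n10 n11.
have e2 := eps_sqr epsE.
have nu0 : N 0 0 != 0 by apply: contra_neq d0 => n0; rewrite -n00 n0 mul0r.
have z01 : N 0 1 = 0 by move/eqP: n01; rewrite mulf_eq0 (negPf nu0) => /eqP.
have z10 : N 1 0 = 0 by move/eqP: n10; rewrite mulf_eq0 (negPf nu0) => /eqP.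
have z11 : N 1 1 = - eps * N 0 0.
  by apply: (mulfI nu0); rewrite n11 -n00; ring.
have [E00 E01 E10 E11] : [/\ N 0 0 = D 0 0 - eps * A 1 1, N 0 1 = D 0 1 + eps * A 0 1,
    N 1 0 = D 1 0 + eps * A 1 0 & N 1 1 = D 1 1 - eps * A 0 0].
  by rewrite /N adj2E; split; rewrite !mxE/=; ring.
move: dA dD; rewrite !det2E; move: z01 z10 z11 nu0; rewrite E00 E01 E10 E11.
move: (A 0 0) (A 0 1) (A 1 0) (A 1 1) (D 0 0) (D 0 1) (D 1 0) (D 1 1) => a b c e p q r t.
move=> /eqP; rewrite addr_eq0 => /eqP qE /eqP; rewrite addr_eq0 => /eqP rE tE nu0 dA dD.
have nuE : p - eps * e = a - eps * e -> [/\ p = a, q = - eps * b, t = e & a - eps * e != 0].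
  move=> h; have pa : p = a by move: h => /(congr1 (fun x => x + eps * e)); rewrite !subrK.
  split => //.
  - by rewrite qE mulNr.
  - have -> : t = (t - eps * a) + eps * a by rewrite subrK.
    by rewrite tE h -[RHS]mul1r -e2; ring.
  - by rewrite -h.
apply: nuE; have tE' : t = eps * a - eps * (p - eps * e).
  by rewrite -(subrK (eps * a) t) tE; ring.
set nu := p - eps * e in nu0 tE' *.
have pE : p = nu + eps * e by rewrite /nu subrK.
have : nu * (eps * (a - eps * e - nu)) = 0.
  transitivity (p * t - q * r - (eps * eps) * (a * e - b * c) + (eps * eps - 1) * 0).
    by rewrite pE tE' qE rE; ring.
  by rewrite dD dA e2; ring.
move=> /eqP; rewrite !mulf_eq0 (negPf nu0)/= => /orP[/eqP e0|/eqP h].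
  by move: e2; rewrite e0 mul0r => /esym/eqP; rewrite oner_eq0.
by apply/esym/eqP; rewrite -subr_eq0 h.
Qed.

Lemma half_transfer_relation s lam : 0 <= s -> dsc lam != 0 ->
  let A := transfer (X lam) s (s + L) in let D := transfer (X lam) (s + L) (s + 2 * L) in
  [/\ D 0 0 = A 0 0, D 0 1 = - eps * A 0 1, D 1 1 = A 1 1 & A 0 0 - eps * A 1 1 != 0].
Proof.
move=> s0 dl A D.
have ceps := cn_eps epsE.
have Hl (eta : R) : 0 < eta -> eta <= 1 -> exists2 T, 0 < T & forall lam, T <= complex.Im lam ->
    let N := hdf s lam in let e := cexp lam L in
    [/\ cn (e * N 0 0 - 1) <= 2 * eta, cn (e * N 0 1) <= 2 * eta,
        cn (e * N 1 0) <= 2 * eta & cn (e * N 1 1 + eps) <= 2 * eta] /\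
    cn (e * e * dsc lam - 1) <= 8 * eta.
  by move=> eta0 eta1; exact: (hdiff_asymptotics hX X0 L0 wp hmaj epsE s0 eta0 eta1).
have c1 : cn (1 : C) <= 1 by rewrite cn1.
have c0 : cn (0 : C) <= 1 by rewrite cn0.
have ce : cn (- eps) <= 1 by rewrite cnN ceps.
apply: (half_period_algebra_converse (transfer_det _ _ (hX lam) (X0 lam))
  (transfer_det _ _ (hX lam) (X0 lam)) dl).
- rewrite (@hdiff_product_const s 0 0 0 0 1 1)// ?mul1r// => eta eta0 eta1.
  by have [T T0 HT] := Hl eta eta0 eta1; exists T => // x /HT[[]].
- rewrite (@hdiff_product_const s 0 0 0 1 1 0)// ?mulr0 ?mul0r// => eta eta0 eta1.
  by have [T T0 HT] := Hl eta eta0 eta1; exists T => // x /HT[[? ? ? ?] ?]; rewrite subr0.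
- rewrite (@hdiff_product_const s 0 0 1 0 1 0)// ?mulr0 ?mul0r// => eta eta0 eta1.
  by have [T T0 HT] := Hl eta eta0 eta1; exists T => // x /HT[[? ? ? ?] ?]; rewrite subr0.
- rewrite (@hdiff_product_const s 0 0 1 1 1 (- eps))// ?mul1r// => eta eta0 eta1.
  by have [T T0 HT] := Hl eta eta0 eta1; exists T => // x /HT[[? ? ? ?] ?]; rewrite opprK.
Qed.

End HalfPeriodFromDoubleZeros.

(** * Recovering the potential from the transfer matrices *)

Section HalfPeriodConclusion.
Context {R : realType}.
Local Notation C := R[i].
Local Notation K := (R[i] : numFieldType).
Local Notation cmu := (@completed_lebesgue_measure R).

Lemma acd_unique (f f' f'' : R -> R) : acd f f' -> acd f f'' ->
  {ae cmu, forall z, f' z = f'' z}.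
Proof.
move=> [_ h1] [_ h2]; apply: (ae_imply2 _ h1 h2) => z d1 d2.
by have [_ <-] := d1; have [_ <-] := d2.
Qed.

Lemma cacd_unique (f f' f'' : R -> C) : cacd f f' -> cacd f f'' ->
  {ae cmu, forall z, f' z = f'' z}.
Proof.
move=> [r1 i1] [r2 i2]; apply: (ae_imply2 _ (acd_unique r1 r2) (acd_unique i1 i2)).
by move=> z; exact: complex_eqP.
Qed.

Lemma periodic_ge0 (p z : R) : 0 < p -> exists n : nat, 0 <= z + n%:R * p.
Proof.
move=> p0; have h := archi_boundP (divr_ge0 (normr_ge0 z) (ltW p0)).
exists (Num.bound (`|z| / p)); move: h; rewrite ltr_pdivrMr // => h.
move: h (ler_norm (- z)); rewrite normrN; lra.
Qed.

Variables (w : R -> C) (X : C -> R -> 'M[C]_2) (L : R) (eps : C).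
Hypotheses (hX : forall lam, solves w lam (X lam)) (X0 : forall lam, X lam 0 = 1%:M).
Hypotheses (L0 : 0 < L) (wp : forall z, w (z + 2 * L) = w z).
Hypothesis hmaj : forall T : R, exists h g, majorized w h g 0 T.
Hypothesis epsE : eps = 1 \/ eps = -1.

(* The transfer [F z] over the half period starting at [z] satisfies
   [F' = B (w (z + L)) F - F B (w z)]; comparing the upper right entries of
   [F (z + L)]' and [F z]' isolates [w (z + L) + eps w z]. *)
Theorem half_period_of_only_double_zeros :
  only_double_zeros (disc X L eps : K -> K) ->
  {ae cmu, forall z, w (z + L) = - eps * w z}.
Proof.
(* A single nonreal parameter suffices, the zeros of [d] being real. *)
move=> dbl; pose lam : C := iC.
have dl : disc X L eps lam != 0.
  apply/eqP => /(disc_zero_real hX X0 L0 wp hmaj epsE)/eqP.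
  by rewrite /= oner_eq0.
have eE : eps * eps = 1 := eps_sqr epsE.
have [F [F' [hF F'E Fper rel0]]] : exists F F' : R -> 'M[C]_2, [/\ mcacd F F',
    forall y, F' y 0 1 = - (iC * lam) * F y 0 1 + iC * (w (y + L))^*%C * F y 1 1 -
      (F y 0 0 * (iC * (w y)^*%C) + F y 0 1 * (iC * lam)),
    forall z, F (z + 2 * L) = F z
    & forall z, 0 <= z -> [/\ F (z + L) 0 0 = F z 0 0,
      F (z + L) 0 1 = - eps * F z 0 1,
      F (z + L) 1 1 = F z 1 1 & F z 0 0 - eps * F z 1 1 != 0]].
  exists (fun z => transfer (X lam) z (z + L)).
  exists (fun z => bmat (w (z + L)) lam *m transfer (X lam) z (z + L) -
                   transfer (X lam) z (z + L) *m bmat (w z) lam).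
  split=> [|y|z|z z0].
  - apply: (mcacd_eq _ _ (mcacdM (mcacd_shift L (hX lam)) (mcacd_adj (hX lam)))) => z //.
    by rewrite /transfer adj2M adj_bmat !mulmxN !mulmxA.
  - move: (transfer _ _ _) => A.
    have E (B D : 'M[C]_2) : (B - D) 0 1 = B 0 1 - D 0 1 by rewrite !mxE.
    have [a00 a01 _ _] := mx2E (- (iC * lam)) (iC * (w (y + L))^*%C) (- (iC * w (y + L))) (iC * lam).
    have [_ b01 _ b11] := mx2E (- (iC * lam)) (iC * (w y)^*%C) (- (iC * w y)) (iC * lam).
    have p01 := mulmx2E (bmat (w (y + L)) lam) A 0 1.
    have q01 := mulmx2E A (bmat (w y) lam) 0 1.
    by rewrite E p01 q01 a00 a01 b01 b11.
  - rewrite /transfer (_ : z + 2 * L + L = z + L + 2 * L); last by ring.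
    rewrite !(fundamental_period hX X0 wp) adj2M -mulmxA (mulmxA (X lam (2 * L))).
    by have [-> _] := adj2_det1 (solves_det (hX lam) (X0 lam) (2 * L)); rewrite mul1mx.
  have := half_transfer_relation hX X0 L0 wp hmaj epsE dbl z0 dl.
  by rewrite (_ : z + L + L = z + 2 * L); last by ring.
(* The relation is known for [z >= 0]; the period [2 L] of [F] carries it to all [z]. *)
have rel z : [/\ F (z + L) 0 0 = F z 0 0, F (z + L) 0 1 = - eps * F z 0 1,
    F (z + L) 1 1 = F z 1 1 & F z 0 0 - eps * F z 1 1 != 0].
  have p0 : 0 < 2 * L by rewrite mulr_gt0.
  have [n zn] := periodic_ge0 z p0.
  have := rel0 _ zn; rewrite addrAC.
  by rewrite !(periodic_mulrn Fper).
have h1 := mcacd_shift L hF 0 1.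
have h2 := cacdZ (- eps) (hF 0 1).
have h3 : cacd (fun z => F (z + L) 0 1) (fun z => - eps * F' z 0 1).
  by apply: (cacd_eq _ _ h2) => z //; have [_ -> _ _] := rel z.
apply: (ae_imply _ (cacd_unique h1 h3)) => z.
have [r00 r01 r11 rn] := rel z.
have wLL : w (z + L + L) = w z by rewrite -(wp z); congr w; ring.
rewrite !F'E wLL r00 r01 r11 => E.
have iC0 : (iC : C) != 0 by rewrite -cn_gt0 cn_iC.
suff : (w (z + L))^*%C = (- eps * w z)^*%C by move=> /(congr1 conjc); rewrite !conjcK.
have eJ : eps^*%C = eps by case: epsE => ->; rewrite ?cJN conjc1.
rewrite cJM cJN eJ; apply/eqP; rewrite -subr_eq0.
(* The terms with [lam] agree on both sides of [E]; the others combine into this product, whose last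
   factor is nonzero by [rel]. *)
suff : iC * ((w (z + L))^*%C - - eps * (w z)^*%C) * (F z 0 0 - eps * F z 1 1) = 0.
  by move=> /eqP; rewrite !mulf_eq0 (negPf iC0) (negPf rn) orbF.
move: E; move: (F z 0 0) (F z 0 1) (F z 1 1) => f q l; move: ((w _)^*%C) ((w _)^*%C) => v2 v.
move=> /eqP; rewrite -subr_eq0 => /eqP E.
rewrite -[LHS]opprK -[RHS]oppr0; congr (- _); rewrite -[RHS]E.
transitivity (- (iC * (v2 * f + eps * v * f - eps * v2 * l - (eps * eps) * (v * l)))); first by ring.
by rewrite eE; ring.
Qed.

End HalfPeriodConclusion.

(** * Reduction of the canonical system *)

Section DiracSystem.
Context {R : realType}.
Local Notation C := R[i].
Local Notation K := (R[i] : numFieldType).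
Local Notation cmu := (@completed_lebesgue_measure R).
Implicit Types (Q : R -> 'M[R]_2) (lam : C).

(** Since [J^-1 = - J], the system reads [Y' = J (Q - lam) Y]. *)
Definition dmat (A : 'M[R]_2) lam : 'M[C]_2 :=
  Jmx _ *m (map_mx (real_complex R) A - lam%:M).

Lemma Jmx_sqr (F : comNzRingType) : Jmx F *m Jmx F = - 1%:M.
Proof.
by apply: matrix2P; rewrite mulmx2E !mxE /= ?mulr1n ?mulr0n; ring.
Qed.

Lemma solution_mcacd Q lam Y : is_solution Q lam Y ->
  mcacd Y (fun z => dmat (Q z) lam *m Y z).
Proof.
move=> [hac hae].
have hd i j : {ae cmu, forall z,
    is_deriveC (fun t => Y t i j) z ((dmat (Q z) lam *m Y z) i j)}.
  apply: (ae_imply _ hae) => z [Y' dY' eqY].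
  suff <- : Y' = dmat (Q z) lam *m Y z by exact: dY'.
  rewrite /dmat -mulmxA mulmxBl mul_scalar_mx -eqY opprD addrCA subrr addr0.
  by rewrite mulmxN mulmxA Jmx_sqr mulNmx mul1mx opprK.
by move=> i j; have [hr hi] := hac i j; split; split => //;
  apply: (ae_imply _ (hd i j)) => z [].
Qed.

(* Coordinates of a vector in the basis [(1, i), (1, -i)]. *)
Definition zsbasis : 'M[C]_2 := mx2 1 1 iC (- iC).
Definition zscoord : 'M[C]_2 := mx2 (2^-1) (- (iC / 2)) (2^-1) (iC / 2).

Let two0 : (2 : C) != 0. Proof. by rewrite pnatr_eq0. Qed.
Let iC2 : (iC * iC : C) = -1.
Proof. by apply: complex_eqP; rewrite /= ?mulr0 ?mul0r ?mulr1 ?addr0 ?sub0r ?oppr0. Qed.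

Lemma zscoordK : zscoord *m zsbasis = 1%:M.
Proof.
apply: matrix2P; rewrite mulmx2E !mxE /= ?mulr1n ?mulr0n; move: iC iC2 two0 => i i2 t0;
  by field: i2.
Qed.

Lemma zsbasisK : zsbasis *m zscoord = 1%:M.
Proof. exact: mulmx1C zscoordK. Qed.

Lemma zscoord_dmat (p s : R) lam :
  zscoord *m dmat (mx2 p s s (- p)) lam = bmat (p +i* s) lam *m zscoord.
Proof.
have [E1 E2] : (p +i* s) = p%:C + iC * s%:C /\ (p +i* s)^*%C = p%:C - iC * s%:C.
  by split; apply: complex_eqP; rewrite ?(cReM, cImM, cReD, cImD, cReN, cImN) /=; ring.
rewrite /bmat E2 E1.
apply: matrix2P; rewrite !mulmx2E !mxE /= ?mulr1n ?mulr0n ?rmorphN /=;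
 move: iC iC2 two0 p%:C s%:C => i i2 t0 x y; by field: i2.
Qed.

Lemma canonical_mx2 Q : canonical_potential Q ->
  forall z, Q z = mx2 (Q z 0 0) (Q z 0 1) (Q z 0 1) (- Q z 0 0).
Proof.
by move=> [p [s h]] z; rewrite h; have [-> -> _ _] := mx2E (p z) (s z) (s z) (- p z).
Qed.

Definition potential Q z : C := Q z 0 0 +i* Q z 0 1.

Lemma potential_scale Q (T c : R) z : canonical_potential Q ->
  (potential Q (z + T) = c%:C * potential Q z) <-> (Q (z + T) = c *: Q z).
Proof.
move=> Qc; split => [h|h].
  have := congr1 (@complex.Re R) h; have := congr1 (@complex.Im R) h.
  rewrite cReM cImM /= !mul0r addr0 subr0 => h1 h0.
  rewrite (canonical_mx2 Qc (z + T)) (canonical_mx2 Qc z) h0 h1.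
  have E (a b : R) : mx2 (c * a) (c * b) (c * b) (- (c * a)) =
      c *: mx2 a b b (- a).
    by apply: matrix2P; rewrite !mxE //= mulrN.
  exact: E.
by apply: complex_eqP; rewrite ?cReM ?cImM /= h !mxE; ring.
Qed.

Lemma solves_potential Q lam Y : canonical_potential Q -> is_solution Q lam Y ->
  solves (potential Q) lam (fun z => zscoord *m Y z *m zsbasis).
Proof.
move=> Qc hY; apply: solvesM.
apply: (mcacd_eq _ _ (mcacdM (mcacd_cst zscoord) (solution_mcacd hY))) => z //.
rewrite mul0mx add0r (mulmxA zscoord) (mulmxA (bmat _ _)); congr (_ *m _).
by rewrite (canonical_mx2 Qc z) zscoord_dmat.
Qed.

Lemma potential_majorized Q (p T : R) : 0 < p -> periodic_with p Q ->
  integrable_mx `[0, p[%classic Q -> exists h g, majorized (potential Q) h g 0 T.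
Proof.
move=> p0 Qp Qi.
have qp z : `|Q (z + p) 0 0| + `|Q (z + p) 0 1| = `|Q z 0 0| + `|Q z 0 1|.
  by rewrite Qp.
have qi : cmu.-integrable `[0, p[%classic (fun z => (`|Q z 0 0| + `|Q z 0 1|)%:E).
  have i0 := integrable_abse (Qi 0 0); have i1 := integrable_abse (Qi 0 1).
  have mD : (measurable : set (set (caratheodory_type (@wlength R idfun)^*%mu))) `[0, p[%classic.
    by apply: sub_caratheodory; exact: measurable_itv.
  by apply: eq_integrable (integrableD mD i0 i1) => // z _ /=; rewrite EFinD.
have Tn : exists n : nat, T <= n%:R * p.
  by have [n hn] := periodic_ge0 (- T) p0; exists n; move: hn; rewrite addrC subr_ge0.
have [n hn] := Tn.
have [h [g [hg hae]]] := exists_majorant n p0 qp qi.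
exists h, g; split => //; apply: (ae_imply _ hae) => z + /andP[z0 zT]; apply.
rewrite (lt_le_trans zT hn) andbT (le_trans _ (ltW z0))// oppr_le0.
by rewrite mulr_ge0 // ltW.
Qed.

(** Here [eps = - c]. The change of basis preserves the trace of the monodromy, so both cases become
    instances of the results on [disc]. *)
Lemma half_period_double_zeros Q (L c : R) (Y : C -> R -> 'M[C]_2) :
  0 < L -> c = 1 \/ c = -1 -> canonical_potential Q -> periodic_with (2 * L) Q ->
  integrable_mx `[0, 2 * L[%classic Q -> is_fundamental_solution Q Y ->
  {ae cmu, forall z, Q (z + L) = c *: Q z} <->
  only_double_zeros ((fun lam => \tr (Y lam (2 * L)) + 2 * c%:C) : K -> K).
Proof.
move=> L0 cE Qc Qp Qi hY.
pose X lam z := zscoord *m Y lam z *m zsbasis.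
have p0 : 0 < 2 * L by rewrite mulr_gt0.
have hX lam : solves (potential Q) lam (X lam).
  by apply: solves_potential => //; have [] := hY lam.
have X0 lam : X lam 0 = 1%:M.
  by rewrite /X; have [_ ->] := hY lam; rewrite mulmx1 zscoordK.
have wp z : potential Q (z + 2 * L) = potential Q z by rewrite /potential Qp.
have hmaj T : exists h g, majorized (potential Q) h g 0 T.
  exact: potential_majorized p0 Qp Qi.
have epsE : - c%:C = 1 \/ - c%:C = -1.
  by case: cE => ->; [right | left]; rewrite ?rmorphN ?rmorph1 ?opprK.
have -> : (fun lam => \tr (Y lam (2 * L)) + 2 * c%:C) = disc X L (- c%:C).
  apply/funext => lam; rewrite /disc /X mxtrace_mulC mulmxA zsbasisK mul1mx.
  by rewrite mulrN opprK.
split=> [hae|hz].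
  apply: (only_double_zeros_of_half_period hX X0 L0 wp hmaj epsE).
  apply: (ae_imply _ hae) => z; rewrite opprK.
  by have [_] := potential_scale L c z Qc.
apply: (ae_imply _ (half_period_of_only_double_zeros hX X0 L0 wp hmaj epsE hz)) => z.
by rewrite opprK; have [] := potential_scale L c z Qc.
Qed.

End DiracSystem.

Theorem corollary5p3 (R : realType) (Q : R -> 'M[R]_2)
    (Q_canonical : canonical_potential Q)
    (Q_periodic : periodic_with pi Q)
    (Q_integrable : integrable_mx `[0, pi[%classic Q)
    (Y : R[i] -> R -> 'M[R[i]]_2)
    (Y_fundamental : is_fundamental_solution Q Y) :
  (ae_periodic (pi / 2) Q <->
     only_double_zeros (fun lam : R[i] => discriminant Y lam + 2)) /\
  (ae_antiperiodic (pi / 2) Q <->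
     only_double_zeros (fun lam : R[i] => discriminant Y lam - 2)).
Proof.
have L0 : 0 < (pi : R) / 2 by rewrite divr_gt0 // pi_gt0.
have piE : 2 * (pi / 2) = pi :> R by rewrite mulrC divfK // pnatr_eq0.
have H c : c = 1 \/ c = -1 ->
    {ae @completed_lebesgue_measure R, forall z, Q (z + pi / 2) = c *: Q z} <->
    only_double_zeros (fun lam : R[i] => discriminant Y lam + 2 * c%:C).
  move=> cE; have := @half_period_double_zeros R Q (pi / 2) c Y L0 cE Q_canonical.
  by rewrite piE; apply.
split.
  have := H 1 (or_introl erefl); rewrite rmorph1 mulr1 => <-.
  by split; apply: ae_imply => z; rewrite scale1r.
have := H (-1) (or_intror erefl); rewrite rmorphN1 mulrN1 => <-.
by split; apply: ae_imply => z; rewrite scaleN1r.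
Qed.
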